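(* Let $f,g:\mathbb{R}^n\to\mathbb{R}^n$ be $C^\infty$ vector fields with $f(0)=0$, and consider the single-input control-affine system $$\dot x=f(x)+u\,g(x),\qquad (x,u)\in\mathbb{R}^n\times\mathbb{R}. \qquad (\ast)$$ Assume that there exists a smooth, positive definite and proper function $V:\mathbb{R}^n\to\mathbb{R}^+$ such that for every $x\neq 0$, either $(gV)(x)\neq 0$, or $(gV)(x)=0$ and at least one of the following (A), (B) holds. (A) $(fV)(x)<0$. (B) There exists an integer $N=N(x)\ge 1$ such that $$(\Delta_1\Delta_2\cdots\Delta_kV)(x)=0\quad\text{for all }k=1,2,\dots\text{ and all }\Delta_1,\dots,\Delta_k\in L\{f,g\}\text{ with }\sum_{p=1}^k\mathrm{order}\,\Delta_p\le N,$$ and one of the following two properties P1, P2 is fulfilled: - P1: $(f^{N+1}V)(x)<0$. - P2: $(f^{N+1}V)(x)\le 0$ and, further, one of the following holds: - P2(i): $N$ is a positive integer and there exists an odd integer $j=j(N)\in\{1,\dots,N\}$ such that $(\lambda_{N+1,j}V)(x)\neq 0$; moreover, if $j>2$, then for every even positive integer $q<j$, $$(\Delta_1\cdots\Delta_kV)(x)=0\quad\text{for all }k=1,2,\dots\text{ and all }\Delta_1,\dots,\Delta_k\in L\{f,g\}\text{ with }\sum_{p=1}^k\mathrm{order}\,\Delta_p=N+1,\ \sum_{p=1}^k\mathrm{order}_{\{g\}}\Delta_p=q. \qquad (\ast\ast)$$ - P2(ii): $N>2$ is an odd integer and there exists an odd integer $j=j(N)\in\{1,\dots,N-2\}$ such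 that $(\lambda_{N+1,j}V)(x)\neq 0$ and $(\ast\ast)$ holds for every even positive integer $q$ with $j<q<N$. - P2(iii): $N$ is even and $(\lambda_{N+1,N}V)(x)<0$. Then there exists a function $a\in K$ such that for every $\sigma>0$ and every $x\ne 0$ there exist a constant $\varepsilon=\varepsilon(x)\in(0,\sigma]$ and a measurable and locally essentially bounded control $u(\cdot,x):[0,\varepsilon]\to\mathbb{R}$ with $$V(\pi(\varepsilon,0,x,u(\cdot,x)))<V(x),\qquad V(\pi(s,0,x,u(\cdot,x)))\le a(V(x))\quad\forall s\in[0,\varepsilon];$$ hence, system $(\ast)$ is SDF-SGAS.
   Context: Notation. $|x|$ is the Euclidean norm, $\mathbb{R}^+=[0,\infty)$, $\mathbb{N}_0=\{0,1,2,\dots\}$. For $C^1$ maps $X:\mathbb{R}^n\to\mathbb{R}^k$, $Y:\mathbb{R}^k\to\mathbb{R}^l$ write $XY:=(DY)X$, where $DY$ is the derivative of $Y$; in particular, for a vector field $X$ and a scalar function $V$ on $\mathbb{R}^n$, $(XV)(x)=DV(x)X(x)$, and $\Delta_1\Delta_2\cdots\Delta_kV$ means $\Delta_1(\Delta_2(\cdots(\Delta_kV)))$. For vector fields, $[X,Y]:=XY-YX=(DY)X-(DX)Y$. Also $f^1V:=fV$ and $f^iV:=f(f^{i-1}V)$ for $i\geq 2$. $\mathrm{Lie}\{f,g\}$ is the Lie algebra generated by $\{f,g\}$. Class $K$ is the set of continuous strictly increasing functions $a:\mathbb{R}^+\to\mathbb{R}^+$ with $a(0)=0$. Order. Let $L_1:=\mathrm{span}\{f,g\}$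 and $L_{i+1}:=\mathrm{span}\{[X,Y]: X\in L_i,\ Y\in L_1\}$, $i=1,2,\dots$. For nonzero $\Delta\in\mathrm{Lie}\{f,g\}$: $\mathrm{order}\,\Delta:=1$ if $\Delta\in L_1\setminus\{0\}$, and $\mathrm{order}\,\Delta:=k>1$ if $\Delta=\Delta_1+\Delta_2$ with $\Delta_1\in L_k\setminus\{0\}$ and $\Delta_2\in\mathrm{span}\bigcup_{i=1}^{k-1}L_i$. Write $\mathrm{order}_{\{g\}}\Delta=l$, $l\in\mathbb{N}_0$, when $\Delta\in\mathrm{Lie}\{f,g\}$ is contained in the linear span of all Lie monomials of $f$ and $g$ involving $g$ exactly $l$ times. The vector fields $\lambda_{\kappa,j}$ and $L\{f,g\}$. Put $\lambda_{1,0}:=f$, and for $\kappa=2,3,\dots$ and $j=1,\dots,\kappa-1$ let $$\lambda_{\kappa,j}:=\sum_{\substack{r_1,\dots,r_j\in\mathbb{N}_0\\ r_1+\cdots+r_j=\kappa-j-1}} B_{r_1,\dots,r_j},$$ where $B_{r_1,\dots,r_j}$ is the left-nested iterated bracket obtained by starting from $f$ and successively bracketing on the right (i.e. replacing the current $Z$ by $[Z,\cdot]$) with the letters, in this order: $g$, then $f$ ($r_j$ times), then $g$, then $f$ ($r_{j-1}$ times), then $g$, ..., then $f$ ($r_2$ times), then $g$, then $f$ ($r_1$ times) (so $g$ occurs exactly $j$ times). For example $\lambda_{2,1}=[f,g]$, $\lambda_{3,1}=[[f,g],f]$, $\lambda_{3,2}=[[f,g],g]$, $\lambda_{4,2}=[[[f,g],f],g]+[[[f,g],g],f]$.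 Define $$L\{f,g\}:=\mathrm{span}\{\lambda_{\kappa,j}:\ \lambda_{1,0},\ \text{and }\kappa=2,3,\dots,\ j=1,\dots,\kappa-1\}.$$ One has $\mathrm{order}\,\lambda_{\kappa,j}=\kappa$ and $\mathrm{order}_{\{g\}}\lambda_{\kappa,j}=j$. Trajectories. For a system $\dot x=F(x,u)$, $(x,u)\in\mathbb{R}^n\times\mathbb{R}^m$, $F(0,0)=0$, and a measurable and locally essentially bounded control $u:[s,T_{\max})\to\mathbb{R}^m$, $\pi(\cdot,s,x,u)$ denotes the trajectory with $\pi(s,s,x,u)=x$, where $T_{\max}=T_{\max}(s,x,u)$ is its maximal existence time. For system $(\ast)$, $F(x,u)=f(x)+ug(x)$ and $m=1$. SDF-SGAS. The system $\dot x=F(x,u)$ is Semi-Globally Asymptotically Stabilizable by Sampled-Data Feedback (SDF-SGAS) if for every $R>0$ and every partition of times $T_1:=0<T_2<T_3<\cdots<T_\nu<\cdots$ with $T_\nu\to\infty$ and $T_{\nu+1}-T_\nu$, $\nu=1,2,\dots$, bounded, there exist a neighborhood $\Omega$ of $0$ with $\{x\in\mathbb{R}^n:|x|\le R\}\subset\Omega$ and a map $k:\mathbb{R}^+\times\Omega\to\mathbb{R}^m$ such that for each $x\in\Omega$ the map $k(\cdot,x)$ is measurable and essentially bounded, and the trajectories $\pi(\cdot)$ of the sampled-data closed-loop system $\dot\pi=F(\pi,k(t,\pi(T_i)))$, $t\in[T_i,T_{i+1})$, $i=1,2,\dots$, with $\pi(0)\in\Omega$ satisfy: (Stability) for every $\varepsilon>0$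 there is $\delta=\delta(\varepsilon)>0$ such that $|\pi(0)|\le\delta\Rightarrow|\pi(t)|\le\varepsilon$ for all $t\ge0$ and any $\pi(0)\in\Omega$; (Attractivity) $\lim_{t\to+\infty}\pi(t)=0$ for every $\pi(0)\in\Omega$. *)

(* Defs.v *)
From HB Require Import structures.
From mathcomp Require Import all_boot all_order all_algebra.
From mathcomp Require Import all_classical all_reals all_analysis.
Set Implicit Arguments.
Unset Strict Implicit.
Unset Printing Implicit Defensive.
Import Order.TTheory GRing.Theory Num.Theory.
Import numFieldNormedType.Exports.
Local Open Scope classical_set_scope.
Local Open Scope ring_scope.

(* The library's norm on row vectors is the sup norm. *)
Definition enorm (R : realType) (n : nat) (x : 'rV[R]_n) : R :=
  Num.sqrt (\sum_i x 0 i ^+ 2).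

(* The guard [differentiable] matters: ['d h x] is unspecified otherwise.  In
   finite dimension, continuity of every [fun x => 'd h x v] is continuity of
   the derivative, so this is the usual class C^k. *)
Fixpoint Ck (R : realType) (n : nat) (W : normedModType R) (k : nat)
    (h : 'rV[R]_n -> W) : Prop :=
  match k with
  | 0 => continuous h
  | k'.+1 => (forall x, differentiable h x) /\
             (forall v, Ck k' (fun x => 'd h x v))
  end.

Definition smooth (R : realType) (n : nat) (W : normedModType R)
    (h : 'rV[R]_n -> W) : Prop := forall k, Ck k h.

Definition positive_definite (R : realType) (n : nat) (V : 'rV[R]_n -> R) :=
  V 0 = 0 /\ forall x, x != 0 -> 0 < V x.

Definition proper_map (R : realType) (n : nat) (V : 'rV[R]_n -> R) :=
  forall K : set R, compact K -> compact (V @^-1` K).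

Definition classK (R : realType) (a : R -> R) :=
  [/\ {within `[0, +oo[, continuous a},
      {in `[0, +oo[ &, {homo a : s t / s < t}} &
      a 0 = 0].

(* XY := (DY)X, for scalar as well as vector-valued Y. *)
Definition lder (R : realType) (n : nat) (W : normedModType R)
    (X : 'rV[R]_n -> 'rV[R]_n) (Y : 'rV[R]_n -> W) : 'rV[R]_n -> W :=
  fun x => 'd Y x (X x).

(* The sign is that of (DY)X - (DX)Y. *)
Definition bracket (R : realType) (n : nat) (X Y : 'rV[R]_n -> 'rV[R]_n) :
    'rV[R]_n -> 'rV[R]_n :=
  fun x => lder X Y x - lder Y X x.

(* D_0 (D_1 (... (D_(k-1) V))) *)
Definition lder_seq (R : realType) (n k : nat)
    (D : 'I_k -> 'rV[R]_n -> 'rV[R]_n) (V : 'rV[R]_n -> R) : 'rV[R]_n -> R :=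
  foldr (fun p W => lder (D p) W) V (enum 'I_k).

Definition vf_span (R : realType) (n : nat)
    (S : set ('rV[R]_n -> 'rV[R]_n)) : set ('rV[R]_n -> 'rV[R]_n) :=
  [set X | exists (k : nat) (c : 'I_k -> R) (Y : 'I_k -> 'rV[R]_n -> 'rV[R]_n),
     (forall i, S (Y i)) /\ forall x, X x = \sum_i c i *: Y i x].

(* [lie_monomial f g l X]: X is an iterated bracket of f and g, with any
   bracketing, in which g occurs exactly l times. *)
Inductive lie_monomial (R : realType) (n : nat) (f g : 'rV[R]_n -> 'rV[R]_n) :
    nat -> ('rV[R]_n -> 'rV[R]_n) -> Prop :=
| lie_monomial_f : lie_monomial f g 0 f
| lie_monomial_g : lie_monomial f g 1 g
| lie_monomial_bracket l m X Y :
    lie_monomial f g l X -> lie_monomial f g m Y ->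
    lie_monomial f g (l + m) (bracket X Y).

Definition Lie (R : realType) (n : nat) (f g : 'rV[R]_n -> 'rV[R]_n) :=
  vf_span [set X | exists l, lie_monomial f g l X].

(* The layers L_1, L_2, ... ; the index 0 is a dummy. *)
Fixpoint lie_layer (R : realType) (n : nat) (f g : 'rV[R]_n -> 'rV[R]_n)
    (i : nat) : set ('rV[R]_n -> 'rV[R]_n) :=
  match i with
  | 0 => set0
  | 1 => vf_span [set f; g]
  | i'.+1 => vf_span [set Z | exists X Y,
               [/\ lie_layer f g i' X, vf_span [set f; g] Y & Z = bracket X Y]]
  end.

(* Orders are relations rather than functions: when the brackets of f and g
   satisfy linear relations the defining clauses can hold of one vector field
   for several integers.  The zero field has no order. *)
Definition has_order (R : realType) (n : nat) (f g : 'rV[R]_n -> 'rV[R]_n)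
    (k : nat) (D : 'rV[R]_n -> 'rV[R]_n) : Prop :=
  [/\ Lie f g D, D <> cst 0 &
      (k = 1%N /\ lie_layer f g 1 D) \/
      ((1 < k)%N /\ exists D1 D2 : 'rV[R]_n -> 'rV[R]_n,
         [/\ lie_layer f g k D1, D1 <> cst 0,
             vf_span (\bigcup_(i in [set i | (1 <= i < k)%N]) lie_layer f g i) D2
           & forall x, D x = D1 x + D2 x])].

Definition has_order_g (R : realType) (n : nat) (f g : 'rV[R]_n -> 'rV[R]_n)
    (l : nat) (D : 'rV[R]_n -> 'rV[R]_n) : Prop :=
  Lie f g D /\ vf_span (lie_monomial f g l) D.

(* For r = [:: r_1; ...; r_j], [foldr] treats r_j first: starting from f,
   bracket with g, then r_j times with f, ..., then with g, then r_1 times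
   with f. *)
Definition nested_bracket (R : realType) (n : nat)
    (f g : 'rV[R]_n -> 'rV[R]_n) (r : seq nat) : 'rV[R]_n -> 'rV[R]_n :=
  foldr (fun ri Z => iter ri (fun Z' => bracket Z' f) (bracket Z g)) f r.

(* The constraint reads r_1 + ... + r_j = kappa - j - 1, which forces
   r_i < kappa.  For kappa = 1 and j = 0 the only term is the empty sequence,
   so [lambda f g 1 0] is f. *)
Definition lambda (R : realType) (n : nat) (f g : 'rV[R]_n -> 'rV[R]_n)
    (kappa j : nat) : 'rV[R]_n -> 'rV[R]_n :=
  fun x => \sum_(r : j.-tuple 'I_kappa |
                 (((\sum_(i < j) tnth r i) + j).+1 == kappa)%N)
             nested_bracket f g [seq nat_of_ord i | i <- r] x.

Definition Lfg (R : realType) (n : nat) (f g : 'rV[R]_n -> 'rV[R]_n) :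
    set ('rV[R]_n -> 'rV[R]_n) :=
  vf_span [set X | X = lambda f g 1 0 \/
     exists kappa j, [/\ (2 <= kappa)%N, (1 <= j <= kappa.-1)%N &
                         X = lambda f g kappa j]].

Definition vanish_upto (R : realType) (n : nat) (f g : 'rV[R]_n -> 'rV[R]_n)
    (V : 'rV[R]_n -> R) (x : 'rV[R]_n) (N : nat) : Prop :=
  forall (k : nat) (D : 'I_k -> 'rV[R]_n -> 'rV[R]_n) (o : 'I_k -> nat),
    (1 <= k)%N ->
    (forall p, Lfg f g (D p)) ->
    (forall p, has_order f g (o p) (D p)) ->
    (\sum_p o p <= N)%N ->
    lder_seq D V x = 0.

Definition vanish_at (R : realType) (n : nat) (f g : 'rV[R]_n -> 'rV[R]_n)
    (V : 'rV[R]_n -> R) (x : 'rV[R]_n) (M q : nat) : Prop :=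
  forall (k : nat) (D : 'I_k -> 'rV[R]_n -> 'rV[R]_n) (o l : 'I_k -> nat),
    (1 <= k)%N ->
    (forall p, Lfg f g (D p)) ->
    (forall p, has_order f g (o p) (D p)) ->
    (forall p, has_order_g f g (l p) (D p)) ->
    (\sum_p o p = M)%N ->
    (\sum_p l p = q)%N ->
    lder_seq D V x = 0.

Definition P1 (R : realType) (n : nat) (f g : 'rV[R]_n -> 'rV[R]_n)
    (V : 'rV[R]_n -> R) (x : 'rV[R]_n) (N : nat) : Prop :=
  iter N.+1 (lder f) V x < 0.

Definition P2i (R : realType) (n : nat) (f g : 'rV[R]_n -> 'rV[R]_n)
    (V : 'rV[R]_n -> R) (x : 'rV[R]_n) (N : nat) : Prop :=
  (0 < N)%N /\
  exists j : nat,
    [/\ odd j, (1 <= j <= N)%N, lder (lambda f g N.+1 j) V x <> 0 &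
        (2 < j)%N -> forall q : nat,
          ~~ odd q -> (0 < q < j)%N -> vanish_at f g V x N.+1 q].

Definition P2ii (R : realType) (n : nat) (f g : 'rV[R]_n -> 'rV[R]_n)
    (V : 'rV[R]_n -> R) (x : 'rV[R]_n) (N : nat) : Prop :=
  [/\ (2 < N)%N, odd N &
  exists j : nat,
    [/\ odd j, (1 <= j <= N - 2)%N, lder (lambda f g N.+1 j) V x <> 0 &
        forall q : nat,
          ~~ odd q -> (j < q < N)%N -> vanish_at f g V x N.+1 q]].

Definition P2iii (R : realType) (n : nat) (f g : 'rV[R]_n -> 'rV[R]_n)
    (V : 'rV[R]_n -> R) (x : 'rV[R]_n) (N : nat) : Prop :=
  ~~ odd N /\ lder (lambda f g N.+1 N) V x < 0.

Definition P2 (R : realType) (n : nat) (f g : 'rV[R]_n -> 'rV[R]_n)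
    (V : 'rV[R]_n -> R) (x : 'rV[R]_n) (N : nat) : Prop :=
  iter N.+1 (lder f) V x <= 0 /\
  [\/ P2i f g V x N, P2ii f g V x N | P2iii f g V x N].

Definition condition_B (R : realType) (n : nat) (f g : 'rV[R]_n -> 'rV[R]_n)
    (V : 'rV[R]_n -> R) (x : 'rV[R]_n) : Prop :=
  exists N : nat,
    [/\ (1 <= N)%N, vanish_upto f g V x N & P1 f g V x N \/ P2 f g V x N].

Definition measurable_control (R : realType) (m : nat) (D : set R)
    (u : R -> 'rV[R]_m) : Prop :=
  forall i, measurable_fun D (fun t => u t 0 i).

Definition ess_bounded (R : realType) (m : nat) (D : set R)
    (u : R -> 'rV[R]_m) : Prop :=
  exists M : R, {ae @lebesgue_measure R, forall t, D t -> enorm (u t) <= M}.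

Definition loc_ess_bounded (R : realType) (m : nat) (D : set R)
    (u : R -> 'rV[R]_m) : Prop :=
  forall K : set R, compact K -> K `<=` D -> ess_bounded K u.

(* Caratheodory solutions of x' = F(x, u(t)) on [s, e], in integral form. *)
Definition is_trajectory (R : realType) (n m : nat)
    (F : 'rV[R]_n -> 'rV[R]_m -> 'rV[R]_n) (u : R -> 'rV[R]_m) (s e : R)
    (phi : R -> 'rV[R]_n) : Prop :=
  forall i : 'I_n,
    (@lebesgue_measure R).-integrable `[s, e]
      (fun tau => (F (phi tau) (u tau) 0 i)%:E) /\
    forall t, t \in `[s, e] ->
      phi t 0 i = phi s 0 i +
        \int[@lebesgue_measure R]_(tau in `[s, t]) F (phi tau) (u tau) 0 i.

Definition affine_system (R : realType) (n : nat)
    (f g : 'rV[R]_n -> 'rV[R]_n) (x : 'rV[R]_n) (u : 'rV[R]_1) : 'rV[R]_n :=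
  f x + u 0 0 *: g x.

(* The sampling times are T 0 = 0 < T 1 < ... .  Since k is only meaningful on
   Omega, a closed-loop trajectory has to be in Omega at every sampling time. *)
Definition closed_loop (R : realType) (n m : nat)
    (F : 'rV[R]_n -> 'rV[R]_m -> 'rV[R]_n) (T : nat -> R)
    (Omega : set 'rV[R]_n) (k : R -> 'rV[R]_n -> 'rV[R]_m)
    (phi : R -> 'rV[R]_n) : Prop :=
  forall i, Omega (phi (T i)) /\
    is_trajectory F (fun t => k t (phi (T i))) (T i) (T i.+1) phi.

(* Stability and attractivity speak of all t >= 0, so closed-loop trajectories
   must exist globally; this is the clause with [exists2 phi].  Only uniqueness
   of solutions makes it a statement about every closed-loop trajectory, so F
   should be locally Lipschitz in the state. *)
Definition SDF_SGAS (R : realType) (n m : nat)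
    (F : 'rV[R]_n -> 'rV[R]_m -> 'rV[R]_n) : Prop :=
  forall (r : R) (T : nat -> R),
    0 < r ->
    T 0%N = 0 -> (forall i, T i < T i.+1) -> T @ \oo --> +oo ->
    (exists M : R, forall i, T i.+1 - T i <= M) ->
  exists (Omega : set 'rV[R]_n) (k : R -> 'rV[R]_n -> 'rV[R]_m),
    [/\ nbhs (0 : 'rV[R]_n) Omega /\ [set x | enorm x <= r] `<=` Omega,
        forall x, Omega x -> measurable_control `[0, +oo[ (k ^~ x) /\
                             ess_bounded `[0, +oo[ (k ^~ x),
        forall x, Omega x -> 
          exists2 phi, closed_loop F T Omega k phi & phi 0 = x,
        forall eps : R, 0 < eps -> exists2 delta : R, 0 < delta &
          forall phi, closed_loop F T Omega k phi -> enorm (phi 0) <= delta ->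
            forall t : R, 0 <= t -> enorm (phi t) <= eps &
        forall phi, closed_loop F T Omega k phi ->
          phi t @[t --> +oo] --> (0 : 'rV[R]_n)].

(* Main.v *)
(* Write X = f + u g and Z = rho (f + w g) with X + Z = mu f.  The lambda_{k,j}
   are the coefficients of u^j in the k-1 fold bracket of f with X.  Following X
   for a short time t and then Z for time t changes V by the sum of
   t^M / M! w_M, where w_{M+1} h = X (w_M h) + w_M (Z h); since X + Z = mu f,
   w_M is a polynomial in mu and u whose coefficients are combinations of
   products of the lambda_{k,j} of total order M.  Condition (B) kills w_1, ...,
   w_N, and P1 or P2 lets one choose u and mu with w_{N+1} < 0: a small u under
   P2(i), a large u under P2(ii) and P2(iii), the parity of j deciding the sign
   of u.  The remainder is uniform near x, so by compactness V can be decreased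
   by uniform steps on {c <= V <= b}.

   For the feedback, a plan of level m drives the state from one sampling time
   to a later one while V <= 2^-m, ending with V <= 2^-m / 4.  At each sampling
   time the feedback follows a plan of the largest possible level and, among
   those, of earliest end.  Hence the level never decreases, and while it stays
   constant the planned end does not move, so the level tends to infinity. *)

Require Import Defs.
From HB Require Import structures.
From mathcomp Require Import all_boot all_order all_algebra.
From mathcomp Require Import all_classical all_reals all_analysis.
From mathcomp Require Import measurable_realfun ring lra zify.
Set Implicit Arguments.
Unset Strict Implicit.
Unset Printing Implicit Defensive.
Import Order.TTheory GRing.Theory Num.Theory.
Import numFieldNormedType.Exports.
Local Open Scope classical_set_scope.
Local Open Scope ring_scope.

(** * Smooth maps and Lie derivatives *)

(** The parameter mu is what isolates a single lambda. The coefficient of u^j in w_{N+1} V(x) mixes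
    lambda_{N+1,j} V(x) with products of several lambda's, and no hypothesis controls that sum for
    an odd j. But the power of mu records the number of factors, and the single-factor term is
    exactly the part linear in mu. So this coefficient is a polynomial in mu whose linear
    coefficient is not zero, and it differs from 0 for some mu > 1. The even powers of u killed by
    the hypotheses vanish for every mu, and the constant term in u is mu^{N+1} f^{N+1} V(x), which
    is either negative, as in P1, or zero. The requirement mu > 1 makes rho = mu - 1 positive, so
    that Z is followed forward in time.

    On the analytic side V need not decrease along a trajectory, only between its ends, so every
    estimate also carries a bound on how far V rises in between. Near the origin no uniform decrease
    is available; there the control is set to zero and V is only prevented from rising too far. *)

Section Smooth.
Context {R : realType} {n : nat}.
Notation E := 'rV[R]_n.

Lemma Ck_continuous (W : normedModType R) k (h : E -> W) :
  Ck k h -> continuous h.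
Proof. by case: k => [//|k] [dh _] x; exact: differentiable_continuous. Qed.

Lemma CkS (W : normedModType R) k (h : E -> W) : Ck k.+1 h -> Ck k h.
Proof.
elim: k h => [|k IH] h hk; first exact: (Ck_continuous hk).
by case: hk => dh dk; split => // v; exact: (IH _ (dk v)).
Qed.

Lemma Ck_cst (W : normedModType R) k (w : W) : Ck k (cst w : E -> W).
Proof.
elim: k w => [|k IH] w /=; first exact: cst_continuous.
split=> [x|v]; first exact: differentiable_cst.
have -> : (fun x => 'd (cst w : E -> W) x v) = cst 0.
  by apply/funext => x; rewrite diff_cst.
exact: (IH 0).
Qed.

Lemma diffDE (W : normedModType R) (h1 h2 : E -> W) x v :
  differentiable h1 x -> differentiable h2 x ->
  'd (h1 + h2) x v = 'd h1 x v + 'd h2 x v.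
Proof. by move=> d1 d2; exact: (congr1 (fun k => k v) (diffD d1 d2)). Qed.

Lemma diffME (h1 h2 : E -> R) x v :
  differentiable h1 x -> differentiable h2 x ->
  'd (h1 * h2) x v = h1 x * 'd h2 x v + h2 x * 'd h1 x v.
Proof. by move=> d1 d2; exact: (congr1 (fun k => k v) (diffM d1 d2)). Qed.

Lemma diffZE (W : normedModType R) (a : R) (h : E -> W) x v :
  differentiable h x -> 'd (a *: h) x v = a *: 'd h x v.
Proof. by move=> d; exact: (congr1 (fun k => k v) (diffZ a d)). Qed.

Lemma diffZlE (W : normedModType R) (a : E -> R) (w : W) x v :
  differentiable a x -> 'd (fun z => a z *: w) x v = 'd a x v *: w.
Proof. by move=> d; exact: (congr1 (fun k => k v) (diffZl w d)). Qed.

Lemma CkD (W : normedModType R) k (h1 h2 : E -> W) :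
  Ck k h1 -> Ck k h2 -> Ck k (h1 + h2).
Proof.
elim: k h1 h2 => [|k IH] h1 h2 /=.
  by move=> c1 c2 x; apply: continuousD; [exact: c1|exact: c2].
move=> [d1 c1] [d2 c2]; split=> [x|v]; first exact: differentiableD.
have -> : (fun x => 'd (h1 + h2) x v) =
    (fun x => 'd h1 x v) + (fun x => 'd h2 x v).
  by apply/funext => x; exact: diffDE.
exact: (IH _ _ (c1 v) (c2 v)).
Qed.

Lemma CkM k (a h : E -> R) : Ck k a -> Ck k h -> Ck k (a * h).
Proof.
elim: k a h => [|k IH] a h.
  by move=> c1 c2 x; apply: continuousM; [exact: c1|exact: c2].
move=> ak hk; have [da ca] := ak; have [dh ch] := hk.
split=> [x|v]; first exact: differentiableM.
have -> : (fun x => 'd (a * h) x v) =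
    a * (fun x => 'd h x v) + h * (fun x => 'd a x v).
  by apply/funext => x; exact: diffME.
exact: (CkD (IH _ _ (CkS ak) (ch v)) (IH _ _ (CkS hk) (ca v))).
Qed.

Lemma CkZl (W : normedModType R) k (a : E -> R) (w : W) :
  Ck k a -> Ck k (fun x => a x *: w).
Proof.
elim: k a => [|k IH] a /=.
  by move=> c x; apply: cvgZr_tmp; [exact: nbhs_filter|exact: (c x)].
move=> [da ca]; split=> [x|v]; first exact: differentiableZl.
have -> : (fun x => 'd (fun z => a z *: w) x v) = fun x => 'd a x v *: w.
  by apply/funext => x; exact: diffZlE.
exact: (IH _ (ca v)).
Qed.

Lemma diff_coord m (M v : 'rV[R]_m) i : 'd (fun N : 'rV[R]_m => N 0 i : R) M v = v 0 i.
Proof.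
have @f : {linear 'rV[R]_m -> R}.
  by exists (fun N : 'rV[R]_m => N 0 i); do 2![eexists]; do ?[constructor];
     rewrite ?mxE// => ? *; rewrite ?mxE//; move=> ?; rewrite !mxE.
have -> : (fun N : 'rV[R]_m => N 0 i : R) = f by [].
by rewrite diff_lin //; exact: coord_continuous.
Qed.

Lemma diff_comp_coord m (h : E -> 'rV[R]_m) i x v : differentiable h x ->
  'd (fun y => h y 0 i) x v = 'd h x v 0 i.
Proof.
move=> dh.
have := diff_comp dh (differentiable_coord (h x) 0 i).
by move=> /(congr1 (fun k => k v)) /= ->; rewrite diff_coord.
Qed.

Lemma Ck_coord m k (h : E -> 'rV[R]_m) i : Ck k h -> Ck k (fun x => h x 0 i).
Proof.
elim: k h => [|k IH] h /=.
  by move=> c x; apply: (continuous_comp (c x) (@coord_continuous _ _ _ _ _ _)).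
move=> [dh ch]; split=> [x|v].
  exact: (differentiable_comp (dh x) (differentiable_coord (h x) 0 i)).
have -> : (fun x => 'd (fun x => h x 0 i) x v) = fun x => 'd h x v 0 i.
  by apply/funext => x; rewrite diff_comp_coord.
exact: (IH _ (ch v)).
Qed.

Lemma Ck_sum (W : normedModType R) k (I : Type) (r : seq I) (P : pred I) (F : I -> E -> W) :
  (forall i, P i -> Ck k (F i)) -> Ck k (\sum_(i <- r | P i) F i).
Proof.
by move=> Fk; apply: (big_ind (Ck k)) => //; [exact: Ck_cst|move=> *; exact: CkD].
Qed.

(** The product rule [CkM] is for scalar functions, so vector-valued maps are handled through their
    expansion in the basis [delta_mx 0 i]. *)
Lemma Ck_coordP m k (h : E -> 'rV[R]_m) : (forall i, Ck k (fun x => h x 0 i)) -> Ck k h.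
Proof.
move=> hk.
have -> : h = \sum_i (fun x => h x 0 i *: delta_mx 0 i).
  apply/funext => x; by rewrite fct_sumE {1}(row_sum_delta (h x)).
by apply: Ck_sum => i _; exact: CkZl.
Qed.

Lemma smooth_differentiable (W : normedModType R) (h : E -> W) x :
  smooth h -> differentiable h x.
Proof. by move=> /(_ 1%N) []. Qed.

Lemma smooth_continuous (W : normedModType R) (h : E -> W) : smooth h -> continuous h.
Proof. by move=> /(_ 0%N). Qed.

Lemma smooth_dir (W : normedModType R) (h : E -> W) v :
  smooth h -> smooth (fun x => 'd h x v).
Proof. by move=> hs k; have [_ ] := hs k.+1; exact. Qed.

(** In ['d h x (X x)] both the point and the direction move with x; here only fixed directions with
    variable scalar coefficients remain, and the closure properties of [Ck] apply. *)
Lemma lderE (X : E -> E) (W : normedModType R) (h : E -> W) :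
  lder X h = fun x => \sum_i X x 0 i *: 'd h x (delta_mx 0 i).
Proof.
apply/funext => x; rewrite /lder {1}(row_sum_delta (X x)) linear_sum.
by apply: eq_bigr => i _; rewrite linearZ.
Qed.

Lemma diff_deltaE (h : E -> R) x v :
  'd h x v = \sum_i v 0 i * 'd h x (delta_mx 0 i).
Proof.
rewrite {1}(row_sum_delta v) linear_sum.
by apply: eq_bigr => i _; rewrite linearZ.
Qed.

Lemma smooth_lderR (X : E -> E) (h : E -> R) : smooth X -> smooth h -> smooth (lder X h).
Proof.
move=> Xs hs k; rewrite lderE.
have -> : (fun x => \sum_i X x 0 i *: 'd h x (delta_mx 0 i)) =
    \sum_i (fun x => X x 0 i) * (fun x => 'd h x (delta_mx 0 i)).
  by apply/funext => x; rewrite fct_sumE.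
apply: Ck_sum => i _; apply: CkM; first exact/Ck_coord/Xs.
exact: (smooth_dir _ hs).
Qed.

Lemma lder_coord (X Y : E -> E) i : smooth Y ->
  (fun x => lder X Y x 0 i) = lder X (fun x => Y x 0 i).
Proof.
by move=> Ys; apply/funext => x; rewrite /lder diff_comp_coord//; exact: smooth_differentiable.
Qed.

Lemma smooth_lder (X Y : E -> E) : smooth X -> smooth Y -> smooth (lder X Y).
Proof.
move=> Xs Ys k; apply: Ck_coordP => i; rewrite lder_coord//.
by apply: smooth_lderR => // l; exact/Ck_coord/Ys.
Qed.

Lemma smoothD (W : normedModType R) (h1 h2 : E -> W) :
  smooth h1 -> smooth h2 -> smooth (h1 + h2).
Proof. by move=> s1 s2 k; exact: CkD. Qed.

Lemma smoothZ (W : normedModType R) (a : R) (h : E -> W) : smooth h -> smooth (a *: h).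
Proof.
move=> hs k; elim: k h hs => [|k IH] h hs /=.
  by move=> x; apply: cvgZl_tmp; [exact: nbhs_filter|exact: (smooth_continuous hs (x:=x))].
have dh x := smooth_differentiable x hs.
split=> [x|v]; first exact: differentiableZ.
have -> : (fun x => 'd (a *: h) x v) = a *: (fun x => 'd h x v).
  by apply/funext => x; exact: diffZE.
by apply: IH; exact: smooth_dir.
Qed.

Lemma smooth0 (W : normedModType R) : smooth (0 : E -> W).
Proof. by move=> k; exact: Ck_cst. Qed.

Lemma is_derive_line (W : normedModType R) (h : E -> W) (x v : E) (r : R) :
  differentiable h (x + r *: v) ->
  is_derive r 1 (fun r : R => h (x + r *: v)) ('d h (x + r *: v) v).
Proof.
move=> dh.
have eqF : (fun q : R => q^-1 *: (((fun r : R => h (x + r *: v)) \o shift r) (q *: 1)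
      - h (x + r *: v))) =
    (fun q : R => q^-1 *: ((h \o shift (x + r *: v)) (q *: v) - h (x + r *: v))).
  apply/funext => q /=; congr (_ *: (h _ - _)).
  by rewrite [_%:A]mulr1 scalerDl addrCA.
split; first by rewrite /derivable eqF; exact: (diff_derivable dh).
by rewrite /derive eqF -(deriveE v dh).
Qed.

(** Second difference over the parallelogram spanned by t v and t w: the mean value theorem is used
    along v for the increment of h in the direction t w, then along w for the derivative of h in the
    direction v. *)
Lemma mvt_square (h : E -> R) (x v w : E) (t : R) : smooth h -> 0 < t ->
  exists xi eta : R, [/\ 0 < xi < t, 0 < eta < t &
    h (x + t *: v + t *: w) - h (x + t *: v) - (h (x + t *: w) - h x) =
    'd (fun y => 'd h y v) (x + xi *: v + eta *: w) w * t * t].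
Proof.
move=> hs t0.
have dh y := smooth_differentiable y hs.
have dhv y := smooth_differentiable y (smooth_dir v hs).
pose F : R -> R := (fun r : R => h (x + t *: w + r *: v)) - (fun r : R => h (x + r *: v)).
pose dF (r : R) : R := 'd h (x + t *: w + r *: v) v - 'd h (x + r *: v) v.
have FF (r : R) : is_derive r (1 : R) F (dF r).
  by apply: is_deriveB; exact: is_derive_line.
have [xi xit] : exists2 c, c \in `]0, t[%R & F t - F 0 = dF c * (t - 0).
  apply: MVT => //; apply: derivable_within_continuous => r _; exact: (@ex_derive _ _ _ _ _ _ _ (FF r)).
pose G (r : R) : R := 'd h (x + xi *: v + r *: w) v.
pose dG (r : R) : R := 'd (fun y => 'd h y v) (x + xi *: v + r *: w) w.
have GG (r : R) : is_derive r (1 : R) G (dG r).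
  exact: (is_derive_line (dhv _)).
have [eta etat] : exists2 c, c \in `]0, t[%R & G t - G 0 = dG c * (t - 0).
  apply: MVT => //; apply: derivable_within_continuous => r _; exact: (@ex_derive _ _ _ _ _ _ _ (GG r)).
rewrite !subr0 => Geq Feq; exists xi, eta; split.
- by move: xit; rewrite in_itv.
- by move: etat; rewrite in_itv.
- rewrite -[X in _ = X * _]Geq /G scale0r addr0.
  have -> : x + xi *: v + t *: w = x + t *: w + xi *: v by rewrite addrAC.
  rewrite -[RHS]Feq /F.
  have -> : x + t *: v + t *: w = x + t *: w + t *: v by rewrite addrAC.
  rewrite -[RHS]/(h (x + t *: w + t *: v) - h (x + t *: v)
    - (h (x + t *: w + 0 *: v) - h (x + 0 *: v))).
  by rewrite !scale0r !addr0.
Qed.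

(** The second difference is symmetric in v and w, so the two mixed derivatives agree at two points
    of a small parallelogram at x; by continuity they agree at x. *)
Lemma smooth_schwarz (h : E -> R) (x v w : E) : smooth h ->
  'd (fun y => 'd h y v) x w = 'd (fun y => 'd h y w) x v.
Proof.
move=> hs; apply/eqP; rewrite -subr_eq0 -normr_le0; apply/ler_addgt0Pr => e e0.
rewrite add0r.
have cA := @smooth_continuous _ _ (smooth_dir w (smooth_dir v hs)) x.
have cB := @smooth_continuous _ _ (smooth_dir v (smooth_dir w hs)) x.
have e20 : 0 < e / 2 by rewrite divr_gt0.
move/cvgrPdist_lt : cA => /(_ _ e20) /nbhs_ballP [d1 /= d10 b1].
move/cvgrPdist_lt : cB => /(_ _ e20) /nbhs_ballP [d2 /= d20 b2].
pose d := Num.min d1 d2.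
have d0 : 0 < d by rewrite lt_min d10.
have dd1 : d <= d1 by rewrite ge_min lexx.
have dd2 : d <= d2 by rewrite ge_min lexx orbT.
pose C := `|v| + `|w| + 1.
have C0 : 0 < C by rewrite ltr_wpDl// addr_ge0.
(* Every xi v + eta w with xi, eta in ]0, t[ is then shorter than d; the summand 1 in C keeps C
   positive when v and w are zero. *)
pose t := d / C.
have t0 : 0 < t by rewrite divr_gt0.
have near_x (xi eta : R) : 0 < xi < t -> 0 < eta < t -> forall a b, `|a| + `|b| < C ->
    `|x - (x + xi *: a + eta *: b)| < d.
  move=> /andP[xi0 xit] /andP[eta0 etat] a b abC.
  rewrite -addrA opprD addrA subrr add0r normrN (le_lt_trans (ler_normD _ _))//.
  rewrite !normrZ (gtr0_norm xi0) (gtr0_norm eta0).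
  apply: (@le_lt_trans _ _ (t * (`|a| + `|b|))).
    by rewrite mulrDr lerD// ler_wpM2r// ltW.
  by rewrite -[ltRHS](divfK (lt0r_neq0 C0)) ltr_pM2l.
have [xi [eta [xit etat eq1]]] := mvt_square x v w hs t0.
have [xi' [eta' [xit' etat' eq2]]] := mvt_square x w v hs t0.
have eq3 : 'd (fun y => 'd h y v) (x + xi *: v + eta *: w) w =
   'd (fun y => 'd h y w) (x + xi' *: w + eta' *: v) v.
  apply: (mulIf (lt0r_neq0 t0)); apply: (mulIf (lt0r_neq0 t0)).
  rewrite -[LHS]eq1 -[RHS]eq2 (addrAC x (t *: v)) !opprB.
  by rewrite addrACA [RHS]addrACA; congr (_ + _); exact: addrC.
have vwC : `|v| + `|w| < C by rewrite ltrDl.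
have wvC : `|w| + `|v| < C by rewrite addrC.
rewrite -ball_normE in b1; rewrite -ball_normE in b2.
have h1 := b1 _ (lt_le_trans (near_x _ _ xit etat _ _ vwC) dd1).
have h2 := b2 _ (lt_le_trans (near_x _ _ xit' etat' _ _ wvC) dd2).
have close (a b c c' : R) : c = c' ->
    `|a - c| < e / 2 -> `|b - c'| < e / 2 -> `|a - b| <= e.
  move=> <- ac bc; rewrite -(subrKA c) (le_trans (ler_normD _ _))// [leRHS]splitr.
  by rewrite lerD//; [exact: ltW|rewrite distrC ltW].
exact: (close _ _ _ _ eq3 h1 h2).
Qed.

Lemma differentiable_bigsum (I : Type) (r : seq I) (F : I -> E -> R) x :
  (forall i, differentiable (F i) x) -> differentiable (\sum_(i <- r) F i) x.
Proof.
move=> dF; apply: (big_ind (fun h : E -> R => differentiable h x)) => [|h1 h2|i _].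
- exact: differentiable_cst.
- exact: differentiableD.
- exact: dF.
Qed.

Lemma diff_sumE (I : Type) (r : seq I) (F : I -> E -> R) x v :
  (forall i, differentiable (F i) x) ->
  'd (\sum_(i <- r) F i) x v = \sum_(i <- r) 'd (F i) x v.
Proof.
move=> dF; elim: r => [|i r IH].
  rewrite [in RHS]big_nil (_ : \sum_(i <- [::]) F i = 0) ?big_nil//.
  exact: (congr1 (fun k : E -> R => k v) (diff_cst (0 : R) x)).
rewrite [in RHS]big_cons -IH (_ : \sum_(i <- i :: r) F i = F i + \sum_(i <- r) F i) ?big_cons//.
exact: (diffDE v (dF i) (differentiable_bigsum r dF)).
Qed.

(** By Leibniz, A(Bh) is (AB)h plus the Hessian of h applied to A and B. The Hessian is symmetric,
    so it cancels in the commutator and only first-order terms remain. *)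
Lemma lder_bracket (X Y : E -> E) (h : E -> R) : smooth X -> smooth Y -> smooth h ->
  lder (bracket X Y) h = lder X (lder Y h) - lder Y (lder X h).
Proof.
move=> Xs Ys hs; apply/funext => x.
have key (A B : E -> E) : smooth A -> smooth B ->
    lder A (lder B h) x = lder (lder A B) h x +
      \sum_i \sum_j A x 0 j * B x 0 i * 'd (fun y => 'd h y (delta_mx 0 i)) x (delta_mx 0 j).
  move=> As Bs.
  have Bc i : smooth (fun y => B y 0 i) by move=> k; exact/Ck_coord/Bs.
  have dd i y : differentiable (fun y => 'd h y (delta_mx 0 i)) y.
    exact/smooth_differentiable/smooth_dir.
  have -> : lder B h = \sum_i (fun y => B y 0 i) * (fun y => 'd h y (delta_mx 0 i)).
    by rewrite lderE; apply/funext => y; rewrite fct_sumE.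
  rewrite {1}/lder.
  transitivity (\sum_i 'd ((fun y => B y 0 i) * (fun y => 'd h y (delta_mx 0 i))) x (A x)).
    apply: diff_sumE => i.
    exact: (differentiableM (smooth_differentiable x (Bc i)) (dd i x)).
  rewrite [in RHS]lderE -big_split /=; apply: eq_bigr => i _.
  rewrite [LHS](diffME (A x) (smooth_differentiable x (Bc i)) (dd i x)).
  rewrite addrC; congr (_ + _).
    apply: (etrans (congr1 ( *%R (B x 0 i)) (diff_deltaE _ x (A x)))).
    by rewrite mulr_sumr; apply: eq_bigr => j _; rewrite mulrA (mulrC (B x 0 i)).
  apply: (etrans (mulrC _ _)).
  exact: (congr1 (fun k => k * _) (diff_comp_coord _ _ (smooth_differentiable x Bs))).
rewrite -[RHS]/(lder X (lder Y h) x - lder Y (lder X h) x) !key//.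
have combine (a b c d e : R) : a = b - c -> d = e -> a = b + d - (c + e).
  by move=> -> ->; rewrite opprD addrACA subrr addr0.
apply: combine; first exact: (linearB ('d h x)).
rewrite exchange_big /=; apply: eq_bigr => i _; apply: eq_bigr => j _.
rewrite (mulrC (X x 0 i)).
exact: (congr1 ( *%R _) (smooth_schwarz x _ _ hs)).
Qed.

End Smooth.

(** * Lie expansions and sign arguments *)

Section Sums.
Context {R : nzRingType} {U : lmodType R}.

(** Pascal's rule, in the form that drives the inductions on the order M of w_M. *)
Lemma sum_binS (G : nat -> nat -> U) M :
  \sum_(i < M.+2) G i (M.+1 - i)%N *+ 'C(M.+1, i) =
  \sum_(i < M.+1) (G i.+1 (M - i)%N + G i (M - i).+1) *+ 'C(M, i).
Proof.
under [RHS]eq_bigr do rewrite mulrnDl.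
rewrite big_split /= big_ord_recl /= bin0 subn0.
under eq_bigr => i _ do rewrite /bump /= add1n binS mulrnDr subSS.
rewrite big_split /= addrA addrC; congr (_ + _).
rewrite big_ord_recr /= bin_small// mulr0n addr0.
rewrite [RHS]big_ord_recl /= bin0 subn0; congr (_ + _).
apply: eq_bigr => i _; rewrite /bump /= add1n.
by congr (G _ _ *+ _); have := ltn_ord i; lia.
Qed.

(** Cauchy product of two polynomials in v; the hypothesis ensures that cutting all sums at the same
    K loses nothing. *)
Lemma sum_convol (F : nat -> nat -> U) (v : R) K :
  (forall j q, (K <= j + q)%N -> F j q = 0) ->
  \sum_(j < K) \sum_(q < K) v ^+ (j + q) *: F j q =
  \sum_(s < K) v ^+ s *: \sum_(j < s.+1) F j (s - j)%N.
Proof.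
move=> F0.
have E (j : 'I_K) : \sum_(q < K) v ^+ (j + q) *: F j q =
    \sum_(s < K | (j <= s)%N) v ^+ s *: F j (s - j)%N.
  rewrite -(big_mkord xpredT (fun q => v ^+ (j + q) *: F j q)).
  rewrite -(big_mkord (fun s => j <= s)%N (fun s => v ^+ s *: F j (s - j)%N)).
  rewrite (big_cat_nat (n := K - j)) ?leq_subr//= [X in _ + X]big_nat_cond [X in _ + X]big1 ?addr0; last first.
    by move=> q q2; rewrite F0 ?scaler0//; have := ltn_ord j; lia.
  rewrite [RHS](big_cat_nat (n := j)) ?(ltnW (ltn_ord j))//=.
  rewrite [X in _ = X + _]big_nat_cond [X in _ = X + _]big1 ?add0r; last by move=> q; lia.
  rewrite -[X in _ = \sum_(X <= _ < _ | _) _]add0n [RHS]big_addn [RHS]big_nat_cond [LHS]big_nat_cond.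
  by apply: eq_big => [q|q _]; rewrite ?leq_addl ?andbT// addnK addnC.
rewrite (eq_bigr _ (fun j _ => E j)) (exchange_big_dep xpredT)//=.
apply: eq_bigr => s _; rewrite -scaler_sumr; congr (_ *: _).
rewrite -(big_mkord (fun j => j <= s)%N (fun j => F j (s - j)%N)).
rewrite -(big_mkord xpredT (fun j => F j (s - j)%N)).
rewrite (big_cat_nat (n := s.+1)) ?ltn_ord//= [X in _ + X]big_nat_cond [X in _ + X]big1 ?addr0; last by move=> q; lia.
by rewrite [LHS]big_nat_cond [RHS]big_nat_cond; apply: eq_bigl => q; lia.
Qed.

End Sums.

(** * Signs of real polynomials near zero and near infinity *)

Section PolySign.
Context {R : realFieldType}.
Implicit Types p : {poly R}.

(** Write p = q X + c. As |q| <= |M| + 1 on [-1, 1], the term q(v) v is smaller than |c| once |v| <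
    |c| / (|M| + 1). *)
Lemma poly_sign0 p : p`_0 != 0 ->
  exists2 eta : R, 0 < eta & forall v, `|v| < eta -> 0 < p.[v] * p`_0.
Proof.
elim/poly_ind: p => [|q c _]; first by rewrite coef0 eqxx.
rewrite coefD coefMX coefC /= add0r => c0.
have [M bM] := poly_itv_bound q (-1) 1.
have M0 : 0 < `|M| + 1 by rewrite ltr_wpDl.
exists (Num.min 1 (`|c| / (`|M| + 1))); first by rewrite lt_min ltr01 divr_gt0// normr_gt0.
move=> v; rewrite lt_min => /andP[v1 v2].
rewrite !hornerE mulrDl.
have cc : 0 < c * c by rewrite lt0r mulf_neq0//= -expr2 sqr_ge0.
have qM : `|q.[v]| <= `|M| + 1.
  apply: (le_trans (bM v _)); first by rewrite -ler_norml ltW.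
  by rewrite (le_trans (ler_norm _))// lerDl.
have : `|q.[v] * v * c| < c * c.
  rewrite !normrM -[ltRHS]ger0_norm ?ltW// normrM ltr_pM2r ?normr_gt0//.
  apply: (@le_lt_trans _ _ ((`|M| + 1) * `|v|)); first by rewrite ler_wpM2r.
  by rewrite mulrC -ltr_pdivlMr.
by rewrite ltr_norml => /andP[]; rewrite -subr_gt0 opprK addrC.
Qed.

(** The lowest exponent present is at most j, hence odd. Near 0 its term decides the sign of p, and
    the sign of u decides the sign of that term. *)
Lemma poly_neg_low p j : odd j -> p`_j != 0 ->
  (forall q, ~~ odd q -> (q < j)%N -> p`_q = 0) -> exists u, p.[u] < 0.
Proof.
move=> oj pj pe.
have ex : exists q, p`_q != 0 by exists j.
case: (ex_minnP ex) => q0 pq0 qmin.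
have oq0 : odd q0.
  apply: contraNT pq0 => eq0.
  by rewrite pe// ltn_neqAle qmin// andbT; apply: contraNneq eq0 => ->.
pose r := drop_poly q0 p.
have pE : p = r * 'X^q0.
  rewrite -[LHS](poly_take_drop q0) (_ : take_poly q0 p = 0) ?add0r//.
  apply/polyP => i; rewrite coef_take_poly coef0; case: ltnP => // iq.
  by apply: contraTeq iq => /qmin; rewrite -leqNgt.
have r0 : r`_0 != 0 by rewrite /r coef_drop_poly add0n.
have [eta eta0 reta] := poly_sign0 r0.
have e2 : 0 < eta / 2 by rewrite divr_gt0.
have e2e : `|eta / 2| < eta by rewrite gtr0_norm// ltr_pdivrMr// ltr_pMr// ltr1n.
have [rp|rn] := ltrP 0 r`_0.
  exists (- (eta / 2)); rewrite pE !hornerE exprNn -signr_odd oq0 expr1 mulN1r mulrN oppr_lt0.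
  rewrite mulr_gt0 ?exprn_gt0//.
  by have := reta (- (eta / 2)); rewrite normrN e2e => /(_ isT); rewrite pmulr_lgt0.
exists (eta / 2); rewrite pE !hornerE pmulr_llt0 ?exprn_gt0//.
have := reta (eta / 2) e2e; rewrite nmulr_lgt0//.
by rewrite lt_neqAle r0.
Qed.

(** Behaviour at infinity is behaviour at 0 of the polynomial with reversed coefficients. *)
Lemma poly_sign_infty p : p != 0 ->
  exists2 B : R, 0 < B & forall u, B < `|u| ->
    0 < p.[u] * (u ^+ (size p).-1 * lead_coef p).
Proof.
move=> p0; set d := (size p).-1.
have sp : size p = d.+1 by rewrite prednK// lt0n size_poly_eq0.
pose r := \poly_(i < d.+1) p`_(d - i).
have r0 : r`_0 = lead_coef p by rewrite coef_poly subn0.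
have [|eta eta0 reta] := @poly_sign0 r; first by rewrite r0 lead_coef_eq0.
exists eta^-1; first by rewrite invr_gt0.
move=> u ue.
have u0 : u != 0 by rewrite -normr_gt0 (lt_trans _ ue)// invr_gt0.
have pE : p.[u] = u ^+ d * r.[u^-1].
  rewrite horner_poly mulr_sumr (horner_coef p) sp (reindex_inj rev_ord_inj) /=.
  apply: eq_bigr => i _; rewrite subSS mulrCA; congr (_ * _).
  rewrite exprVn; have := ltn_ord i; rewrite ltnS => id.
  by apply: (mulIf (expf_neq0 i u0)); rewrite divfK ?expf_neq0// -exprD subnK.
rewrite pE mulrACA -expr2 -r0 pmulr_rgt0; last by rewrite lt0r sqr_ge0 sqrf_eq0 expf_neq0.
by apply: reta; rewrite normfV invf_plt// posrE normr_gt0.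
Qed.

(** The degree is at least j and cannot be an even number above j, so it is odd; a large u of the
    right sign makes p negative. *)
Lemma poly_neg_high p j : odd j -> p`_j != 0 ->
  (forall q, ~~ odd q -> (j < q)%N -> p`_q = 0) -> exists u, p.[u] < 0.
Proof.
move=> oj pj pe.
have p0 : p != 0 by apply: contraNneq pj => ->; rewrite coef0.
have [B B0 HB] := poly_sign_infty p0.
have od : odd (size p).-1.
  apply: contraT => ed; have lc : lead_coef p != 0 by rewrite lead_coef_eq0.
  rewrite lead_coefE pe ?eqxx// in lc; rewrite ltn_neqAle.
  have jd : (j <= (size p).-1)%N.
    rewrite -ltnS prednK ?lt0n ?size_poly_eq0//.
    by apply: contraNT pj; rewrite -leqNgt => /leq_sizeP ->.
  by rewrite jd andbT; apply: contraNneq ed => <-.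
have B1 : 0 < B + 1 by rewrite ltr_wpDl// ltW.
have [lp|ln] := ltrP 0 (lead_coef p).
  exists (- (B + 1)); have := HB (- (B + 1)).
  rewrite normrN gtr0_norm// ltrDl ltr01 => /(_ isT).
  rewrite exprNn -signr_odd od expr1 mulN1r mulNr mulrN oppr_gt0.
  by rewrite pmulr_llt0// mulr_gt0// exprn_gt0.
exists (B + 1); have := HB (B + 1); rewrite gtr0_norm// ltrDl ltr01 => /(_ isT).
have ln' : lead_coef p < 0 by rewrite lt_neqAle ln lead_coef_eq0 p0.
by rewrite nmulr_lgt0// nmulr_llt0// exprn_gt0.
Qed.

Lemma poly_neg_lead p : ~~ odd (size p).-1 -> lead_coef p < 0 -> exists u, p.[u] < 0.
Proof.
move=> ed lc.
have p0 : p != 0 by apply: contraTneq lc => ->; rewrite lead_coef0 ltxx.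
have [B B0 HB] := poly_sign_infty p0.
have B1 : 0 < B + 1 by rewrite ltr_wpDl// ltW.
exists (B + 1); have := HB (B + 1); rewrite gtr0_norm// ltrDl ltr01 => /(_ isT).
by rewrite nmulr_lgt0// pmulr_rlt0// exprn_gt0.
Qed.

(** A non-zero p has fewer roots than the [size p] integers starting at 2. The bound 1 < x is the
    condition mu > 1. *)
Lemma poly_nonroot_gt1 p : p != 0 -> exists2 x, 1 < x & p.[x] != 0.
Proof.
move=> p0; pose rs : seq R := [seq i.+2%:R | i <- iota 0 (size p)].
have : ~~ all (root p) rs.
  have urs : uniq rs.
    by rewrite map_inj_uniq ?iota_uniq// => i k /eqP; rewrite eqr_nat => /eqP[].
  apply/negP => rall; have := max_poly_roots p0 rall urs.
  by rewrite size_map size_iota ltnn.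
by case/allPn => _ /mapP[i _ ->] ri; exists i.+2%:R; rewrite // ltr1n.
Qed.

End PolySign.

(** * Expansion of two successive flows for an abstract Lie action *)

Section Algebra.
Context {R : realFieldType} {L U : lmodType R}.
Variables (act : L -> U -> U) (br : L -> L -> L).
Hypothesis act_linr : forall X, linear (act X).
Hypothesis act_linl : forall h, linear (act^~ h).
Hypothesis br_linl : forall Y, linear (br^~ Y).
Hypothesis br_anti : forall X Y, br X Y = - br Y X.
Hypothesis act_br : forall X Y h, act (br X Y) h = act X (act Y h) - act Y (act X h).
Variables (f g : L) (V : U).

Let actr X : {linear U -> U} := HB.pack (act X) (GRing.isLinear.Build _ _ _ _ _ (act_linr X)).
Let actl h : {linear L -> U} := HB.pack (act^~ h) (GRing.isLinear.Build _ _ _ _ _ (act_linl h)).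
Let brl Y : {linear L -> L} := HB.pack (br^~ Y) (GRing.isLinear.Build _ _ _ _ _ (br_linl Y)).

Lemma actr0 X : act X 0 = 0. Proof. exact: (linear0 (actr X)). Qed.
Lemma actrD X h1 h2 : act X (h1 + h2) = act X h1 + act X h2.
Proof. exact: (linearD (actr X)). Qed.
Lemma actrZ X a h : act X (a *: h) = a *: act X h.
Proof. exact: (linearZ_LR (actr X)). Qed.
Lemma actrMn X h k : act X (h *+ k) = act X h *+ k.
Proof. exact: (linearMn (actr X)). Qed.
Lemma actr_sum X I (r : seq I) P (F : I -> U) :
  act X (\sum_(i <- r | P i) F i) = \sum_(i <- r | P i) act X (F i).
Proof. exact: (linear_sum (actr X)). Qed.
Lemma act0 h : act 0 h = 0. Proof. exact: (linear0 (actl h)). Qed.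
Lemma actD X Y h : act (X + Y) h = act X h + act Y h.
Proof. exact: (linearD (actl h)). Qed.
Lemma actZ a X h : act (a *: X) h = a *: act X h.
Proof. exact: (linearZ_LR (actl h)). Qed.
Lemma act_sum I (r : seq I) P (F : I -> L) h :
  act (\sum_(i <- r | P i) F i) h = \sum_(i <- r | P i) act (F i) h.
Proof. exact: (linear_sum (actl h)). Qed.
Lemma br0 Y : br 0 Y = 0. Proof. exact: (linear0 (brl Y)). Qed.
Lemma brD X1 X2 Y : br (X1 + X2) Y = br X1 Y + br X2 Y.
Proof. exact: (linearD (brl Y)). Qed.
Lemma brZ a X Y : br (a *: X) Y = a *: br X Y.
Proof. exact: (linearZ_LR (brl Y)). Qed.
Lemma br_sum I (r : seq I) P (F : I -> L) Y :
  br (\sum_(i <- r | P i) F i) Y = \sum_(i <- r | P i) br (F i) Y.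
Proof. exact: (linear_sum (brl Y)). Qed.
Lemma brxx X : br X X = 0.
Proof.
have := br_anti X X => /eqP; rewrite -addr_eq0 -mulr2n -scaler_nat scaler_eq0.
by rewrite pnatr_eq0 => /= /eqP.
Qed.

(** This is w_M h, equal to the sum of 'C(M, i) X^i Z^(M - i) h (see [taylor_binom]); the recursive
    form is the one in which X + Z = mu f can be used. *)
Fixpoint taylor (X Z : L) M h : U :=
  if M is M'.+1 then act X (taylor X Z M' h) + taylor X Z M' (act Z h) else h.

(** For A = ad_X^i f one has X (A w) = [X, A] w + A (X w). The bracket is ad_X^(i+1) f, the other
    term joins A (w (Z h)) to give the next w, and Pascal's rule collects everything. Hence only
    iterated brackets of f with X occur, and those expand in the lambda's. *)
Lemma taylor_rec (mu : R) X Z M h : X + Z = mu *: f ->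
  taylor X Z M.+1 h = mu *: \sum_(i < M.+1)
    act (iter i (br X) f) (taylor X Z (M - i)%N h) *+ 'C(M, i).
Proof.
move=> XZ; elim: M h => [|M IH] h.
  by rewrite big_ord1 /= mulr1n -actD XZ actZ.
rewrite -[LHS]/(act X (taylor X Z M.+1 h) + taylor X Z M.+1 (act Z h)) !IH.
rewrite actrZ -scalerDr actr_sum -big_split /=; congr (_ *: _).
rewrite (sum_binS (fun i k => act (iter i (br X) f) (taylor X Z k h))).
apply: eq_bigr => i _; rewrite actrMn -mulrnDl; congr (_ *+ _) => /=.
by rewrite actrD act_br addrA; congr (_ + _); rewrite subrK.
Qed.

(* The index i is shifted: lam i j stands for lambda_{i+1,j}. *)
Fixpoint lam i j : L :=
  if i is i'.+1 then
    br (lam i' j) f + (if j is j'.+1 then br (lam i' j') g else 0)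
  else if j is 0%N then f else 0.

Lemma lam_big i j : (i < j)%N -> lam i j = 0.
Proof.
elim: i j => [|i IH] [|j]//= ij; rewrite !IH ?br0 ?addr0//; lia.
Qed.

(** Each bracket on the left is turned into one on the right at the cost of a sign. [K] is any bound
    above i, so that all later sums can share one range. *)
Lemma ad_lam u i K : (i < K)%N ->
  iter i (br (f + u *: g)) f = (-1) ^+ i *: \sum_(j < K) u ^+ j *: lam i j.
Proof.
elim: i => [|i IH] iK.
  case: K iK => // K _; rewrite big_ord_recl /= !expr0 !scale1r big1 ?addr0// => j _.
  by rewrite scaler0.
rewrite iterS IH; last exact: ltnW.
rewrite br_anti brZ br_sum -scalerN -sumrN exprS mulN1r scaleNr -scalerN -sumrN; congr (_ *: _).
case: K iK {IH} => // K iK.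
transitivity (\sum_(j < K.+1) - (u ^+ j *: br (lam i j) f) + \sum_(j < K.+1) - (u ^+ j.+1 *: br (lam i j) g)).
  rewrite -big_split /=; apply: eq_bigr => j _.
  rewrite brZ (br_anti (lam i j)) brD brZ !(br_anti _ (lam i j)) scalerN opprK.
  by rewrite scalerDr !scalerN scalerA -exprSr.
(* Shift of the g-part from u^(j+1) to u^j; the term j = K that falls out at the top is zero because
   i < K. *)
transitivity (\sum_(j < K.+1) - (u ^+ j *: br (lam i j) f) +
    \sum_(j < K.+1) - (u ^+ j *: (if j : nat is j'.+1 then br (lam i j') g else 0))).
  congr (_ + _); rewrite [in RHS]big_ord_recl /= scaler0 oppr0 add0r.
  by rewrite big_ord_recr /= lam_big ?br0 ?scaler0 ?oppr0 ?addr0//.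
by rewrite -big_split /=; apply: eq_bigr => j _; rewrite -opprD -scalerDr.
Qed.

(** Coefficient of mu^k u^q in w_M V: k is the number of factors lambda, M their total order, q the
    number of occurrences of g. *)
Fixpoint coef k M q : U :=
  if k is k'.+1 then
    if M is M'.+1 then
      \sum_(i < M'.+1) \sum_(j < q.+1)
        ((-1) ^+ i *: act (lam i j) (coef k' (M' - i)%N (q - j)%N)) *+ 'C(M', i)
    else 0
  else if (M == 0%N) && (q == 0%N) then V else 0.

(** A non-zero factor lambda_{i+1,j} has j <= i, so k factors of total order M contain g at most M -
    k times. *)
Lemma coef_big k M q : (M < q + k)%N -> coef k M q = 0.
Proof.
elim: k M q => [|k IH] M q /=.
  by rewrite addn0; case: q => // q; rewrite andbF.
case: M => // M Mqk; apply: big1 => i _; apply: big1 => j _.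
have [ij|ji] := ltnP i j; first by rewrite lam_big// act0 scaler0 mul0rn.
rewrite IH ?actr0 ?scaler0 ?mul0rn//.
by have := ltn_ord i; have := ltn_ord j; lia.
Qed.

Lemma taylor_coef u (mu : R) Z M K : f + u *: g + Z = mu *: f -> (M < K)%N ->
  taylor (f + u *: g) Z M V = \sum_(k < K) \sum_(q < K) (mu ^+ k * u ^+ q) *: coef k M q.
Proof.
move=> XZ; elim/ltn_ind: M => -[|M] IH MK.
  case: K MK {IH} => // K _; rewrite /= !big_ord_recl /= !expr0 mulr1 scale1r.
  rewrite big1 ?addr0; last by move=> q _; rewrite scaler0.
  rewrite big1 ?addr0// => k _; rewrite big1// => q _.
  by rewrite scaler0.
rewrite (taylor_rec _ _ XZ).
pose F (k i j q : nat) := ((-1) ^+ i *: act (lam i j) (coef k (M - i)%N q)) *+ 'C(M, i).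
have E (i : 'I_M.+1) :
    act (iter i (br (f + u *: g)) f) (taylor (f + u *: g) Z (M - i)%N V) *+ 'C(M, i) =
    \sum_(k < K) mu ^+ k *: \sum_(s < K) u ^+ s *: \sum_(j < s.+1) F k i j (s - j)%N.
  have iM := ltn_ord i.
  rewrite (@ad_lam _ _ K) ?IH; try lia.
  rewrite actZ act_sum scaler_sumr -sumrMnl.
  transitivity (\sum_(j < K) \sum_(k < K) \sum_(q < K) mu ^+ k *: (u ^+ (j + q) *: F k i j q)).
    apply: eq_bigr => j _; rewrite actZ actr_sum !scaler_sumr -sumrMnl.
    apply: eq_bigr => k _; rewrite actr_sum !scaler_sumr -sumrMnl.
    apply: eq_bigr => q _; rewrite actrZ /F -!scalerMnr; congr (_ *+ _).
    by rewrite !scalerA; congr (_ *: _); rewrite exprD; ring.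
  rewrite exchange_big /=; apply: eq_bigr => k _.
  under eq_bigr do rewrite -scaler_sumr.
  rewrite -scaler_sumr; congr (_ *: _).
  (* Beyond degree K either j > i, or the k remaining factors, of total order M - i, cannot contain
     g q times. *)
  apply: sum_convol => j q jqK; rewrite /F.
  have [ij|ji] := ltnP i j; first by rewrite lam_big// act0 scaler0 mul0rn.
  by rewrite coef_big ?actr0 ?scaler0 ?mul0rn//; lia.
rewrite (eq_bigr _ (fun i _ => E i)) exchange_big /= scaler_sumr.
case: K MK {IH} E => // K MK E.
(* The factor mu of [taylor_rec] shifts k by one. The top power on the left has more factors than
   its order allows, and k = 0 on the right is incompatible with a positive order. *)
rewrite big_ord_recr [RHS]big_ord_recl /=.
rewrite [X in _ + X](_ : _ = 0) ?addr0; last first.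
  rewrite big1 ?scaler0// => i _; rewrite big1 ?scaler0// => s _.
  rewrite big1 ?scaler0// => j _; rewrite /F coef_big ?actr0 ?scaler0 ?mul0rn//; lia.
rewrite [X in _ = X + _](_ : _ = 0) ?add0r; last by rewrite big1// => q _; rewrite scaler0.
apply: eq_bigr => k _; rewrite /bump /= add1n -scaler_sumr scalerA -exprS exchange_big /= scaler_sumr.
apply: eq_bigr => s _; rewrite -scaler_sumr scalerA; congr (_ *: _).
Qed.

Definition lprod (l : seq (nat * nat)) h : U := foldr (fun p => act (lam p.1 p.2)) h l.

Lemma lprod_linear l : linear (lprod l).
Proof. by elim: l => //= p l IH a x y; rewrite /= IH act_linr. Qed.

Let lprodl l : {linear U -> U} :=
  HB.pack (lprod l) (GRing.isLinear.Build _ _ _ _ _ (lprod_linear l)).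
Lemma lprod0 l : lprod l 0 = 0. Proof. exact: (linear0 (lprodl l)). Qed.
Lemma lprodZ l a h : lprod l (a *: h) = a *: lprod l h.
Proof. exact: (linearZ_LR (lprodl l)). Qed.
Lemma lprodMn l h k : lprod l (h *+ k) = lprod l h *+ k.
Proof. exact: (linearMn (lprodl l)). Qed.
Lemma lprod_sum l I (r : seq I) P (F : I -> U) :
  lprod l (\sum_(i <- r | P i) F i) = \sum_(i <- r | P i) lprod l (F i).
Proof. exact: (linear_sum (lprodl l)). Qed.

Lemma lprod_cat l1 l2 h : lprod (l1 ++ l2) h = lprod l1 (lprod l2 h).
Proof. by rewrite /lprod foldr_cat. Qed.

Definition lord (l : seq (nat * nat)) := sumn [seq p.1.+1 | p <- l].
Definition lgord (l : seq (nat * nat)) := sumn [seq p.2 | p <- l].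

Variable phi : {linear U -> R^o}.

(** The prefix [l0] gathers the factors already peeled off the recursion of [coef], so that in the
    end [phi] meets one complete product. In the application [phi] is evaluation at x. *)
Lemma coef_vanish l0 k M q :
  (forall l, size l = k -> lord l = M -> lgord l = q -> phi (lprod (l0 ++ l) V) = 0) ->
  phi (lprod l0 (coef k M q)) = 0.
Proof.
elim: k M q l0 => [|k IH] M q l0 /= H.
  case: ifP => [/andP[/eqP M0 /eqP q0]|_]; last by rewrite lprod0 linear0.
  by rewrite -[l0]cats0; apply: H; rewrite ?M0 ?q0.
case: M H => [|M] H; first by rewrite lprod0 linear0.
rewrite lprod_sum linear_sum big1// => i _.
rewrite lprod_sum linear_sum big1// => j _.
rewrite lprodMn lprodZ linearMn linearZ_LR /=.
have -> : lprod l0 (act (lam i j) (coef k (M - i)%N (q - j)%N)) =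
    lprod (rcons l0 (nat_of_ord i, nat_of_ord j)) (coef k (M - i)%N (q - j)%N).
  by rewrite -cats1 lprod_cat.
rewrite IH ?scaler0 ?mul0rn// => l sl ol gl.
rewrite cat_rcons; apply: H; rewrite /= ?sl//.
  by rewrite /lord /= -/(lord l) ol; have := ltn_ord i; lia.
by rewrite /lgord /= -/(lgord l) gl; have := ltn_ord j; lia.
Qed.

(** The part linear in mu: [coef 0] can differ from zero only at order 0 without g, so the single
    factor carries the whole order and all the g's. *)
Lemma coef1 M q : coef 1 M.+1 q = (-1) ^+ M *: act (lam M q) V.
Proof.
rewrite [LHS]/= big_ord_recr /= subnn big1 ?add0r; last first.
  move=> i _; rewrite big1// => j _.
  by rewrite ifF ?actr0 ?scaler0 ?mul0rn//; have := ltn_ord i; lia.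
rewrite big_ord_recr /= subnn big1 ?add0r ?binn ?mulr1n//.
move=> j _; rewrite ifF ?actr0 ?scaler0 ?mul0rn//.
by have := ltn_ord j; lia.
Qed.

(** The case u = 0: X and Z are multiples of f and all brackets vanish. *)
Lemma taylor_f (mu : R) M h : taylor f ((mu - 1) *: f) M h = mu ^+ M *: iter M (act f) h.
Proof.
have XZ : f + (mu - 1) *: f = mu *: f by rewrite scalerBl scale1r addrC subrK.
elim: M h => [|M IH] h; first by rewrite scale1r.
rewrite (taylor_rec _ _ XZ) big_ord_recl /= subn0 bin0 mulr1n big1 ?addr0; last first.
  move=> i _; rewrite /bump /= add1n.
  have -> k : br f (iter k (br f) f) = 0.
    by elim: k => [|k IHk] /=; rewrite ?brxx// IHk br_anti br0 oppr0.
  by rewrite act0 mul0rn.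
by rewrite IH actrZ scalerA -exprS.
Qed.


Section Sign.
Variable N : nat.
Hypothesis van : forall l, l != [::] -> (lord l <= N)%N -> phi (lprod l V) = 0.

Definition vanq q := forall l, l != [::] -> lord l = N.+1 -> lgord l = q ->
  phi (lprod l V) = 0.

Let X u := f + u *: g.
Let Z (mu u : R) := mu *: f - (f + u *: g).
Let XZ mu u : X u + Z mu u = mu *: f.
Proof. by rewrite /X /Z addrC subrK. Qed.

Lemma taylor_low mu u M : (1 <= M <= N)%N -> phi (taylor (X u) (Z mu u) M V) = 0.
Proof.
move=> /andP[M1 MN].
rewrite (taylor_coef (XZ mu u) (ltnSn M)) linear_sum big1// => k _.
rewrite linear_sum big1// => q _; rewrite linearZ_LR /=.
rewrite -[coef k M q]/(lprod [::] (coef k M q)) coef_vanish ?scaler0// => l sl ol gl.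
apply: van; last by rewrite cat0s ol.
by rewrite cat0s; apply: contraTneq M1 => l0; rewrite -ol l0.
Qed.

(** w_{N+1} V at the point, as a polynomial in u for fixed mu. *)
Let P (mu : R) : {poly R} := \poly_(q < N.+2) \sum_(k < N.+2) mu ^+ k * phi (coef k N.+1 q).

Let PE mu u : (P mu).[u] = phi (taylor (X u) (Z mu u) N.+1 V).
Proof.
rewrite (taylor_coef (XZ mu u) (ltnSn _)) exchange_big horner_poly linear_sum.
apply: eq_bigr => q _; rewrite linear_sum mulr_suml; apply: eq_bigr => k _.
by rewrite linearZ_LR /= mulrAC.
Qed.

Let Pvan mu q : vanq q -> (P mu)`_q = 0.
Proof.
move=> vq; rewrite coef_poly; case: ltnP => // _; apply: big1 => -[[|k] kN] _ /=.
  by rewrite linear0 mulr0.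
rewrite -[X in phi X]/(lprod [::] (coef k.+1 N.+1 q)) coef_vanish ?mulr0// => l sl ol gl.
by rewrite cat0s; apply: vq => //; case: l sl {ol gl}.
Qed.

Let Pnz j : phi (act (lam N j) V) != 0 -> (j <= N)%N -> exists2 mu, 1 < mu & (P mu)`_j != 0.
Proof.
move=> lj jN; pose s : {poly R} := \poly_(k < N.+2) phi (coef k N.+1 j).
have s0 : s != 0.
  apply: contraNneq lj => s0; have : s`_1 = 0 by rewrite s0 coef0.
  rewrite coef_poly (_ : (1 < N.+2)%N = true)// coef1 linearZ_LR => /eqP.
  by rewrite mulf_eq0 signr_eq0.
have [mu mu1 smu] := poly_nonroot_gt1 s0; exists mu => //.
rewrite coef_poly ltnS leqW//; move: smu; rewrite horner_poly.
by under eq_bigr do rewrite mulrC.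
Qed.

Lemma taylor_neg :
  phi (iter N.+1 (act f) V) < 0 \/
  (phi (iter N.+1 (act f) V) <= 0 /\
   [\/ exists j, [/\ odd j, (j <= N)%N, phi (act (lam N j) V) != 0 &
          forall q, ~~ odd q -> (0 < q < j)%N -> vanq q],
       odd N /\ exists j, [/\ odd j, (j <= N)%N, phi (act (lam N j) V) != 0 &
          forall q, ~~ odd q -> (j < q < N)%N -> vanq q] |
       ~~ odd N /\ phi (act (lam N N) V) < 0]) ->
  exists mu u, 1 < mu /\ phi (taylor (X u) (Z mu u) N.+1 V) < 0.
Proof.
have X0 : X 0 = f by rewrite /X scale0r addr0.
have Z0 mu : Z mu 0 = (mu - 1) *: f by rewrite /Z scale0r addr0 scalerBl scale1r.
have fneg : phi (iter N.+1 (act f) V) < 0 ->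
    exists mu u, 1 < mu /\ phi (taylor (X u) (Z mu u) N.+1 V) < 0.
  move=> neg; exists 2, 0; split; first by rewrite ltr1n.
  rewrite X0 Z0 taylor_f linearZ_LR /=.
  by rewrite pmulr_rlt0// exprn_gt0.
(* A strict inequality in P2 is P1; otherwise the constant coefficient of [P mu] is zero for every
   mu. *)
case=> // -[]; rewrite le_eqVlt => /orP[/eqP f0|/fneg//].
have P0 mu : (P mu)`_0 = 0.
  rewrite -horner_coef0 PE X0 Z0 taylor_f.
  by rewrite linearZ_LR f0 scaler0.
have Pbig mu q : (N < q)%N -> (P mu)`_q = 0.
  move=> Nq; rewrite coef_poly; case: ltnP => // _; apply: big1 => -[[|k] kN] _.
    by rewrite /= linear0 mulr0.
  by rewrite (@coef_big k.+1) ?linear0 ?mulr0//; lia.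
case=> [[j [oj jN lj vj]]|[oN [j [oj jN lj vj]]]|[eN lN]].
- have [mu mu1 Pj] := Pnz lj jN; exists mu.
  have [|u Pu] := @poly_neg_low _ (P mu) j oj Pj.
    by move=> [|q] eq qj //; apply/Pvan/vj.
  by exists u; rewrite -PE.
- have [mu mu1 Pj] := Pnz lj jN; exists mu.
  have [|u Pu] := @poly_neg_high _ (P mu) j oj Pj.
    (* The hypothesis covers even q with q < N, and q = N is excluded because N is odd. *)
    move=> q eq jq; have [qN|Nq] := leqP q N; last exact: Pbig.
    by apply/Pvan/vj => //; rewrite jq ltn_neqAle qN andbT; apply: contraNneq eq => ->.
  by exists u; rewrite -PE.
(* Any mu > 1 would do: two or more factors of total order N + 1 contain g fewer than N times, so
   the coefficient of u^N is mu lambda_{N+1,N} V, with sign (-1)^N = 1. *)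
- exists 2.
  have PN : (P 2)`_N = 2 * phi (act (lam N N) V).
    rewrite coef_poly leqW//.
    pose o1 : 'I_N.+2 := Ordinal (isT : 1 < N.+2)%N.
    have E0 : \sum_(k < N.+2 | k != o1) 2 ^+ k * phi (coef k N.+1 N) = 0.
      apply: big1 => -[[|[|k]] kN] // _; first by rewrite /= linear0 mulr0.
      by rewrite (@coef_big k.+2) ?linear0 ?mulr0//; lia.
    rewrite (bigD1 o1) // E0; apply: (etrans (addr0 _)).
    by rewrite [nat_of_ord _]/= expr1 coef1 -signr_odd (negbTE eN) scale1r.
  have PN0 : (P 2)`_N < 0 by rewrite PN pmulr_rlt0.
  have sP : size (P 2) = N.+1.
    apply/eqP; rewrite eqn_leq; apply/andP; split.
      by apply/leq_sizeP => q Nq; exact: Pbig.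
    by rewrite ltnNge; apply/negP => /leq_sizeP/(_ _ (leqnn N)) e; rewrite e ltxx in PN0.
  have [||u Pu] := @poly_neg_lead _ (P 2); rewrite ?lead_coefE ?sP//.
  by exists u; rewrite -PE ltr1n.
Qed.

End Sign.
End Algebra.

(** * Descent from the hypotheses *)

(* Bundling smoothness makes the Lie derivative bilinear without side
   conditions, as the abstract computation of w_M requires. *)
Section SmoothSubtype.
Context {R : realType} {n : nat} (W : normedModType R).
Notation E := 'rV[R]_n.

Definition smooth_pred : {pred E -> W} := fun h => `[< smooth h >].

Lemma smooth_predP (h : E -> W) : reflect (smooth h) (h \in smooth_pred).
Proof. exact: asboolP. Qed.

Lemma smooth_submod : submod_closed smooth_pred.
Proof.
split; first by apply/smooth_predP; exact: smooth0.
move=> a h1 h2 /smooth_predP s1 /smooth_predP s2; apply/smooth_predP.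
exact: (smoothD (smoothZ a s1) s2).
Qed.

HB.instance Definition _ := GRing.isSubmodClosed.Build R (E -> W) smooth_pred smooth_submod.

Record sm := Sm { sm_val :> E -> W; sm_valP : sm_val \in smooth_pred }.
HB.instance Definition _ := [isSub for sm_val].
HB.instance Definition _ := [Choice of sm by <:].
HB.instance Definition _ := [SubChoice_isSubLmodule of sm by <:].

Lemma sm_smooth (h : sm) : smooth h.
Proof. by apply/smooth_predP; exact: sm_valP. Qed.

Definition mk_sm (h : E -> W) (hs : smooth h) : sm := Sm (introT (smooth_predP h) hs).

End SmoothSubtype.
Arguments sm R n W : clear implicits.

Section Concrete.
Context {R : realType} {n : nat}.
Notation E := 'rV[R]_n.
Notation SF := (sm R n R).
Notation VF := (sm R n E).

Definition sact (X : VF) (h : SF) : SF :=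
  mk_sm (smooth_lderR (sm_smooth X) (sm_smooth h)).

Definition snabla (X Y : VF) : VF := mk_sm (smooth_lder (sm_smooth X) (sm_smooth Y)).

Definition sbr (X Y : VF) : VF := snabla X Y - snabla Y X.

Lemma sm_eqP (W : normedModType R) (a b : sm R n W) : (forall x, a x = b x) -> a = b.
Proof. by move=> ab; apply/val_inj/funext. Qed.

Lemma lder_linl (W : normedModType R) (h : E -> W) (a : R) (X Y : E -> E) x :
  lder (a *: X + Y) h x = a *: lder X h x + lder Y h x.
Proof. exact: (linearP ('d h x)). Qed.

Lemma lder_linr (W : normedModType R) (X : E -> E) (a : R) (h1 h2 : E -> W) x :
  smooth h1 -> smooth h2 ->
  lder X (a *: h1 + h2) x = a *: lder X h1 x + lder X h2 x.
Proof.
move=> s1 s2.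
have d1 := smooth_differentiable x s1.
have d2 := smooth_differentiable x s2.
apply: (etrans (diffDE _ (differentiableZ a d1) d2)).
by congr (_ + _); exact: diffZE.
Qed.

Lemma sm_valD (W : normedModType R) (a b : sm R n W) : (a + b : sm R n W) = (a : E -> W) + b :> (E -> W).
Proof. by []. Qed.

Lemma sact_linr X : linear (sact X).
Proof.
move=> a h1 h2; apply: sm_eqP => x.
exact: (lder_linr _ _ _ (sm_smooth h1) (sm_smooth h2)).
Qed.

Lemma sact_linl h : linear (sact^~ h).
Proof. by move=> a X Y; apply: sm_eqP => x; exact: lder_linl. Qed.

Lemma sbr_linl Y : linear (sbr^~ Y).
Proof.
move=> a X1 X2; rewrite /sbr.
have -> : snabla (a *: X1 + X2) Y = a *: snabla X1 Y + snabla X2 Y.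
  by apply: sm_eqP => x; exact: lder_linl.
have -> : snabla Y (a *: X1 + X2) = a *: snabla Y X1 + snabla Y X2.
  by apply: sm_eqP => x; exact: (lder_linr _ _ _ (sm_smooth X1) (sm_smooth X2)).
by rewrite scalerBr opprD addrACA.
Qed.

Lemma sbr_anti X Y : sbr X Y = - sbr Y X.
Proof. by rewrite /sbr opprB. Qed.

Lemma sact_br X Y h : sact (sbr X Y) h = sact X (sact Y h) - sact Y (sact X h).
Proof.
apply: sm_eqP => x.
exact: (congr1 (fun k => k x) (lder_bracket (sm_smooth X) (sm_smooth Y) (sm_smooth h))).
Qed.

Definition sev (x : E) (h : SF) : R^o := h x.
Lemma sev_linear x : linear (sev x).
Proof. by []. Qed.
HB.instance Definition _ x := GRing.isLinear.Build R SF R^o _ (sev x) (sev_linear x).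

(** * The fields lambda, their orders and the vanishing hypotheses *)

Section Lambda.
Variables (f g : VF).
Notation adf := (sbr^~ f).
Notation slam := (lam sbr f g).

Definition snested (r : seq nat) : VF :=
  foldr (fun ri Z => iter ri adf (sbr Z g)) f r.

Lemma snestedE r : snested r = nested_bracket f g r :> (E -> E).
Proof.
elim: r => [|ri r IHr]; first by [].
rewrite -[RHS]/(iter ri (fun Z' => bracket Z' f) (bracket (nested_bracket f g r) g)) -IHr.
rewrite -[LHS]/(sm_val (iter ri adf (sbr (snested r) g))).
elim: ri => [|k IH]; first by [].
rewrite [in RHS]iterS -IH; reflexivity.
Qed.

(** In [lambda] the exponents range over 'I_kappa, which ties the type of the tuples to the order.
    The separate bound [m] keeps that type fixed while kappa decreases. *)
Definition slambda m kappa j : VF :=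
  \sum_(r : j.-tuple 'I_m | ((sumn [seq nat_of_ord i | i <- r] + j).+1 == kappa)%N)
    snested [seq nat_of_ord i | i <- r].

Lemma sm_sum (W : normedModType R) I (s : seq I) P (F : I -> sm R n W) x :
  (\sum_(i <- s | P i) F i) x = \sum_(i <- s | P i) F i x.
Proof. by elim/big_rec2: _ => // i y h _ <-. Qed.

Lemma slambdaE kappa j : slambda kappa kappa j = lambda f g kappa j :> (E -> E).
Proof.
apply/funext => x; rewrite /slambda /lambda sm_sum; apply: eq_big => [r|r _].
  by rewrite sumnE big_map big_tuple.
by rewrite snestedE.
Qed.

Lemma slambda0 m kappa : slambda m kappa 0 = if kappa == 1%N then f else 0.
Proof.
rewrite /slambda.
have one (r : 0.-tuple 'I_m) : r = [tuple] by exact: tuple0.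
case: eqP => [->|k1]; last first.
  by rewrite big1// => r; rewrite (one r) /= => /eqP /esym.
by rewrite (big_pred1 [tuple])// => r; rewrite (one r) /= eqxx.
Qed.

Lemma iter_adf_sum k I (s : seq I) P (F : I -> VF) :
  iter k adf (sbr (\sum_(i <- s | P i) F i) g) =
  \sum_(i <- s | P i) iter k adf (sbr (F i) g).
Proof.
elim: k => [|k IH] /=; first exact: (br_sum sbr_linl).
by rewrite IH; exact: (br_sum sbr_linl).
Qed.

(** The head of the tuple is r_1: it describes the outermost run of f's, together with the g just
    inside it. *)
Lemma slambdaS m kappa j : slambda m kappa j.+1 =
  \sum_(i < m | (i < kappa)%N) iter i adf (sbr (slambda m (kappa - i.+1)%N j) g).
Proof.
rewrite /slambda.
rewrite (reindex (fun p : 'I_m * j.-tuple 'I_m => [tuple of p.1 :: p.2])) /=; last first.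
  exists (fun t : j.+1.-tuple 'I_m => (thead t, [tuple of behead t])) => [[i t] _|t _].
    by apply: injective_projections; [rewrite /= theadE|apply/val_inj].
  by rewrite -tuple_eta.
rewrite -(pair_big_dep xpredT
  (fun (i : 'I_m) (r : j.-tuple 'I_m) =>
    (((i + sumn [seq nat_of_ord i | i <- r])%N + j.+1).+1 == kappa)%N)
  (fun i r => iter i adf (sbr (snested [seq nat_of_ord i | i <- r]) g))) /=.
rewrite [RHS]big_mkcond /=; apply: eq_bigr => i _.
case: ifP => ik; last by rewrite big1// => r /eqP; lia.
by rewrite iter_adf_sum; apply: eq_bigl => r; lia.
Qed.

Lemma slam_unroll i j : slam i j.+1 =
  \sum_(k < i) iter k adf (sbr (slam (i - k.+1)%N j) g).
Proof.
elim: i => [|i IH]; first by rewrite big_ord0.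
rewrite big_ord_recl /= subSS subn0 IH addrC; congr (_ + _).
rewrite (br_sum sbr_linl); apply: eq_bigr => k _.
by rewrite /bump /= add1n subSS.
Qed.

Lemma slamS0 i : slam i.+1 0 = 0.
Proof.
elim: i => [|i IH]; first by rewrite /= addr0 (brxx sbr_anti).
by rewrite -[LHS]/(sbr (slam i.+1 0) f + 0) IH (br0 sbr_linl) addr0.
Qed.

(** Both the sum over tuples and the recursion [lam] unroll to a sum over the length of the last run
    of f's. *)
Lemma slambda_lam m i j : (i < m)%N -> slambda m i.+1 j = slam i j.
Proof.
elim: j i => [|j IH] i im.
  rewrite slambda0; case: i im => // i im.
  by rewrite slamS0.
rewrite slambdaS slam_unroll.
rewrite (big_ord_widen _ (fun k => iter k adf (sbr (slam (i - k.+1)%N j) g)) (ltnW im)).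
rewrite big_mkcond [RHS]big_mkcond /=; apply: eq_bigr => k _.
(* The index k = i occurs on the left only; it leaves a field of order 0, which is an empty sum. *)
rewrite ltnS leq_eqVlt; case: eqP => [->|ki] /=.
  rewrite ltnn subSS subnn (_ : slambda m 0 j = 0) ?(br0 sbr_linl); last by rewrite /slambda big_pred0.
  by elim: (i) => //= k' ->; rewrite (br0 sbr_linl).
case: ifP => // ki'; rewrite -(IH (i - k.+1)%N); last by lia.
by congr (iter _ _ (sbr (slambda _ _ _) _)); lia.
Qed.

Lemma slamE i j : slam i j = lambda f g i.+1 j :> (E -> E).
Proof. by rewrite -slambdaE slambda_lam. Qed.


Lemma vf_span_gen (S : set (E -> E)) X : S X -> vf_span S X.
Proof.
move=> SX; exists 1%N, (fun=> 1), (fun=> X); split=> // x.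
by rewrite big_ord1 scale1r.
Qed.

Lemma vf_span0 (S : set (E -> E)) : vf_span S (fun=> 0).
Proof.
by exists 0%N, (fun=> 0), (fun=> fun=> 0); split=> [[]//|x]; rewrite big_ord0.
Qed.

Lemma vf_spanD (S : set (E -> E)) X Y : vf_span S X -> vf_span S Y ->
  vf_span S (fun x => X x + Y x).
Proof.
move=> [k1 [c1 [Y1 [S1 E1]]]] [k2 [c2 [Y2 [S2 E2]]]].
exists (k1 + k2)%N, (fun i => match fintype.split i with inl a => c1 a | inr b => c2 b end),
  (fun i => match fintype.split i with inl a => Y1 a | inr b => Y2 b end); split.
  by move=> i; case: fintype.split => a; [exact: S1|exact: S2].
move=> x; rewrite big_split_ord E1 E2; congr (_ + _); apply: eq_bigr => i _.
  by rewrite (unsplitK (inl i)).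
by rewrite (unsplitK (inr i)).
Qed.

Lemma vf_span_sum (S : set (E -> E)) I (s : seq I) (P : pred I) (F : I -> E -> E) :
  (forall i, P i -> vf_span S (F i)) -> vf_span S (fun x => \sum_(i <- s | P i) F i x).
Proof.
move=> SF'; elim: s => [|i s IH].
  by under eq_fun do rewrite big_nil; exact: vf_span0.
under eq_fun do rewrite big_cons.
by case Pi: (P i) => //; apply: vf_spanD => //; exact: SF'.
Qed.

Lemma lie_layerS i : (0 < i)%N -> lie_layer f g i.+1 =
  vf_span [set Z | exists X Y,
     [/\ lie_layer f g i X, vf_span [set (f : E -> E); (g : E -> E)] Y & Z = bracket X Y]].
Proof. by case: i. Qed.

Lemma lie_layer_br i X Y : (0 < i)%N -> lie_layer f g i X ->
  vf_span [set (f : E -> E); (g : E -> E)] Y -> lie_layer f g i.+1 (bracket X Y).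
Proof.
by move=> i0 LX LY; rewrite lie_layerS//; apply: vf_span_gen; exists X, Y.
Qed.

Lemma nested_layer r : lie_layer f g (sumn r + size r).+1 (nested_bracket f g r).
Proof.
elim: r => [|ri r IH].
  by rewrite /= ; apply: vf_span_gen; left.
rewrite -[nested_bracket _ _ _]/(iter ri (fun Z' => bracket Z' f) (bracket (nested_bracket f g r) g)).
elim: ri => [|k IHk].
  rewrite -[(_ + _).+1]/((0 + sumn r + (size r).+1).+1) add0n addnS.
  by apply: lie_layer_br => //; apply: vf_span_gen; right.
rewrite iterS -[(_ + _).+1]/((k.+1 + sumn r + (size r).+1).+1) !addSn.
by apply: lie_layer_br => //; apply: vf_span_gen; left.
Qed.

Lemma nested_monomial r : lie_monomial f g (size r) (nested_bracket f g r).
Proof.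
elim: r => [|ri r IH]; first exact: lie_monomial_f.
rewrite -[nested_bracket _ _ _]/(iter ri (fun Z' => bracket Z' f) (bracket (nested_bracket f g r) g)).
elim: ri => [|k IHk].
  by have := lie_monomial_bracket IH (lie_monomial_g f g); rewrite addn1.
rewrite iterS.
by have := lie_monomial_bracket IHk (lie_monomial_f f g); rewrite addn0.
Qed.

Lemma lambda_layer i j : lie_layer f g i.+1 (lambda f g i.+1 j).
Proof.
have lay (r : j.-tuple 'I_i.+1) : ((\sum_(k < j) tnth r k) + j).+1 == i.+1 ->
    lie_layer f g i.+1 (nested_bracket f g [seq nat_of_ord k | k <- r]).
  move=> /eqP E0; have := nested_layer [seq nat_of_ord k | k <- r].
  by rewrite sumnE big_map big_tuple size_map size_tuple E0.
case: i lay => [|i] lay.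
  exact: vf_span_sum.
by rewrite lie_layerS//; apply: vf_span_sum => r /lay; rewrite lie_layerS.
Qed.

Lemma lambda_monomials i j : vf_span (lie_monomial f g j) (lambda f g i j).
Proof.
apply: vf_span_sum => r _; apply: vf_span_gen.
by have := nested_monomial [seq nat_of_ord k | k <- r]; rewrite size_map size_tuple.
Qed.

Lemma lambda_Lie i j : Lie f g (lambda f g i j).
Proof.
have [k [c [Y [SY EY]]]] := lambda_monomials i j.
by exists k, c, Y; split=> // a; exists j; exact: SY.
Qed.

Lemma lambda_order i j : lambda f g i.+1 j <> cst 0 ->
  has_order f g i.+1 (lambda f g i.+1 j).
Proof.
move=> l0; split => //; first exact: lambda_Lie.
case: i l0 => [|i] l0; first by left; split=> //; exact: lambda_layer.
right; split=> //; exists (lambda f g i.+2 j), (fun=> 0); split=> //.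
- exact: lambda_layer.
- exact: vf_span0.
- by move=> x; rewrite addr0.
Qed.

Lemma lambda_order_g i j : has_order_g f g j (lambda f g i j).
Proof. by split; [exact: lambda_Lie|exact: lambda_monomials]. Qed.

(** Being non-zero forces the indices into the range that defines [Lfg]: the field vanishes for j >
    i, and for j = 0 unless i = 0. *)
Lemma lambda_Lfg i j : lambda f g i.+1 j <> cst 0 -> Lfg f g (lambda f g i.+1 j).
Proof.
rewrite -slamE => l0; apply: vf_span_gen.
have l0' : slam i j <> 0 by move=> e; apply: l0; rewrite e.
case: i l0 l0' => [|i] l0 l0'.
  by case: j l0 l0' => // _ _; left; rewrite -slamE.
right; exists i.+2, j; split=> //; last by rewrite slamE.
case: j l0 l0' => [|j] l0 l0'; first by rewrite slamS0 in l0'.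
rewrite /= ltnNge; apply/negP => ij; apply: l0'.
by rewrite (lam_big sbr_linl).
Qed.

Lemma lprod_vanish V l i j : (i, j) \in l -> slam i j = 0 ->
  lprod sact sbr f g l V = 0.
Proof.
move=> + ij0; elim: l => // p l IH; rewrite in_cons => /orP[/eqP <-|/IH lp].
  by rewrite /= ij0 (act0 sact_linl).
by rewrite /= -/(lprod sact sbr f g l V) lp (actr0 sact_linr).
Qed.

Lemma lprod_lder_seq (V : SF) l : lprod sact sbr f g l V =
  lder_seq (fun p : 'I_(size l) => lambda f g (nth (0, 0)%N l p).1.+1 (nth (0, 0)%N l p).2) V
  :> (E -> R).
Proof.
rewrite /lder_seq.
have -> : foldr (fun (p : 'I_(size l)) W =>
      lder (lambda f g (nth (0, 0)%N l p).1.+1 (nth (0, 0)%N l p).2) W) (V : E -> R) (enum 'I_(size l)) =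
  foldr (fun q W => lder (lambda f g q.1.+1 q.2) W) (V : E -> R)
    [seq nth (0, 0)%N l k | k <- [seq nat_of_ord k | k <- enum 'I_(size l)]].
  by rewrite -map_comp foldr_map.
rewrite val_enum_ord map_nth_iota0// take_size.
elim: l => // p l IH.
rewrite -[RHS]/(lder (lambda f g p.1.+1 p.2)
  (foldr (fun q W => lder (lambda f g q.1.+1 q.2) W) (V : E -> R) l)) -IH -slamE.
reflexivity.
Qed.

Lemma lprod_sum_order l (F : nat * nat -> nat) :
  (\sum_(p < size l) F (nth (0, 0)%N l p))%N = sumn [seq F p | p <- l].
Proof. by rewrite sumnE big_map (big_nth (0, 0)%N) big_mkord. Qed.

(** The hypotheses speak of fields that have an order, hence of non-zero ones; a product with a zero
    factor vanishes by linearity. *)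
Lemma lprod_nonzero (V : SF) x l :
  ((forall p, p \in l -> lambda f g p.1.+1 p.2 <> cst 0) ->
    sev x (lprod sact sbr f g l V) = 0) ->
  sev x (lprod sact sbr f g l V) = 0.
Proof.
move=> H; have [all0|/existsNP[[i j] /not_implyP[pl /contrapT p0]]] :=
  pselect (forall p, p \in l -> lambda f g p.1.+1 p.2 <> cst 0); first exact: H.
rewrite (@lprod_vanish V l i j pl) ?linear0//.
by apply: sm_eqP => y; rewrite slamE p0.
Qed.

Lemma vanish_upto_lprod (V : SF) x N l : vanish_upto f g V x N ->
  l != [::] -> (lord l <= N)%N -> sev x (lprod sact sbr f g l V) = 0.
Proof.
move=> vN l0 lN; apply: lprod_nonzero => nz.
rewrite /sev lprod_lder_seq.
apply: (vN _ _ (fun p : 'I_(size l) => (nth (0, 0)%N l p).1.+1)).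
- by rewrite lt0n size_eq0.
- by move=> p; apply/lambda_Lfg/nz/mem_nth.
- by move=> p; apply/lambda_order/nz/mem_nth.
- by rewrite (lprod_sum_order l (fun p => p.1.+1)).
Qed.

Lemma vanish_at_lprod (V : SF) x M q l : vanish_at f g V x M q ->
  l != [::] -> lord l = M -> lgord l = q -> sev x (lprod sact sbr f g l V) = 0.
Proof.
move=> vN l0 lN lq; apply: lprod_nonzero => nz.
rewrite /sev lprod_lder_seq.
apply: (vN _ _ (fun p : 'I_(size l) => (nth (0, 0)%N l p).1.+1)
  (fun p : 'I_(size l) => (nth (0, 0)%N l p).2)).
- by rewrite lt0n size_eq0.
- by move=> p; apply/lambda_Lfg/nz/mem_nth.
- by move=> p; apply/lambda_order/nz/mem_nth.
- by move=> p; exact: lambda_order_g.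
- by rewrite (lprod_sum_order l (fun p => p.1.+1)).
- by rewrite (lprod_sum_order l (fun p => p.2)).
Qed.

End Lambda.

Fixpoint lie_taylor (X Z : E -> E) M (h : E -> R) : E -> R :=
  if M is M'.+1 then lder X (lie_taylor X Z M' h) + lie_taylor X Z M' (lder Z h) else h.

Lemma lie_taylorE (X Z : VF) M (h : SF) :
  taylor sact X Z M h = lie_taylor X Z M h :> (E -> R).
Proof.
elim: M h => [|M IH] h; first by [].
have e1 : sact X (taylor sact X Z M h) = lder X (lie_taylor X Z M h) :> (E -> R).
  exact (f_equal (fun k : E -> R => lder X k) (IH h)).
exact (eq_trans (sm_valD (sact X (taylor sact X Z M h)) (taylor sact X Z M (sact Z h)))
  (f_equal2 (fun a b : E -> R => a + b) e1 (IH (sact Z h)))).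
Qed.

(** All that is kept of the conditions on the Lie derivatives at x. N = 0 with rho = 0 expresses a
    first-order decrease along X alone. *)
Definition descent (f g : E -> E) (V : E -> R) (x : E) : Prop :=
  exists (u w rho : R) (N : nat), let X := f + u *: g in let Z := rho *: (f + w *: g) in
  [/\ 0 <= rho, forall M, (1 <= M <= N)%N -> lie_taylor X Z M V x = 0 &
      lie_taylor X Z N.+1 V x < 0].

Lemma lder_add (X Y : E -> E) (h : E -> R) x : lder (X + Y) h x = lder X h x + lder Y h x.
Proof. exact: (linearD ('d h x)). Qed.

Lemma lder_scale a (Y : E -> E) (h : E -> R) x : lder (a *: Y) h x = a * lder Y h x.
Proof. exact: (linearZ_LR ('d h x)). Qed.

Lemma descent_one (f g : E -> E) (V : E -> R) x u : lder (f + u *: g) V x < 0 -> descent f g V x.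
Proof.
move=> neg; exists u, 0, 0, 0%N; split=> // [[|M] //|].
rewrite -[lie_taylor _ _ _ _ _]/(lder (f + u *: g) V x + lder (0 *: (f + 0 *: g)) V x).
by rewrite lder_scale mul0r addr0.
Qed.

Lemma condition_descent (f g : VF) (V : SF) x :
  lder g V x <> 0 \/ (lder g V x = 0 /\ (lder f V x < 0 \/ condition_B f g V x)) ->
  descent f g V x.
Proof.
case=> [g0|[_ [fneg|[N [N1 vN cP]]]]].
(* This u makes the derivative of V along f + u g equal to -1. *)
- apply: (@descent_one _ _ _ _ (- (lder f V x + 1) / lder g V x)).
  rewrite lder_add lder_scale divfK; last exact/eqP.
  by rewrite opprD addrA subrr add0r ltrN10.
- by apply: (@descent_one _ _ _ _ 0); rewrite lder_add lder_scale mul0r addr0.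
pose ev : {linear SF -> R^o} := sev x.
have iterE k : ev (iter k (sact f) V) = iter k (lder f) V x.
  have : sm_val (iter k (sact f) V) = iter k (lder f) V; last by move=> /(congr1 (@^~ x)).
  elim: k => [|k IH]; first by [].
  exact (f_equal (fun h : E -> R => lder f h) IH).
have van l : l != [::] -> (lord l <= N)%N -> ev (lprod sact sbr f g l V) = 0.
  exact: vanish_upto_lprod.
have lamE j : ev (sact (lam sbr f g N j) V) = lder (lambda f g N.+1 j) V x.
  by rewrite -(slamE f g N j).
have [] := @taylor_neg R _ _ sact sbr sact_linr sact_linl sbr_linl sbr_anti sact_br f g V
  ev N.
  rewrite iterE; case: cP => [p1|[p2 p3]]; [by left|right; split; first by []].
  case: p3 => [[_ [j [oj /andP[_ jN] lj vj]]]|[N2 oN [j [oj /andP[_ jN] lj vj]]]|[eN lN]].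
  - apply: Or31; exists j; split=> //; first by rewrite lamE; exact/eqP.
    (* [P2i] grants the vanishing only for j > 2, which the existence of an even q with 0 < q < j
       implies. *)
    move=> q eq /andP[q0 qj] l; apply: vanish_at_lprod; apply: vj => //.
      by case: q eq q0 qj => [|[|q]] //= _ _ qj; lia.
    by rewrite q0 qj.
  - apply: Or32; split=> //; exists j; split=> //; first lia.
      by rewrite lamE; exact/eqP.
    by move=> q eq qj l; apply: vanish_at_lprod; exact: vj.
  - by apply: Or33; rewrite lamE.
(* Z = mu f - X = (mu - 1) f - u g, whence rho = mu - 1 and w = -u / rho. *)
move=> mu [u [mu1 neg]]; exists u, (- u / (mu - 1)), (mu - 1), N => X Z.
have mu0 : mu - 1 != 0 by rewrite subr_eq0 gt_eqF.
have XE : X = (f + u *: g : VF) :> (E -> E) by [].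
have ZE : Z = (mu *: f - (f + u *: g) : VF) :> (E -> E).
  apply/funext => y.
  rewrite -[LHS]/((mu - 1) *: (f y + (- u / (mu - 1)) *: g y)).
  rewrite -[RHS]/(mu *: f y - (f y + u *: g y)).
  by rewrite scalerDr scalerA mulrC divfK// scalerBl scale1r opprD addrA scaleNr.
split; first by rewrite subr_ge0 ltW.
  move=> M MN; rewrite XE ZE -lie_taylorE.
  exact: (taylor_low sact_linr sact_linl sbr_linl sbr_anti sact_br van mu u MN).
by rewrite XE ZE -lie_taylorE.
Qed.

End Concrete.

(** * Flows of smooth vector fields *)

Section Integral.
Context {R : realType}.
Notation mu := (@lebesgue_measure R).
Implicit Types h : R -> R.

Lemma integrable_continuous h a b : continuous h ->
  mu.-integrable `[a, b] (EFin \o h).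
Proof.
move=> ch; apply: continuous_compact_integrable; first exact: segment_compact.
exact: continuous_subspaceT.
Qed.

Lemma integrable_sub_itv h a b c d : a <= c -> d <= b ->
  mu.-integrable `[a, b] (EFin \o h) -> mu.-integrable `[c, d] (EFin \o h).
Proof.
move=> ac db; apply: integrableS; [exact: measurable_itv|exact: measurable_itv|].
by apply: subset_itv; rewrite bnd_simp.
Qed.

Lemma Rintegral_split h a b c : a <= b -> b <= c ->
  mu.-integrable `[a, c] (EFin \o h) ->
  \int[mu]_(t in `[a, c]) h t = \int[mu]_(t in `[a, b]) h t + \int[mu]_(t in `[b, c]) h t.
Proof.
move=> ab bc ih; rewrite -(Rintegral_itv_obnd_cbnd (r := b)); last first.
  apply: integrableS ih; [exact: measurable_itv|exact: measurable_itv|].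
  by apply: subset_itv; rewrite bnd_simp.
rewrite -(Rintegral_itvB (x := b) ih) ?bnd_simp//.
by rewrite addrC subrK.
Qed.

Lemma Rintegral_norm_le h a b M : a <= b ->
  mu.-integrable `[a, b] (EFin \o h) -> (forall t, a <= t <= b -> `|h t| <= M) ->
  `|\int[mu]_(t in `[a, b]) h t| <= M * (b - a).
Proof.
move=> ab ih hM.
apply: (le_trans (le_normr_Rintegral _ ih)); first exact: measurable_itv.
have muE : fine (mu `[a, b]) = b - a.
  rewrite lebesgue_measure_itv /= lte_fin; case: ltgtP ab => // -> _.
  by rewrite subrr.
rewrite -muE -Rintegral_cst; last exact: measurable_itv.
apply: le_Rintegral; first exact: measurable_itv.
- exact: integrable_norm ih.
- by apply: integrable_continuous => ?; exact: cvg_cst.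
- by move=> t; rewrite /= in_itv /= => tab; exact: hM.
Qed.

Lemma Rintegral_point h a : \int[mu]_(t in `[a, a]) h t = 0.
Proof. by rewrite set_itv1 Rintegral_set1. Qed.

End Integral.

(** * Estimates on balls and truncation to a ball *)

Section Norm.
Context {R : realType} {n : nat}.
Notation E := 'rV[R]_n.

Lemma rV_norm_leP (x : E) c : 0 <= c -> (forall i, `|x 0 i| <= c) -> `|x| <= c.
Proof.
move=> c0 xc; rewrite [leLHS]/Num.Def.normr /= mx_normrE.
by apply: bigmax_le => // -[i j] _ /=; rewrite (ord1 i).
Qed.

Lemma rV_coord_le (x : E) i : `|x 0 i| <= `|x|.
Proof.
rewrite [leRHS]/Num.Def.normr /= mx_normrE.
exact: (le_bigmax _ (fun ij => `|x ij.1 ij.2|) (0, i)).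
Qed.

Lemma ball_compact (B : R) : compact [set x : E | `|x| <= B].
Proof.
apply: bounded_closed_compact.
  exists B; split; first exact: num_real.
  by move=> M BM x /= xB; rewrite (le_trans xB)// ltW.
apply: (@preimage_closed _ _ (fun x : E => `|x|) [set r | r <= B]).
  by move=> x _; exact: norm_continuous.
exact: closed_le.
Qed.

Lemma continuous_bounded_ball (h : E -> R) B : continuous h ->
  exists2 M : R, 0 < M & forall x : E, `|x| <= B -> `|h x| <= M.
Proof.
move=> ch.
have /compact_bounded[M [_ bM]] : compact (h @` [set x : E | `|x| <= B]).
  by apply: continuous_compact; [exact: continuous_subspaceT|exact: ball_compact].
exists (`|M| + 1); first by rewrite ltr_wpDl.
move=> x xB; apply: bM; last by exists x.
by rewrite (le_lt_trans (ler_norm _))// ltrDl.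
Qed.

(** Mean value theorem on the segment from y to x, which stays in the ball by convexity. *)
Lemma smooth_lipschitz_ballR (h : E -> R) B : smooth h ->
  exists2 L : R, 0 < L & forall x y : E, `|x| <= B -> `|y| <= B -> `|h x - h y| <= L * `|x - y|.
Proof.
move=> hs.
have /choice[M HM] : forall i : 'I_n, exists M : R, 0 < M /\
    forall x : E, `|x| <= B -> `|'d h x (delta_mx 0 i)| <= M.
  move=> i; have [M M0 bM] := @continuous_bounded_ball (fun x => 'd h x (delta_mx 0 i)) B
    (smooth_continuous (smooth_dir (delta_mx 0 i) hs)).
  by exists M.
exists (1 + \sum_i M i); first by rewrite ltr_wpDr// sumr_ge0// => i _; rewrite ltW//; case: (HM i).
move=> x y xB yB.
pose F (r : R) := h (y + r *: (x - y)).
pose dF (r : R) : R := 'd h (y + r *: (x - y)) (x - y).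
have FF (r : R) : is_derive r (1 : R) F (dF r).
  exact: (is_derive_line (smooth_differentiable _ hs)).
have [c c01] : exists2 c, c \in `]0, 1[%R & F 1 - F 0 = dF c * (1 - 0).
  apply: MVT => //; apply: derivable_within_continuous => r _.
  exact: (@ex_derive _ _ _ _ _ _ _ (FF r)).
rewrite subr0 mulr1 /F scale1r scale0r addr0 (addrC y) subrK => ->.
have cB : `|y + c *: (x - y)| <= B.
  have -> : y + c *: (x - y) = (1 - c) *: y + c *: x.
    by rewrite scalerBr scalerBl scale1r addrA addrAC.
  move: c01; rewrite in_itv /= => /andP[c0 c1].
  rewrite (le_trans (ler_normD _ _))// !normrZ (gtr0_norm c0) gtr0_norm ?subr_gt0//.
  apply: (@le_trans _ _ ((1 - c) * B + c * B)); last by rewrite -mulrDl subrK mul1r.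
  by rewrite lerD// ler_wpM2l// ?subr_ge0 ltW.
rewrite /dF diff_deltaE (le_trans (ler_norm_sum _ _ _))// mulrDl mul1r mulr_suml.
rewrite -[leLHS]add0r lerD// ler_sum// => i _.
rewrite normrM mulrC ler_pM// ?rV_coord_le//.
by have [_] := HM i; exact.
Qed.

Lemma smooth_lipschitz_ball (X : E -> E) B : smooth X ->
  exists2 L : R, 0 < L & forall x y : E, `|x| <= B -> `|y| <= B -> `|X x - X y| <= L * `|x - y|.
Proof.
move=> Xs.
have /choice[L HL] : forall i : 'I_n, exists L : R, 0 < L /\
    forall x y : E, `|x| <= B -> `|y| <= B -> `|X x 0 i - X y 0 i| <= L * `|x - y|.
  move=> i; have [L L0 bL] := @smooth_lipschitz_ballR (fun x => X x 0 i) B (fun k => Ck_coord i (Xs k)).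
  by exists L.
have L0 i : 0 <= L i by case: (HL i) => /ltW.
exists (1 + \sum_i L i); first by rewrite ltr_wpDr// sumr_ge0.
move=> x y xB yB; apply: rV_norm_leP.
  by rewrite mulr_ge0// addr_ge0// sumr_ge0.
move=> i; rewrite !mxE; have [_ /(_ x y xB yB) h1] := HL i.
apply: (le_trans h1); rewrite ler_wpM2r// (bigD1 i)//= addrCA lerDl.
by rewrite addr_ge0// sumr_ge0.
Qed.

Lemma continuous_bounded_ballV (X : E -> E) B : continuous X ->
  exists2 M : R, 0 < M & forall x : E, `|x| <= B -> `|X x| <= M.
Proof.
move=> cX; have cN : continuous (fun x => `|X x|).
  by move=> x; apply: continuous_comp; [exact: cX|exact: norm_continuous].
have [M M0 bM] := continuous_bounded_ball B cN.
by exists M => // x /bM; rewrite normr_id.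
Qed.

(** Retraction onto the ball of the sup norm. It is 1-Lipschitz, so a smooth field composed with it
    is globally bounded and Lipschitz. *)
Definition clamp (B : R) (x : E) : E := \row_i Num.max (- B) (Num.min B (x 0 i)).

Lemma clamp_id B x : `|x| <= B -> clamp B x = x.
Proof.
move=> xB; apply/rowP => i; rewrite mxE.
have := le_trans (rV_coord_le x i) xB; rewrite ler_norml => /andP[h1 h2].
by rewrite (min_idPr h2) (max_idPr h1).
Qed.

Lemma clamp_norm B x : 0 <= B -> `|clamp B x| <= B.
Proof.
move=> B0; apply: rV_norm_leP => // i; rewrite mxE ler_norml.
by rewrite le_max lexx /= ge_max ge_min lexx /= andbT (le_trans _ B0)// oppr_le0.
Qed.

Lemma clamp_lip B x y : 0 <= B -> `|clamp B x - clamp B y| <= `|x - y|.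
Proof.
move=> B0; apply: rV_norm_leP => // i; rewrite !mxE.
have := rV_coord_le (x - y) i; rewrite !mxE; apply: le_trans.
move: (x 0 i) (y 0 i) => a b.
rewrite /Num.max /Num.min.
have ab1 := ler_norm (a - b); have ab2 := ler_norm (b - a); rewrite distrC in ab2.
by case: (ltP B a) => h1; case: (ltP B b) => h2; case: (ltP (- B) B) => h3;
  case: (ltP (- B) a) => h4; case: (ltP (- B) b) => h5;
  rewrite ler_norml; apply/andP; split; lra.
Qed.

End Norm.

Section Geometric.
Context {R : realType}.
Notation q k := (2^-1 ^+ k : R).

Lemma geo_gt0 k : 0 < q k. Proof. by rewrite exprn_gt0// invr_gt0. Qed.

Lemma geo_half k : q k.+1 = q k / 2. Proof. by rewrite exprSr. Qed.

Lemma le_geo (a b c : R) : (forall k, a <= b + c * q k) -> a <= b.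
Proof.
move=> H; rewrite leNgt; apply/negP => ba.
have d0 : 0 < a - b by rewrite subr_gt0.
pose x := `|c| / (a - b).
have x0 : 0 <= x by rewrite divr_ge0// ltW.
have := archi_boundP x0; set k := Num.bound x => xk.
have := H k; rewrite leNgt => /negP; apply.
rewrite -ltrBrDl (le_lt_trans (ler_norm _))// normrM (gtr0_norm (geo_gt0 k)).
rewrite exprVn ltr_pdivrMr ?exprn_gt0//.
have : `|c| < k%:R * (a - b) by rewrite -ltr_pdivrMr.
move/lt_le_trans; apply; rewrite mulrC ler_wpM2l ?ltW//.
by rewrite -natrX ltr_nat ltn_expl.
Qed.

(** u_k - 2C 2^-k increases, u_k + 2C 2^-k decreases, and the first stays below the second; the
    supremum of the first is the limit, with its rate. *)
Lemma geo_limit (u : nat -> R) C : (forall k, `|u k.+1 - u k| <= C * q k) ->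
  exists l, forall k, `|l - u k| <= 2 * C * q k.
Proof.
move=> uC.
pose v k := u k - 2 * C * q k; pose w k := u k + 2 * C * q k.
have C0 : 0 <= C by have := le_trans (normr_ge0 _) (uC 0%N); rewrite mulr1.
have vS k : v k <= v k.+1.
  by rewrite /v geo_half; have := uC k; rewrite ler_norml => /andP[h1 h2]; lra.
have wS k : w k.+1 <= w k.
  by rewrite /w geo_half; have := uC k; rewrite ler_norml => /andP[h1 h2]; lra.
have vD k d : v k <= v (k + d)%N.
  by elim: d => [|d IH]; rewrite ?addn0// addnS (le_trans IH).
have wD k d : w (k + d)%N <= w k.
  by elim: d => [|d IH]; rewrite ?addn0// addnS (le_trans _ IH).
have vw k m : v k <= w m.
  apply: (le_trans (vD k m)); apply: (@le_trans _ _ (w (k + m)%N)).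
    by rewrite /v /w lerD2l ge0_cp// ?mulr_ge0// ltW// geo_gt0.
  by rewrite addnC.
exists (sup (range v)) => k.
have vk : v k <= sup (range v).
  by apply: ub_le_sup; [exists (w 0%N) => _ [m _ <-]; exact: vw|exists k].
have wk : sup (range v) <= w k.
  by apply: ge_sup; [exists (v 0%N), 0%N|move=> _ [m _ <-]; exact: vw].
by rewrite ler_norml; rewrite /v /w in vk wk; apply/andP; split; lra.
Qed.

End Geometric.

Lemma lerD3 (R : realFieldType) (a b d m z : R) :
  a <= z -> b <= m -> d <= z -> a + b + d <= m + (z + z).
Proof. by lra. Qed.

(** * Picard iteration and Taylor expansion along a flow *)

Section Picard.
Context {R : realType} {n : nat}.
Notation E := 'rV[R]_n.
Notation mu := (@lebesgue_measure R).
Notation q k := (2^-1 ^+ k : R).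

Lemma lipschitz_continuous (V W : normedModType R) (phi : V -> W) M : (forall t t', `|phi t - phi t'| <= M * `|t - t'|) ->
  continuous phi.
Proof.
move=> H t; apply/cvgrPdist_le => e e0; near=> t'.
apply: (le_trans (H _ _)).
have M1 : 0 < `|M| + 1 by rewrite ltr_wpDl.
apply: (@le_trans _ _ ((`|M| + 1) * `|t - t'|)).
  by rewrite ler_wpM2r// (le_trans (ler_norm _))// lerDl.
rewrite mulrC -ler_pdivlMr//; near: t'.
by apply: cvgr_dist_le; [exact: cvg_id|rewrite divr_gt0].
Unshelve. all: by end_near. Qed.

Lemma continuous_coord (phi : R -> E) i : continuous phi -> continuous (fun t : R => phi t 0 i).
Proof.
by move=> c t; apply: (continuous_comp (c t) (@coord_continuous _ _ _ _ _ _)).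
Qed.

Section Iteration.
Variables (G : E -> E) (L M tau s : R) (y : E).
Hypotheses (Gc : continuous G) (GM : forall x, `|G x| <= M)
  (GL : forall x z, `|G x - G z| <= L * `|x - z|) (tau0 : 0 <= tau) (Ltau : L * tau <= 2^-1)
  (L0 : 0 <= L).

Let M0 : 0 <= M. Proof. exact: le_trans (normr_ge0 _) (GM 0). Qed.

(** Projection of time onto [s, s + tau]; through it the iterates live on the whole line, with
    global Lipschitz bounds. *)
Let m (t : R) : R := Num.max s (Num.min t (s + tau)).
Let ms (t : R) : s <= m t. Proof. by rewrite le_max lexx. Qed.
Let me (t : R) : m t <= s + tau.
Proof. by rewrite ge_max lerDl tau0 ge_min lexx orbT. Qed.
Let m_lip (t t' : R) : `|m t - m t'| <= `|t - t'|.
Proof.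
have ab1 := ler_norm (t - t'); have ab2 := ler_norm (t' - t); rewrite distrC in ab2.
rewrite /m /Num.max /Num.min.
by case: (ltP t (s + tau)) => h1; case: (ltP t' (s + tau)) => h2;
  [case: (ltP s t) => h4; case: (ltP s t') => h5
  |case: (ltP s t) => h4; case: (ltP s (s + tau)) => h5
  |case: (ltP s (s + tau)) => h4; case: (ltP s t') => h5
  |case: (ltP s (s + tau)) => h4];
  rewrite ler_norml; apply/andP; split; lra.
Qed.

Definition picard_map (phi : R -> E) (t : R) : E :=
  \row_i (y 0 i + \int[mu]_(v in `[s, m t]) G (phi v) 0 i).

Let Gphi (phi : R -> E) i : continuous phi -> continuous (fun v : R => G (phi v) 0 i).
Proof.
move=> c; apply: (@continuous_coord (fun v : R => G (phi v))) => v.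
by apply: (continuous_comp (c v)); exact: Gc.
Qed.

Lemma picard_map_lip (phi : R -> E) : continuous phi -> forall t t' : R,
  `|picard_map phi t - picard_map phi t'| <= M * `|t - t'|.
Proof.
move=> c t t'; apply: rV_norm_leP => [|i]; first by rewrite mulr_ge0.
rewrite !mxE opprD addrACA subrr add0r.
apply: (@le_trans _ _ (M * `|m t - m t'|)); last by rewrite ler_wpM2l// m_lip.
have main a b : s <= a -> a <= b ->
    `|\int[mu]_(v in `[s, b]) G (phi v) 0 i - \int[mu]_(v in `[s, a]) G (phi v) 0 i| <= M * `|b - a|.
  move=> sa ab.
  rewrite (Rintegral_split sa ab (integrable_continuous _ _ (@Gphi _ i c))) addrAC subrr add0r.
  rewrite (ger0_norm (_ : 0 <= b - a)) ?subr_ge0//.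
  apply: Rintegral_norm_le => //; first exact: (integrable_continuous _ _ (@Gphi _ i c)).
  by move=> v _; rewrite (le_trans (rV_coord_le _ _)).
have [mm|mm] := leP (m t') (m t); first exact: main.
by rewrite distrC (distrC (m t)); apply: main => //; exact: ltW.
Qed.

Lemma picard_map_continuous (phi : R -> E) : continuous phi -> continuous (picard_map phi).
Proof. by move=> c; apply: lipschitz_continuous; exact: picard_map_lip. Qed.

Lemma picard_map_contr (phi psi : R -> E) (K : R) : continuous phi -> continuous psi -> 0 <= K ->
  (forall t, `|phi t - psi t| <= K) ->
  forall t, `|picard_map phi t - picard_map psi t| <= K / 2.
Proof.
move=> c1 c2 K0 dK t; apply: rV_norm_leP => [|i]; first by rewrite divr_ge0.
rewrite !mxE opprD addrACA subrr add0r.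
have i1 := @integrable_continuous _ _ s (m t) (@Gphi _ i c1).
have i2 := @integrable_continuous _ _ s (m t) (@Gphi _ i c2).
rewrite -RintegralB//.
apply: (@le_trans _ _ (L * K * (m t - s))).
  apply: Rintegral_norm_le => //; first by apply: integrable_continuous => v; apply: cvgB; [exact: (@Gphi _ i c1)|exact: (@Gphi _ i c2)].
  move=> v _; apply: (@le_trans _ _ `|G (phi v) - G (psi v)|).
    by have := rV_coord_le (G (phi v) - G (psi v)) i; rewrite !mxE.
  by apply: (le_trans (GL _ _)); rewrite ler_wpM2l.
apply: (@le_trans _ _ (L * K * tau)).
  by rewrite ler_wpM2l ?mulr_ge0// lerBlDl.
by rewrite mulrAC (mulrC K) ler_wpM2r.
Qed.

Let it k := iter k picard_map (fun=> y).

Let it_cont k : continuous (it k).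
Proof. by elim: k => [|k IH]; [exact: cst_continuous|exact: picard_map_continuous]. Qed.

Let it_diff k t : `|it k.+1 t - it k t| <= M * tau * q k.
Proof.
elim: k t => [|k IH] t.
  rewrite mulr1; apply: rV_norm_leP => [|i]; first by rewrite mulr_ge0.
  rewrite !mxE addrAC subrr add0r.
  apply: (@le_trans _ _ (M * (m t - s))); last by rewrite ler_wpM2l// lerBlDl.
  apply: Rintegral_norm_le => //; first exact: (integrable_continuous _ _ (@Gphi _ i (@it_cont 0%N))).
  by move=> v _; rewrite (le_trans (rV_coord_le _ _)).
rewrite geo_half mulrA.
apply: (@picard_map_contr (it k.+1) (it k)); [exact: it_cont|exact: it_cont| |exact: IH].
by rewrite !mulr_ge0// ltW// geo_gt0.
Qed.

Lemma picard_exists : exists phi : R -> E, [/\ continuous phi, phi s = y,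
  forall t, s <= t <= s + tau -> `|phi t - y| <= M * tau &
  forall t, s <= t <= s + tau -> forall i,
    phi t 0 i = y 0 i + \int[mu]_(v in `[s, t]) G (phi v) 0 i].
Proof.
pose K := 2 * (M * tau).
have K0 : 0 <= K by rewrite !mulr_ge0.
have /choice[l Hl] : forall ti : R * 'I_n, exists l : R,
    forall k, `|l - it k ti.1 0 ti.2| <= K * q k.
  move=> [t i]; apply: geo_limit => k /=; apply: le_trans (it_diff k t).
  by have := rV_coord_le (it k.+1 t - it k t) i; rewrite !mxE.
pose phi t : E := \row_i l (t, i).
have phik t k : `|phi t - it k t| <= K * q k.
  apply: rV_norm_leP => [|i]; first by rewrite mulr_ge0// ltW// geo_gt0.
  by rewrite !mxE; exact: (Hl (t, i)).
have phi_cont : continuous phi.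
  apply: (@lipschitz_continuous _ _ _ M) => t t'; apply: (@le_geo _ _ _ (K + K)) => k.
  have -> : phi t - phi t' = (phi t - it k.+1 t) + (it k.+1 t - it k.+1 t') - (phi t' - it k.+1 t').
    by rewrite opprB !addrA !subrK.
  have b1 := phik t k.+1; have b2 := phik t' k.+1.
  have b3 := picard_map_lip (@it_cont k) t t'.
  have b4 : K * q k.+1 <= K * q k.
    by rewrite ler_wpM2l// geo_half ler_pdivrMr// ler_peMr ?ler1n// ltW// geo_gt0.
  apply: (le_trans (ler_normB _ _)); apply: (le_trans (lerD (ler_normD _ _) (lexx _))).
  rewrite -[it k.+1 t]/(picard_map (it k) t) -[it k.+1 t']/(picard_map (it k) t') in b1 b2 *.
  by rewrite mulrDl; apply: lerD3 => //; [exact: le_trans b1 b4|exact: le_trans b2 b4].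
have fixphi t i : phi t 0 i = picard_map phi t 0 i.
  apply/eqP; rewrite -subr_eq0 -normr_le0; apply: (@le_geo _ _ _ (K + K)) => k.
  rewrite add0r.
  have aux (a b d : E) : a 0 i - b 0 i = (a - d) 0 i - (b - d) 0 i.
    by rewrite !mxE opprB addrA subrK.
  rewrite (aux _ _ (it k.+1 t)).
  have b1 := le_trans (rV_coord_le _ i) (phik t k.+1).
  have b2 := le_trans (rV_coord_le _ i)
    (picard_map_contr phi_cont (@it_cont k) (mulr_ge0 K0 (ltW (geo_gt0 k))) (phik^~ k) t).
  have qk := geo_gt0 (R := R) k.
  have b4 : K * q k.+1 <= K * q k.
    by rewrite ler_wpM2l// geo_half ler_pdivrMr// ler_peMr ?ler1n// ltW// geo_gt0.
  have b5 : K * q k / 2 <= K * q k.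
    by rewrite ler_pdivrMr// ler_peMr ?ler1n// mulr_ge0// ltW.
  by apply: (le_trans (ler_normB _ _)); rewrite mulrDl; apply: lerD; [exact: le_trans b1 b4|exact: le_trans b2 b5].
have mt t : s <= t <= s + tau -> m t = t.
  by move=> /andP[st te]; rewrite /m (min_idPl te) (max_idPr st).
have phiE t : s <= t <= s + tau -> forall i,
    phi t 0 i = y 0 i + \int[mu]_(v in `[s, t]) G (phi v) 0 i.
  by move=> st i; rewrite fixphi mxE mt.
exists phi; split=> //.
  by apply/rowP => i; rewrite phiE ?lexx ?lerDl// Rintegral_point addr0.
move=> t st; apply: rV_norm_leP => [|i]; first by rewrite mulr_ge0.
rewrite mxE [X in _ + X]mxE phiE// addrAC subrr add0r.
move: (st) => /andP[st1 st2].
apply: (@le_trans _ _ (M * (t - s))); last by rewrite ler_wpM2l// lerBlDl.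
apply: Rintegral_norm_le => //; first exact: (integrable_continuous _ _ (@Gphi _ i phi_cont)).
by move=> v _; rewrite (le_trans (rV_coord_le _ _)).
Qed.

End Iteration.

Definition flow_on (X : E -> E) (s e : R) (phi : R -> E) := continuous phi /\
  forall t, s <= t <= e -> forall i,
    phi t 0 i = phi s 0 i + \int[mu]_(v in `[s, t]) X (phi v) 0 i.

(** Picard iteration for X composed with [clamp (B + 1)]. The bound M^-1 on the time keeps the
    solution within distance 1 of y, where clamping changes nothing; the bound 1 / (2L) gives the
    contraction. *)
Lemma flow_exists (X : E -> E) B : smooth X -> 0 <= B ->
  exists2 tau0 : R, 0 < tau0 & forall tau s y, 0 <= tau <= tau0 -> `|y| <= B ->
    exists2 phi, flow_on X s (s + tau) phi & phi s = y /\
      forall t, s <= t <= s + tau -> `|phi t| <= B + 1.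
Proof.
move=> Xs B0; have B1 : 0 <= B + 1 by rewrite addr_ge0.
have [M M0 HM] := continuous_bounded_ballV (B + 1) (smooth_continuous Xs).
have [L L0 HL] := smooth_lipschitz_ball (B + 1) Xs.
pose G x := X (clamp (B + 1) x).
exists (Num.min M^-1 (L * 2)^-1); first by rewrite lt_min !invr_gt0 M0 mulr_gt0.
move=> tau s y /andP[tau0]; rewrite le_min => /andP[tM tL] yB.
have GM x : `|G x| <= M by apply: HM; exact: clamp_norm.
have GL x z : `|G x - G z| <= L * `|x - z|.
  apply: (le_trans (HL _ _ (clamp_norm x B1) (clamp_norm z B1))).
  by rewrite ler_wpM2l ?(ltW L0)//; exact: clamp_lip.
have Gc : continuous G.
  exact: (lipschitz_continuous GL).
have Lt : L * tau <= 2^-1.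
  by move: tL; rewrite invfM ler_pdivlMl// -?ler_pdivlMl// mulrC ler_pdivlMl.
have [phi [phic phis phiB phiE]] := @picard_exists G L M tau s y Gc GM GL tau0 Lt (ltW L0).
have phi1 t : s <= t <= s + tau -> `|phi t| <= B + 1.
  move=> st; rewrite -(subrK y (phi t)) addrC (le_trans (ler_normD _ _))// lerD//.
  apply: (le_trans (phiB t st)); apply: (@le_trans _ _ (M * M^-1)).
    by rewrite ler_wpM2l// ltW.
  by rewrite divff// gt_eqF.
exists phi; [split=> // t st i|split=> //].
rewrite phiE// phis; congr (_ + _); apply: eq_Rintegral => v.
rewrite inE /= in_itv /= => /andP[sv vt].
rewrite /G clamp_id//; apply: phi1; rewrite sv /=.
by move: st => /andP[_]; exact: le_trans.
Qed.


Section FlowTaylor.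
Variables (X : E -> E) (s e : R) (phi : R -> E).
Hypotheses (Xs : smooth X) (Xphi : flow_on X s e phi).

Lemma flow_is_derive t : s < t < e -> is_derive t (1 : R) phi (X (phi t)).
Proof.
case: Xphi => phic phiE /andP[st te].
have Xc i : continuous (fun v : R => X (phi v) 0 i).
  apply: (@continuous_coord (fun v : R => X (phi v))) => v.
  by apply: (continuous_comp (phic v)); exact: (smooth_continuous Xs).
have coordD i : is_derive t (1 : R) (fun v : R => phi v 0 i) (X (phi t) 0 i).
  have [dF F'] := continuous_FTC1_closed te
    (integrable_continuous s e (Xc i)) st (Xc i t).
  apply: (@near_eq_is_derive _ _ _
    (fun v : R => phi s 0 i + \int[mu]_(w in `[s, v]) X (phi w) 0 i)).
    near=> v.
    have sv : s < v by near: v; exact: lt_nbhsr.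
    have ve : v < e by near: v; exact: lt_nbhsl.
    by apply/esym/phiE; rewrite (ltW sv) (ltW ve).
  rewrite -[X (phi t) 0 i]add0r; apply: is_deriveD.
  by split; [exact: dF|rewrite -derive1E F'].
have dphi : derivable phi t (1 : R).
  by apply/derivable_mxP => i j; rewrite (ord1 i); case: (coordD j).
split=> //; rewrite derive_mx//; apply/rowP => j; rewrite mxE.
exact: (@derive_val _ _ _ _ _ _ _ (coordD j)).
Unshelve. all: by end_near. Qed.

Lemma flow_derive (h : E -> R) t : smooth h -> s < t < e ->
  is_derive t (1 : R) (h \o phi) (lder X h (phi t)).
Proof.
move=> hs ste; have dphi := flow_is_derive ste.
have d1 : differentiable phi t by apply/derivable1_diffP; case: dphi.
have d2 := smooth_differentiable (phi t) hs.
have d3 : differentiable (h \o phi) t by exact: differentiable_comp.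
split; first exact/derivable1_diffP.
apply: (etrans (deriveE _ d3)).
apply: (etrans (congr1 (fun k => k 1) (diff_comp d1 d2))) => /=.
rewrite /lder; congr ('d h (phi t) _).
by rewrite -(deriveE _ d1); exact: (@derive_val _ _ _ _ _ _ _ dphi).
Qed.

(** The Lie series of h along X, truncated to degrees below K. *)
Definition taylor_poly (h : E -> R) (x : E) K : {poly R} :=
  \poly_(k < K) (iter k (lder X) h x / k`!%:R).

Lemma deriv_taylor_poly h x K :
  (taylor_poly h x K.+1)^`() = taylor_poly (lder X h) x K.
Proof.
apply/polyP => k; rewrite coef_deriv !coef_poly ltnS; case: ltnP => _; last by rewrite mul0rn.
rewrite -iterSr.
have aux (a : R) : a / (k.+1)`!%:R *+ k.+1 = a / k`!%:R; last exact: aux.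
by rewrite -mulr_natr -mulrA; congr (_ * _); rewrite factS natrM invfM mulrAC mulVf ?mul1r// pnatr_eq0.
Qed.

Lemma smooth_iter_lder (h : E -> R) k : smooth h -> smooth (iter k (lder X) h).
Proof. by move=> hs; elim: k => [//|k IH]; exact: smooth_lderR. Qed.

(** The derivative of the remainder for h is the remainder for X h of one order less; the mean value
    theorem then replaces an integration, at the harmless cost of the factor 1/K!. *)
Lemma flow_taylor (h : E -> R) K M : smooth h -> 0 <= M ->
  (forall t, s <= t <= e -> `|iter K (lder X) h (phi t)| <= M) ->
  forall t, s <= t <= e ->
    `|h (phi t) - (taylor_poly h (phi s) K).[t - s]| <= M * (t - s) ^+ K.
Proof.
move=> hs M0; elim: K h hs => [|K IH] h hs HM t ste.
  rewrite /taylor_poly poly_def big_ord0 horner0 subr0 mulr1; exact: HM.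
have Lhs := smooth_lderR Xs hs.
have {IH}IH := IH _ Lhs (fun t st => eq_rect _ (fun z => `|z (phi t)| <= M) (HM t st) _ (iterSr K (lder X) h)).
move: ste => /andP[st te].
pose p := (taylor_poly h (phi s) K.+1) \Po ('X - s%:P).
pose F : R -> R := (h \o phi) - horner p.
pose dF (v : R) : R := lder X h (phi v) - (taylor_poly (lder X h) (phi s) K).[v - s].
have FF (v : R) : v \in `]s, t[ -> is_derive v (1 : R) F (dF v).
  rewrite in_itv /= => /andP[sv vt].
  apply: is_deriveB; first by apply: flow_derive => //; rewrite sv (lt_le_trans vt).
  have -> : (taylor_poly (lder X h) (phi s) K).[v - s] = p^`().[v].
    by rewrite /p deriv_comp derivB derivX derivC subr0 mulr1 deriv_taylor_poly horner_comp !hornerE.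
  exact: is_derive_poly.
have Fc : {within `[s, t], continuous F}.
  apply: continuous_subspaceT => v; apply: cvgB; last exact: continuous_horner.
  by apply: (continuous_comp (Xphi.1 v)); exact: (smooth_continuous hs).
have [c] := MVT_segment st FF Fc.
rewrite in_itv /= => /andP[sc ct] FE.
have Fs : F s = 0.
  rewrite -[F s]/(h (phi s) - p.[s]) /p horner_comp !hornerE subrr.
  by rewrite horner_coef0 coef_poly /= invr1 mulr1 subrr.
have -> : h (phi t) - (taylor_poly h (phi s) K.+1).[t - s] = F t.
  by rewrite -[F t]/(h (phi t) - p.[t]) /p horner_comp !hornerE.
rewrite -[F t]subr0 -Fs FE normrM exprSr mulrA (ger0_norm (_ : 0 <= t - s)) ?subr_ge0//.
rewrite ler_wpM2r ?subr_ge0//.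
apply: (le_trans (IH c _)); first by rewrite sc (le_trans ct).
by rewrite ler_wpM2l// lerXn2r ?nnegrE ?subr_ge0// lerB.
Qed.

End FlowTaylor.

End Picard.

(** * Trajectories *)

Section IntegralEq.
Context {R : realType}.
Notation mu := (@lebesgue_measure R).
Implicit Types h : R -> R.

(** Glued controls agree with their pieces only before the switching time; the right endpoint has
    measure zero. *)
Lemma integrable_eq_co h h' a b : (forall t, a <= t < b -> h t = h' t) ->
  mu.-integrable `[a, b] (EFin \o h) -> mu.-integrable `[a, b] (EFin \o h').
Proof.
move=> hh' /integrableP[mh ih].
have hE : {in `[a, b[%classic, (EFin \o h) =1 (EFin \o h')}.
  by move=> t; rewrite inE /= in_itv /= => /hh' ->.
have mh' : measurable_fun `[a, b[ (EFin \o h').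
  apply: (eq_measurable_fun (EFin \o h)); last exact/emeasurable_fun_itv_bndo_bndcP.
  exact: hE.
apply/integrableP; split; first exact/emeasurable_fun_itv_bndo_bndcP.
rewrite -integral_itv_bndo_bndc; last exact: measurableT_comp.
rewrite -integral_itv_bndo_bndc in ih; last first.
  by apply: measurableT_comp => //; exact/emeasurable_fun_itv_bndo_bndcP.
by under eq_integral => t tab do rewrite -hE//.
Qed.

Lemma Rintegral_eq_co h h' a b : (forall t, a <= t < b -> h t = h' t) ->
  mu.-integrable `[a, b] (EFin \o h) ->
  \int[mu]_(t in `[a, b]) h t = \int[mu]_(t in `[a, b]) h' t.
Proof.
move=> hh' ih; have ih' := integrable_eq_co hh' ih.
have co k : mu.-integrable `[a, b] (EFin \o k) -> mu.-integrable `[a, b[ (EFin \o k).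
  apply: integrableS; [exact: measurable_itv|exact: measurable_itv|].
  by apply: subset_itv; rewrite bnd_simp.
rewrite -Rintegral_itv_bndo_bndc ?co// -[RHS]Rintegral_itv_bndo_bndc ?co//.
by apply: eq_Rintegral => t; rewrite inE /= in_itv /= => /hh'.
Qed.

Lemma integrable_cat h a b c : a <= b -> b <= c ->
  mu.-integrable `[a, b] (EFin \o h) -> mu.-integrable `[b, c] (EFin \o h) ->
  mu.-integrable `[a, c] (EFin \o h).
Proof.
move=> ab bc /integrableP[m1 i1] /integrableP[m2 i2].
have U : `[a, c]%classic = `[a, b] `|` `]b, c].
  apply/seteqP; split=> t /=; rewrite !in_itv /=.
    by move=> /andP[at' tc]; case: (leP t b) => tb; [left; rewrite at'|right; rewrite tc].
  move=> [/andP[at' tb]|/andP[bt tc]]; first by rewrite at' (le_trans tb).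
  by rewrite tc andbT (le_trans ab)// ltW.
have /emeasurable_fun_itv_obnd_cbndP m2' := m2.
have mU : measurable_fun (`[a, b] `|` `]b, c]) (EFin \o h) by apply/measurable_funU.
rewrite U; apply/integrableP; split; first exact: mU.
rewrite ge0_integral_setU//=; first last.
- rewrite disj_set2E; apply/eqP/seteqP; split=> t //=.
  by rewrite !in_itv /= => -[/andP[_ tb] /andP[bt _]]; move: tb; rewrite leNgt bt.
- exact: (measurableT_comp (@abse_measurable R setT) mU).
rewrite lte_add_pinfty//.
rewrite integral_itv_obnd_cbnd//.
exact: (measurableT_comp (@abse_measurable R setT) m2').
Qed.

Lemma Rintegral_mono_set h a b c d : a <= c -> c <= d -> d <= b ->
  (forall t, 0 <= h t) -> mu.-integrable `[a, b] (EFin \o h) ->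
  \int[mu]_(t in `[c, d]) h t <= \int[mu]_(t in `[a, b]) h t.
Proof.
move=> ac cd db h0 ih.
rewrite (Rintegral_split ac (le_trans cd db) ih).
rewrite (Rintegral_split cd db (integrable_sub_itv ac (lexx _) ih)).
by rewrite addrCA lerDl addr_ge0// Rintegral_ge0.
Qed.

End IntegralEq.

Section Traj.
Context {R : realType} {n : nat}.
Notation E := 'rV[R]_n.
Notation mu := (@lebesgue_measure R).
Variables (f g : E -> E).

Definition rhs (c : R -> R) (phi : R -> E) (i : 'I_n) (t : R) : R :=
  (f (phi t) + c t *: g (phi t)) 0 i.

Definition traj (c : R -> R) (s e : R) (phi : R -> E) := forall i,
  mu.-integrable `[s, e] (EFin \o rhs c phi i) /\
  forall t, s <= t <= e -> phi t 0 i = phi s 0 i + \int[mu]_(v in `[s, t]) rhs c phi i v.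

Lemma traj_eq c c' phi phi' s e : s <= e ->
  (forall t, s <= t < e -> c t = c' t) -> (forall t, s <= t <= e -> phi t = phi' t) ->
  traj c s e phi -> traj c' s e phi'.
Proof.
move=> se cc' pp' T i; have [ih hE] := T i.
have hh' t : s <= t < e -> rhs c phi i t = rhs c' phi' i t.
  by move=> ste; rewrite /rhs cc'// pp'//; move: ste => /andP[-> /ltW].
split; first exact: integrable_eq_co ih.
move=> t /andP[st te]; rewrite -!pp' ?lexx ?se ?st// hE ?st//; congr (_ + _).
apply: Rintegral_eq_co; last exact: integrable_sub_itv ih.
by move=> v /andP[sv vt]; rewrite hh'// sv (lt_le_trans vt).
Qed.

Lemma traj_sub c phi s e a b : s <= a -> a <= b -> b <= e ->
  traj c s e phi -> traj c a b phi.
Proof.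
move=> sa ab be T i; have [ih hE] := T i.
split; first exact: integrable_sub_itv ih.
move=> t /andP[at' tb]; rewrite hE; last by rewrite (le_trans sa) ?(le_trans tb).
rewrite (hE a) ?sa ?(le_trans ab)// -addrA; congr (_ + _).
apply: Rintegral_split => //; apply: integrable_sub_itv ih => //.
exact: le_trans tb be.
Qed.

Lemma traj_join c phi s m e : s <= m -> m <= e ->
  traj c s m phi -> traj c m e phi -> traj c s e phi.
Proof.
move=> sm me T1 T2 i; have [i1 h1] := T1 i; have [i2 h2] := T2 i.
have ih := integrable_cat sm me i1 i2; split=> // t /andP[st te].
have [tm|/ltW mt] := leP t m; first by rewrite h1 ?st.
rewrite h2 ?mt// h1 ?sm ?lexx// -addrA; congr (_ + _).
by rewrite [RHS](Rintegral_split sm mt)//; exact: integrable_sub_itv ih.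
Qed.

Lemma traj_cat c c1 c2 phi psi s m e : s <= m -> m <= e ->
  (forall t, s <= t < m -> c t = c1 t) -> (forall t, m <= t < e -> c t = c2 t) ->
  traj c1 s m phi -> traj c2 m e psi -> phi m = psi m ->
  traj c s e (fun t => if t <= m then phi t else psi t).
Proof.
move=> sm me cc1 cc2 T1 T2 pm; apply: (traj_join sm me).
  apply: traj_eq T1 => // t /andP[st tm]; [by rewrite cc1// st|by rewrite tm].
apply: traj_eq T2 => // t /andP[mt te]; first by rewrite cc2// mt.
by case: ifP => // tm; have -> : t = m by apply/le_anti; rewrite mt tm.
Qed.

Lemma traj_is_trajectory c (u : R -> 'rV[R]_1) s e phi : s <= e -> (forall t, s <= t < e -> u t 0 0 = c t) ->
  traj c s e phi -> is_trajectory (affine_system f g) u s e phi.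
Proof.
move=> se uc T i.
have /(_ i)[ih hE] : traj (fun t => u t 0 0) s e phi.
  by apply: traj_eq T => // t ste; rewrite uc.
by split; [exact: ih|move=> t; rewrite in_itv /= => /hE].
Qed.

Lemma is_trajectory_traj (u : R -> 'rV[R]_1) s e phi :
  is_trajectory (affine_system f g) u s e phi -> traj (fun t => u t 0 0) s e phi.
Proof.
move=> T i; have [ih hE] := T i; split; first exact: ih.
by move=> t ste; apply: hE; rewrite in_itv.
Qed.

Lemma flow_traj a s e phi : smooth f -> smooth g ->
  flow_on (f + a *: g) s e phi -> traj (fun=> a) s e phi.
Proof.
move=> fs gs [phic phiE] i; split; last by move=> t ste; exact: phiE.
apply: integrable_continuous.
apply: (@continuous_coord _ _ (fun v : R => f (phi v) + a *: g (phi v))) => v.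
have fc : continuous (f + a *: g).
  exact: (smooth_continuous (smoothD fs (smoothZ a gs))).
exact: (continuous_comp (phic v) (fc (phi v))).
Qed.

Lemma traj_bounded c phi s e : traj c s e phi ->
  exists2 B : R, 0 <= B & forall t, s <= t <= e -> `|phi t| <= B.
Proof.
move=> T; pose b i := `|phi s 0 i| + \int[mu]_(v in `[s, e]) `|rhs c phi i v|.
have b0 i : 0 <= b i by rewrite addr_ge0// Rintegral_ge0.
exists (\sum_i b i); first by rewrite sumr_ge0.
move=> t /andP[st te]; apply: rV_norm_leP => [|i]; first by rewrite sumr_ge0.
apply: (@le_trans _ _ (b i)); last by rewrite (bigD1 i)//= lerDl sumr_ge0.
have [ih ->] := T i; last by rewrite st.
rewrite (le_trans (ler_normD _ _))// lerD2l.
have ih' := integrable_sub_itv (lexx s) te ih.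
apply: (le_trans (le_normr_Rintegral _ ih')); first exact: measurable_itv.
by apply: (Rintegral_mono_set (lexx s) st te) => //; exact: (integrable_norm ih).
Qed.

(** Both trajectories lie in one ball, where the right-hand side is Lipschitz with constant L. On an
    interval of length 1 / (2L) that starts with equal values, the supremum of their distance is at
    most half of itself; finitely many such intervals cover [s, t]. *)
Lemma traj_uniq c phi psi s e U : smooth f -> smooth g ->
  (forall t, s <= t <= e -> `|c t| <= U) ->
  traj c s e phi -> traj c s e psi -> phi s = psi s ->
  forall t, s <= t <= e -> phi t = psi t.
Proof.
move=> fs gs cU T1 T2 ps.
have [B1 B10 HB1] := traj_bounded T1; have [B2 B20 HB2] := traj_bounded T2.
pose B := B1 + B2.
have b1 t : s <= t <= e -> `|phi t| <= B by move=> /HB1; move/le_trans; apply; rewrite lerDl.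
have b2 t : s <= t <= e -> `|psi t| <= B by move=> /HB2; move/le_trans; apply; rewrite lerDr.
have [Lf Lf0 HLf] := smooth_lipschitz_ball B fs.
have [Lg Lg0 HLg] := smooth_lipschitz_ball B gs.
pose L := Lf + `|U| * Lg.
have L0 : 0 < L by rewrite ltr_pwDl// mulr_ge0// ltW.
have lipr t i : s <= t <= e -> `|rhs c phi i t - rhs c psi i t| <= L * `|phi t - psi t|.
  move=> ste; rewrite /rhs.
  have -> : (f (phi t) + c t *: g (phi t)) 0 i - (f (psi t) + c t *: g (psi t)) 0 i =
      (f (phi t) - f (psi t) + c t *: (g (phi t) - g (psi t))) 0 i.
    by rewrite !mxE; ring.
  apply: (le_trans (rV_coord_le _ _)); apply: (le_trans (ler_normD _ _)).
  rewrite mulrDl lerD//; first by rewrite HLf// ?b1 ?b2.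
  rewrite normrZ -mulrA ler_pM//; last by rewrite HLg// ?b1 ?b2.
  by rewrite (le_trans (cU _ ste))// ler_norm.
pose d := (2 * L)^-1.
have d0 : 0 < d by rewrite invr_gt0 mulr_gt0.
have step a t : s <= a -> a <= t -> t <= e -> t <= a + d -> phi a = psi a ->
    phi t = psi t.
  move=> sa at' te tad pa.
  pose S := [set `|phi v - psi v| | v in `[a, t]].
  have Sub v : S v -> v <= B + B.
    move=> [w /=]; rewrite in_itv /= => /andP[aw wt] <-.
    have swe : s <= w <= e by rewrite (le_trans sa)// (le_trans wt).
    by rewrite (le_trans (ler_normB _ _))// lerD// ?b1 ?b2.
  have S0 : S !=set0 by exists `|phi a - psi a|, a => //=; rewrite in_itv /= lexx.
  have Ss : has_sup S by split=> //; exists (B + B) => v; exact: Sub.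
  have Sle v : a <= v <= t -> `|phi v - psi v| <= sup S.
    by move=> avt; apply: ub_le_sup; [exists (B + B) => w; exact: Sub|exists v; rewrite //= in_itv].
  have supS0 : 0 <= sup S by apply: le_trans (Sle a _); rewrite ?lexx.
  suff sS : sup S <= sup S / 2.
    have sS0 : sup S <= 0.
      by move: sS; rewrite ler_pdivlMr// mulr_natr mulr2n gerDl.
    have := Sle t; rewrite at' lexx => /(_ isT) /le_trans /(_ sS0).
    by rewrite normr_le0 subr_eq0 => /eqP.
  apply: ge_sup; first exact: S0.
  move=> z [v /=]; rewrite in_itv /= => /andP[av vt] <-.
  apply: rV_norm_leP => [|i]; first by rewrite divr_ge0.
  have T1a := traj_sub sa (le_trans av vt) te T1; have T2a := traj_sub sa (le_trans av vt) te T2.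
  have [i1 h1] := T1a i; have [i2 h2] := T2a i.
  rewrite mxE [X in _ + X]mxE h1 ?av// h2 ?av// pa opprD addrACA subrr add0r.
  have j1 := integrable_sub_itv (lexx a) vt i1; have j2 := integrable_sub_itv (lexx a) vt i2.
  rewrite -RintegralB//.
  apply: (@le_trans _ _ (L * sup S * (v - a))).
    apply: Rintegral_norm_le => //; first exact: (integrableB _ j1 j2).
    move=> w /andP[aw wv].
    apply: (le_trans (lipr w i _)).
      by rewrite (le_trans sa)//= (le_trans wv)// (le_trans vt).
    by rewrite ler_wpM2l ?(ltW L0)// Sle// aw (le_trans wv).
  rewrite mulrAC mulrC ler_wpM2l//.
  apply: (@le_trans _ _ (L * d)); first by rewrite ler_wpM2l ?(ltW L0)// lerBlDl (le_trans vt).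
  by rewrite /d invfM mulrCA divff ?mulr1// gt_eqF.
have main k t : s <= t <= e -> t <= s + k%:R * d -> phi t = psi t.
  elim: k t => [|k IH] t /andP[st te] tk.
    by have -> : t = s; [apply/le_anti; rewrite st andbT; rewrite mul0r addr0 in tk|].
  have [tk'|/ltW tk'] := leP t (s + k%:R * d); first by apply: IH => //; rewrite st.
  apply: (step (s + k%:R * d)) => //.
  - by rewrite lerDl mulr_ge0// ltW.
  - by move: tk; rewrite -natr1 mulrDl mul1r addrA.
  - by apply: IH; rewrite ?lexx// lerDl mulr_ge0 ?(ltW d0)//= (le_trans tk').
move=> t ste; move: (ste) => /andP[st te].
have x0 : 0 <= (t - s) / d by rewrite divr_ge0 ?subr_ge0// ltW.
apply: (main (Num.bound ((t - s) / d))) => //.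
rewrite -lerBlDl -ler_pdivrMr// ltW//.
exact: archi_boundP.
Qed.

End Traj.

(** * The local step *)

Lemma taylor_binom (R : realFieldType) (L U : lmodType R) (act : L -> U -> U)
    (act_linr : forall X, linear (act X)) (X Z : L) M h :
  taylor act X Z M h = \sum_(i < M.+1) iter i (act X) (iter (M - i) (act Z) h) *+ 'C(M, i).
Proof.
elim: M h => [|M IH] h; first by rewrite big_ord1 /= bin0 mulr1n.
have := sum_binS (fun i j => iter i (act X) (iter j (act Z) h)) M => /= ->.
rewrite (IH h) (IH (act Z h)) (actr_sum act_linr) -big_split /=.
apply: eq_bigr => i _; rewrite (actrMn act_linr) mulrnDl; congr (_ + _).
by rewrite -iterSr.
Qed.

Section Poly.
Context {R : realType}.

Lemma poly_low_neg (p : {poly R}) m : (forall i, (i < m)%N -> p`_i = 0) -> p`_m < 0 ->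
  exists2 tau : R, 0 < tau & forall t, 0 < t < tau -> p.[t] < 0.
Proof.
move=> p0 pm.
have pE : p = drop_poly m p * 'X^m.
  rewrite -[LHS](poly_take_drop m) [take_poly m p](_ : _ = 0) ?add0r//.
  by apply/polyP => i; rewrite coef_take_poly coef0; case: ifP => // /p0.
have d0 : (drop_poly m p)`_0 = p`_m by rewrite coef_drop_poly.
have [|tau tau0 Ht] := @poly_sign0 _ (drop_poly m p); first by rewrite d0 lt_eqF.
exists tau => // t /andP[t0 tt].
rewrite pE hornerM hornerXn pmulr_llt0 ?exprn_gt0//.
have := Ht t; rewrite gtr0_norm// => /(_ tt); rewrite d0 => h.
by rewrite ltNge; apply/negP => h'; move: h; rewrite ltNge mulr_ge0_le0// ltW.
Qed.

(** Expansion along X (index l) of each Taylor coefficient along Z (index k). *)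
Definition double_sum (c : nat -> nat -> R) K t : R :=
  \sum_(k < K) (\sum_(l < K) c k l / l`!%:R * t ^+ l) / k`!%:R * t ^+ k.

(** For c k l = X^l Z^k V at x, the coefficient of t^M with M < K is w_M V(x) / M!. So p, the
    difference of the two sides, starts with a negative multiple of t^(N+1), and C t^(N+2) is of
    higher order. *)
Lemma double_sum_lt (c : nat -> nat -> R) N C :
  (forall M, (1 <= M <= N)%N -> \sum_(i < M.+1) c (M - i)%N i *+ 'C(M, i) = 0) ->
  \sum_(i < N.+2) c (N.+1 - i)%N i *+ 'C(N.+1, i) < 0 ->
  exists2 tau : R, 0 < tau & forall t, 0 < t < tau ->
    double_sum c N.+2 t + C * t ^+ N.+2 < c 0%N 0%N.
Proof.
move=> low neg; set K := N.+2.
pose p : {poly R} := \sum_(l < K) \sum_(k < K) (c k l / (l`!%:R * k`!%:R)) *: 'X^(l + k)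
  + C *: 'X^K - (c 0%N 0%N)%:P.
have pt t : p.[t] = double_sum c K t + C * t ^+ K - c 0%N 0%N.
  rewrite /p !hornerE; congr (_ + _ - _); rewrite /double_sum.
  rewrite exchange_big horner_sum; apply: eq_bigr => k _.
  rewrite horner_sum mulr_suml mulr_suml; apply: eq_bigr => l _.
  by rewrite !hornerE exprD invfM; ring.
have pM M : (M < K)%N -> p`_M = (M`!%:R)^-1 * (\sum_(i < M.+1) c (M - i)%N i *+ 'C(M, i))
    - (c 0%N 0%N) *+ (M == 0)%N.
  move=> MK; rewrite coefB coefD coefZ coefXn coefC ltn_eqF// mulr0 addr0 mulrb; congr (_ - _).
  rewrite coef_sum mulr_sumr.
  rewrite (big_ord_widen K (fun i => M`!%:R^-1 * (c (M - i)%N i *+ 'C(M, i))))//.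
  rewrite [RHS]big_mkcond /=; apply: eq_bigr => l _; rewrite coef_sum ltnS.
  case: ifPn => lM.
    have MlK : (M - l < K)%N by apply: leq_ltn_trans MK; rewrite leq_subr.
    rewrite (bigD1 (Ordinal MlK))//= coefZ coefXn subnKC// eqxx mulr1.
    rewrite big1 ?addr0; last first.
      move=> k kl; rewrite coefZ coefXn; case: eqP => [e|]; last by rewrite mulr0.
      by case/eqP: kl; apply: val_inj => /=; rewrite e addKn.
    rewrite -(bin_fact lM) natrM natrM -mulr_natr.
    have h1 : 'C(M, l)%:R != 0 :> R by rewrite pnatr_eq0 -lt0n bin_gt0.
    have h2 : l`!%:R != 0 :> R by rewrite pnatr_eq0 -lt0n fact_gt0.
    have h3 : (M - l)`!%:R != 0 :> R by rewrite pnatr_eq0 -lt0n fact_gt0.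
    by field; rewrite h1 h2 h3.
  rewrite big1// => k _; rewrite coefZ coefXn; case: eqP => [e|]; last by rewrite mulr0.
  by rewrite e leq_addr in lM.
have [||tau tau0 Ht] := @poly_low_neg p N.+1.
- move=> i iN; rewrite pM ?ltnS ?(ltnW iN)//; case: i iN => [|i] iN.
    by rewrite big_ord1 /= bin0 fact0 invr1 mul1r !mulr1n subrr.
  by rewrite low ?mulr0 ?subr0// -ltnS.
- by rewrite pM// subr0 pmulr_rlt0// invr_gt0 ltr0n fact_gt0.
exists tau => // t /Ht; rewrite pt; lra.
Qed.

Lemma taylor_sum_close (a b : nat -> R) K M t : 0 <= t <= 1 ->
  (forall k, (k < K)%N -> `|a k - b k| <= M) ->
  `|\sum_(k < K) a k / k`!%:R * t ^+ k - \sum_(k < K) b k / k`!%:R * t ^+ k| <= M *+ K.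
Proof.
move=> /andP[t0 t1] ab; rewrite -sumrB; apply: (le_trans (ler_norm_sum _ _ _)).
rewrite -[X in _ *+ X](card_ord K) -sumr_const; apply: ler_sum => k _.
rewrite -mulrBl -mulrBl !normrM -mulrA; apply: (le_trans _ (ab _ (ltn_ord k))).
rewrite ler_piMr//; apply: mulr_ile1 => //.
  rewrite normfV normr_nat invf_le1 ?ler1n ?fact_gt0// ltr0n fact_gt0//.
by rewrite ger0_norm ?exprn_ge0// exprn_ile1.
Qed.

End Poly.

Section LocalStep.
Context {R : realType} {n : nat}.
Notation E := 'rV[R]_n.

Lemma iter_lder_scale (Y : E -> E) (h : E -> R) rho k : smooth Y -> smooth h ->
  iter k (lder (rho *: Y)) h = rho ^+ k *: iter k (lder Y) h.
Proof.
move=> Ys hs.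
have step (a : R) (h' : E -> R) : smooth h' ->
    lder (rho *: Y) (a *: h') = (rho * a) *: lder Y h'.
  move=> hs'; apply/funext => x.
  have e1 := lder_scale rho Y (a *: h') x.
  have e2 : lder Y (a *: h') x = a * lder Y h' x.
    have e3 := diffZE a (Y x) (smooth_differentiable x hs').
    exact e3.
  exact (etrans e1 (etrans (f_equal (fun z => rho * z) e2) (mulrA rho a (lder Y h' x)))).
elim: k => [|k IH]; first exact: (esym (scale1r h)).
have e1 := f_equal (fun h' : E -> R => lder (rho *: Y) h') IH.
have e2 := step (rho ^+ k) _ (smooth_iter_lder Ys k hs).
exact (etrans e1 (etrans e2 (f_equal (fun c : R => c *: lder Y (iter k (lder Y) h)) (esym (exprS rho k))))).
Qed.

Lemma iter_sact (X : sm R n E) (h : sm R n R) k :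
  iter k (sact X) h = iter k (lder X) h :> (E -> R).
Proof.
elim: k => [|k IH]; first by [].
exact (f_equal (fun h' : E -> R => lder X h') IH).
Qed.

Lemma lie_taylor_binom (X Z : E -> E) (h : E -> R) M x :
  smooth X -> smooth Z -> smooth h ->
  lie_taylor X Z M h x =
  \sum_(i < M.+1) iter i (lder X) (iter (M - i) (lder Z) h) x *+ 'C(M, i).
Proof.
move=> Xs Zs hs; set X' := mk_sm Xs; set Z' := mk_sm Zs; set h' := mk_sm hs.
have e1 := f_equal (fun k : E -> R => k x) (lie_taylorE X' Z' M h').
have e2 := f_equal (fun k : sm R n R => k x) (taylor_binom sact_linr X' Z' M h').
apply: (etrans (esym e1)); apply: (etrans e2); apply: (etrans (sm_sum _ _ _ _)).
apply: eq_bigr => i _.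
have e3 : iter i (sact X') (iter (M - i) (sact Z') h') =
    iter i (lder X) (iter (M - i) (lder Z) h) :> (E -> R).
  exact (etrans (iter_sact X' _ i) (f_equal (fun k : E -> R => iter i (lder X) k) (iter_sact Z' h' (M - i)))).
have e4 (k : nat) (a : sm R n R) : (a *+ k) x = a x *+ k.
  by elim: k => [|k IH]; rewrite ?mulr0n// !mulrS -IH.
exact (etrans (e4 _ _) (f_equal (fun a : E -> R => a x *+ 'C(M, i)) e3)).
Qed.

Lemma smooth_iter2_bounded (X Z : E -> E) (h : E -> R) K B :
  smooth X -> smooth Z -> smooth h ->
  exists2 C : R, 0 < C & forall k l x, (k <= K)%N -> (l <= K)%N -> `|x| <= B ->
    `|iter l (lder X) (iter k (lder Z) h) x| <= C.
Proof.
move=> Xs Zs hs.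
have [C HC] : {C : nat -> nat -> R | forall k l, 0 < C k l /\ forall x, `|x| <= B ->
    `|iter l (lder X) (iter k (lder Z) h) x| <= C k l}.
  have ch k l : {C : R | 0 < C /\ forall x, `|x| <= B ->
      `|iter l (lder X) (iter k (lder Z) h) x| <= C}.
    apply: cid.
    have [C C0 HC] := continuous_bounded_ball B (smooth_continuous
      (smooth_iter_lder Xs l (smooth_iter_lder Zs k hs))).
    by exists C.
  by exists (fun k l => sval (ch k l)) => k l; exact: (svalP (ch k l)).
exists (\sum_(k < K.+1) \sum_(l < K.+1) C k l).
  apply: (@lt_le_trans _ _ (C 0%N 0%N)); first by have [] := HC 0%N 0%N.
  rewrite (bigD1 ord0)//= (bigD1 (ord0 : 'I_K.+1))//= -addrA lerDl addr_ge0//.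
    by apply: sumr_ge0 => l _; rewrite ltW//; have [] := HC 0%N l.
  by apply: sumr_ge0 => k _; apply: sumr_ge0 => l _; rewrite ltW//; have [] := HC k l.
move=> k l x kK lK xB; have [_ Hkl] := HC k l.
apply: (le_trans (Hkl x xB)).
have kK' : (k < K.+1)%N by []; have lK' : (l < K.+1)%N by [].
rewrite (bigD1 (Ordinal kK'))//= (bigD1 (Ordinal lK'))//= -addrA lerDl addr_ge0//.
  by apply: sumr_ge0 => l' _; rewrite ltW//; have [] := HC k l'.
by apply: sumr_ge0 => k' _; apply: sumr_ge0 => l' _; rewrite ltW//; have [] := HC k' l'.
Qed.

Lemma taylor_polyE (X : E -> E) (h : E -> R) x K t :
  (taylor_poly X h x K).[t] = \sum_(k < K) iter k (lder X) h x / k`!%:R * t ^+ k.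
Proof. exact: horner_poly. Qed.

Lemma flow_increment (X : E -> E) (h : E -> R) s e phi M : smooth X -> smooth h ->
  flow_on X s e phi -> 0 <= M -> (forall t, s <= t <= e -> `|lder X h (phi t)| <= M) ->
  forall t, s <= t <= e -> `|h (phi t) - h (phi s)| <= M * (t - s).
Proof.
move=> Xs hs F M0 HM t ste.
have := @flow_taylor _ _ X s e phi Xs F h 1 M hs M0 HM t ste.
have -> : (taylor_poly X h (phi s) 1).[t - s] = h (phi s).
  by rewrite taylor_polyE big_ord1 /= divr1 mulr1.
by rewrite expr1.
Qed.

Definition jet (X Y : E -> E) (h : E -> R) x k l := iter l (lder X) (iter k (lder Y) h) x.

(** Following Y for time rho t amounts to following rho Y for time t. The function h is expanded
    along Y about the switching point, then each coefficient along X about y; both remainders are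
    O(t^K), uniformly for |y| <= B. *)
Lemma two_flows (X Y : E -> E) (h : E -> R) rho K B : smooth X -> smooth Y -> smooth h ->
  0 <= rho -> 0 <= B ->
  exists tau C : R, [/\ 0 < tau, 0 <= C & forall t s y, 0 <= t <= tau -> `|y| <= B ->
    exists phi psi, [/\ flow_on X s (s + t) phi /\ phi s = y,
      flow_on Y (s + t) (s + t + rho * t) psi /\ psi (s + t) = phi (s + t),
      `|h (psi (s + t + rho * t)) - double_sum (jet X (rho *: Y) h y) K t| <= C * t ^+ K,
      forall v, s <= v <= s + t -> `|h (phi v) - h y| <= C * t &
      forall v, s + t <= v <= s + t + rho * t -> `|h (psi v) - h y| <= C * t]].
Proof.
move=> Xs Ys hs r0 B0.
have [t1 t10 F1] := flow_exists Xs B0.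
have [t2 t20 F2] := flow_exists Ys (addr_ge0 B0 ler01).
have rYs := smoothZ rho Ys.
have [C1 C10 H1] := smooth_iter2_bounded K.+1 (B + 1 + 1) Xs rYs hs.
have [C2 C20 H2] := smooth_iter2_bounded K.+1 (B + 1 + 1) Ys Ys hs.
(* The bound 1 is required by [taylor_sum_close]; the other two are existence times for legs of
   duration t and rho t. *)
pose tau := Num.min 1 (Num.min t1 (t2 / (rho + 1))).
(* The first two summands bound the Taylor remainders [e1] and [e2], the last two the variation of h
   on the two legs. *)
pose C := C2 * rho ^+ K + C1 *+ K + (C1 + C2 * rho).
have r1 : 0 < rho + 1 by rewrite ltr_wpDl.
have C1n := ltW C10; have C2n := ltW C20.
have CC2 : 0 <= C2 * rho by rewrite mulr_ge0.
have CC1 : 0 <= C1 *+ K by rewrite mulrn_wge0.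
have CC3 : 0 <= C2 * rho ^+ K by rewrite mulr_ge0 ?exprn_ge0.
exists tau, C; split.
- by rewrite !lt_min ltr01 t10 divr_gt0.
- by rewrite !addr_ge0.
move=> t s y; rewrite !le_min => /and4P[t0 tle1 tt1 tt2] yB.
have B1 : B + 1 <= B + 1 + 1 by rewrite lerDl.
have rt0 : 0 <= rho * t by rewrite mulr_ge0.
have rtt2 : rho * t <= t2.
  move: tt2; rewrite ler_pdivlMr// => /(le_trans _); apply.
  by rewrite mulrC ler_wpM2l// lerDl.
have [|phi fphi [phis phiB]] := F1 t s y _ yB; first by rewrite t0.
have zB : `|phi (s + t)| <= B + 1 by apply: phiB; rewrite lerDl t0 lexx.
have [|psi fpsi [psis psiB]] := F2 (rho * t) (s + t) (phi (s + t)) _ zB; first by rewrite rt0.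
exists phi, psi.
have incr1 v : s <= v <= s + t -> `|h (phi v) - h y| <= C1 * t.
  move=> /andP[sv ve]; rewrite -{1}phis.
  apply: (@le_trans _ _ (C1 * (v - s))).
    apply: (flow_increment Xs hs fphi (ltW C10)); last by rewrite sv.
    move=> w sw; apply: (H1 0%N 1%N (phi w)) => //.
    exact: le_trans (phiB w sw) B1.
  by rewrite ler_wpM2l ?(ltW C10)// lerBlDl.
have incr2 v : s + t <= v <= s + t + rho * t ->
    `|h (psi v) - h (phi (s + t))| <= C2 * rho * t.
  move=> /andP[sv ve]; rewrite -psis.
  apply: (@le_trans _ _ (C2 * (v - (s + t)))).
    apply: (flow_increment Ys hs fpsi (ltW C20)); last by rewrite sv.
    move=> w sw; apply: (H2 0%N 1%N (psi w)) => //; exact: psiB.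
  by rewrite -mulrA ler_wpM2l ?(ltW C20)// lerBlDl.
split=> //.
- have e1 : `|h (psi (s + t + rho * t)) -
      \sum_(k < K) iter k (lder (rho *: Y)) h (phi (s + t)) / k`!%:R * t ^+ k|
      <= C2 * rho ^+ K * t ^+ K.
    have := @flow_taylor _ _ Y (s + t) (s + t + rho * t) psi Ys fpsi h K C2 hs (ltW C20).
    move=> /(_ (fun w sw => H2 0%N K (psi w) isT (leqnSn K) (psiB w sw))).
    move=> /(_ (s + t + rho * t)); rewrite lerDl rt0 lexx => /(_ isT).
    rewrite [X in _ * X ^+ _](_ : _ = rho * t); last by rewrite addrC addKr.
    rewrite exprMn mulrA psis; apply: le_trans.
    rewrite le_eqVlt; apply/orP; left; apply/eqP; congr (`|_ - _|).
    rewrite [s + t + rho * t - _](_ : _ = rho * t); last by rewrite addrC addKr.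
    apply: (etrans _ (esym (taylor_polyE _ _ _ _ _))).
    apply: eq_bigr => k _.
    have e := f_equal (fun u : E -> R => u (phi (s + t))) (iter_lder_scale rho k Ys hs).
    apply: (etrans (f_equal (fun z => z / k`!%:R * t ^+ k) e)).
    have ring1 (a b c d : R) : a * b / c * d = b / c * (a * d) by ring.
    apply: (etrans (ring1 (rho ^+ k) (iter k (lder Y) h (phi (s + t))) k`!%:R (t ^+ k))).
    exact (f_equal (fun z => iter k (lder Y) h (phi (s + t)) / k`!%:R * z) (esym (exprMn k rho t))).
  have e2 : `|\sum_(k < K) iter k (lder (rho *: Y)) h (phi (s + t)) / k`!%:R * t ^+ k -
      double_sum (jet X (rho *: Y) h y) K t| <= C1 *+ K * t ^+ K.
    rewrite mulrnAl.
    apply: (@taylor_sum_close _ (fun k => iter k (lder (rho *: Y)) h (phi (s + t)))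
      (fun k => \sum_(l < K) jet X (rho *: Y) h y k l / l`!%:R * t ^+ l)).
      by rewrite t0.
    move=> k kK.
    have := @flow_taylor _ _ X s (s + t) phi Xs fphi (iter k (lder (rho *: Y)) h) K C1
      (smooth_iter_lder rYs k hs) (ltW C10).
    move=> /(_ (fun w sw => H1 k K (phi w) (leqW (ltnW kK)) (leqnSn K) (le_trans (phiB w sw) B1))).
    move=> /(_ (s + t)); rewrite lerDl t0 lexx => /(_ isT).
    rewrite [X in _ * X ^+ _](_ : _ = t); last by rewrite addrC addKr.
    apply: le_trans.
    rewrite le_eqVlt; apply/orP; left; apply/eqP; congr (`|_ - _|).
    rewrite [s + t - _](_ : _ = t); last by rewrite addrC addKr.
    rewrite phis; exact (esym (taylor_polyE _ _ _ _ _)).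
  rewrite -[X in `|X|](subrKA (\sum_(k < K) iter k (lder (rho *: Y)) h (phi (s + t)) / k`!%:R * t ^+ k)).
  apply: (le_trans (ler_normD _ _)); apply: (le_trans (lerD e1 e2)).
  by rewrite -mulrDl ler_wpM2r ?exprn_ge0// lerDl addr_ge0.
- move=> v /incr1 /le_trans; apply; rewrite ler_wpM2r//.
  by rewrite /C addrA addrAC lerDr !addr_ge0.
- move=> v /incr2 i2.
  have i1 : `|h (phi (s + t)) - h y| <= C1 * t by apply: incr1; rewrite lerDl t0 lexx.
  rewrite -[X in `|X|](subrKA (h (phi (s + t)))).
  apply: (le_trans (ler_normD _ _)); apply: (le_trans (lerD i2 i1)).
  by rewrite -mulrDl ler_wpM2r// addrC lerDr addr_ge0.
Qed.

Lemma double_sum_continuous (c : E -> nat -> nat -> R) K t :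
  (forall k l, continuous (fun y => c y k l)) -> continuous (fun y => double_sum (c y) K t).
Proof.
move=> cc y.
have step (a : nat -> E -> R) : (forall k, {for y, continuous (a k)}) ->
    {for y, continuous (fun y => \sum_(k < K) a k y / k`!%:R * t ^+ k)}.
  move=> ac; elim: K => [|K' IH].
    have e : (fun z => \sum_(k < 0) a k z / k`!%:R * t ^+ k) = fun=> 0.
      by apply/funext => z; rewrite big_ord0.
    have c0 : {for y, continuous (0 : E -> R)} by exact: (smooth_continuous (smooth0 R)).
    exact: (eq_ind_r (fun F : E -> R => {for y, continuous F}) c0 e).
  have e : (fun z => \sum_(k < K'.+1) a k z / k`!%:R * t ^+ k) =
    (fun z => \sum_(k < K') a k z / k`!%:R * t ^+ k) \+ (fun z => a K' z / K'`!%:R * t ^+ K').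
    by apply/funext => z; rewrite big_ord_recr.
  have cg : {for y, continuous (fun z => a K' z / K'`!%:R * t ^+ K')}.
    have c1 := @continuous_comp _ _ _ (a K') (fun r : R => r / K'`!%:R * t ^+ K') y (ac K').
    by apply: c1 => //; apply: cvgMr_tmp; apply: cvgMr_tmp; exact: cvg_id.
  have cS := continuousD IH cg.
  exact: (eq_ind_r (fun F : E -> R => {for y, continuous F}) cS e).
apply: (step (fun k y => \sum_(l < K) c y k l / l`!%:R * t ^+ l)) => k.
by apply: (step (fun l y => c y k l)) => l; exact: cc.
Qed.

Lemma local_step (f g : E -> E) (V : E -> R) x sigma : smooth f -> smooth g -> smooth V ->
  descent f g V x -> 0 < sigma ->
  exists u w tau1 tau2 delta r : R,
    [/\ 0 < tau1, 0 <= tau2, tau1 + tau2 <= sigma, 0 < delta & 0 < r] /\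
    forall y s, `|y - x| <= r -> exists phi,
      [/\ traj f g (fun t => if t < s + tau1 then u else w) s (s + tau1 + tau2) phi,
          phi s = y, V (phi (s + tau1 + tau2)) <= V y - delta &
          forall v, s <= v <= s + tau1 + tau2 -> V (phi v) <= V y + sigma].
Proof.
move=> fs gs Vs [u [w [rho [N [rho0 low neg]]]]] sigma0.
set X := f + u *: g in low neg; set Y := f + w *: g in low neg.
have Xs : smooth X := smoothD fs (smoothZ u gs).
have Ys : smooth Y := smoothD fs (smoothZ w gs).
have Zs := smoothZ rho Ys.
have [t1 [C [t10 C0 HF]]] := two_flows N.+2 Xs Ys Vs rho0 (addr_ge0 (normr_ge0 x) ler01).
have [||t2 t20 Ht2] := @double_sum_lt R (jet X (rho *: Y) V x) N C.
- move=> M MN; apply: (etrans _ (low M MN)).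
  exact (esym (lie_taylor_binom M x Xs Zs Vs)).
- have e := lie_taylor_binom N.+1 x Xs Zs Vs.
  exact: (eq_ind _ (fun z => is_true (z < 0)) neg _ e).
have cc k l : continuous (fun y => jet X (rho *: Y) V y k l).
  exact (smooth_continuous (smooth_iter_lder Xs l (smooth_iter_lder Zs k Vs))).
have cV : jet X (rho *: Y) V x 0%N 0%N = V x by [].
move: (jet X (rho *: Y) V) cc cV Ht2 HF {low neg} => c cc cV Ht2 HF.
have r1 : 0 < rho + 1 by rewrite ltr_wpDl.
have C1 : 0 < C + 1 by rewrite ltr_wpDl.
(* t2 / 2 gives the strict inequality t < t2; sigma / (C + 1) bounds the rise of V, and sigma / (rho
   + 1) the duration t + rho t. *)
pose t := Num.min (Num.min t1 (t2 / 2)) (Num.min (sigma / (C + 1)) (sigma / (rho + 1))).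
have t0 : 0 < t by rewrite !lt_min t10 !divr_gt0.
have tt1 : t <= t1 by rewrite !ge_min lexx.
have tt2 : t < t2.
  apply: (@le_lt_trans _ _ (t2 / 2)); first by rewrite !ge_min lexx orbT.
  by rewrite ltr_pdivrMr// ltr_pMr// ltr1n.
have Ct : C * t <= sigma.
  apply: (@le_trans _ _ ((C + 1) * t)); first by rewrite ler_wpM2r ?(ltW t0)// lerDl.
  by rewrite mulrC -ler_pdivlMr// !ge_min lexx !orbT.
have rt : t + rho * t <= sigma.
  by rewrite -[X in X + _]mul1r -mulrDl addrC mulrC -ler_pdivlMr// !ge_min lexx !orbT.
have := Ht2 t; rewrite t0 tt2 cV => /(_ isT).
pose S y := double_sum (c y) N.+2 t; rewrite -[double_sum _ _ _]/(S x) => Sx.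
(* A third of the gain at x: moving from x to y costs at most eta in S and eta in V, which leaves a
   decrease of eta. *)
pose eta := (V x - (S x + C * t ^+ N.+2)) / 3.
have eta0 : 0 < eta by rewrite divr_gt0// subr_gt0.
have Sc : {for x, continuous S} by exact: double_sum_continuous.
have Vc : {for x, continuous V} by exact: (smooth_continuous Vs).
have [r [r0 rle1 Hr]] : exists r : R, [/\ 0 < r, r <= 1 &
    forall y, `|y - x| <= r -> `|S x - S y| <= eta /\ `|V x - V y| <= eta].
  have /cvgrPdist_le /(_ _ eta0) nS := Sc; have /cvgrPdist_le /(_ _ eta0) nV := Vc.
  have : \forall y \near x, `|S x - S y| <= eta /\ `|V x - V y| <= eta.
    by near=> y; split; near: y.
  move=> /nbhs_normP[e /= e0 He]; exists (Num.min 1 (e / 2)).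
  split; [by rewrite lt_min ltr01 divr_gt0|by rewrite ge_min lexx|].
  move=> y; rewrite le_min => /andP[_ ye]; apply: He => /=.
  rewrite distrC (le_lt_trans ye)// ltr_pdivrMr// ltr_pMr// ltr1n//.
exists u, w, t, (rho * t), eta, r; split; first by split=> //; rewrite mulr_ge0// ltW.
move=> y s yr.
have yB : `|y| <= `|x| + 1.
  by rewrite -[y](subrK x) (le_trans (ler_normD _ _))// addrC lerD2l (le_trans yr).
have [|phi [psi [[fphi phis] [fpsi psis] vend v1 v2]]] := HF t s y _ yB.
  by rewrite (ltW t0).
have rt0 : 0 <= rho * t by rewrite mulr_ge0// ltW.
have [yS yV] := Hr y yr.
exists (fun v => if v <= s + t then phi v else psi v); split.
- apply: (traj_cat (phi := phi) (psi := psi) _ _ _ _ (flow_traj fs gs fphi) (flow_traj fs gs fpsi)).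
  + by rewrite lerDl ltW.
  + by rewrite lerDl.
  + by move=> v /andP[_ ->].
  + by move=> v /andP[vt _]; rewrite ltNge vt.
  + by rewrite psis.
- by rewrite lerDl ltW.
- have -> : (if s + t + rho * t <= s + t then phi (s + t + rho * t) else psi (s + t + rho * t)) =
      psi (s + t + rho * t).
    (* The first branch arises only for rho t = 0, when the second leg is a point. *)
    by case: ifP => //; rewrite gerDl => h; have -> : rho * t = 0 by [apply/le_anti; rewrite h]; rewrite addr0 psis.
  move: vend yS yV; rewrite -[double_sum _ _ _]/(S y).
  have : eta * 3 = V x - (S x + C * t ^+ N.+2) by rewrite /eta divfK// pnatr_eq0.
  rewrite !ler_norml; clear; move: (V (psi _)) (S x) (S y) (V x) (V y) eta (C * _) => a b d e h k l.
  lra.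
- move=> v /andP[sv ve]; case: ifPn => vt.
    have := v1 v; rewrite sv vt => /(_ isT) /ler_normlP[_]; rewrite lerBlDl => /le_trans; apply.
    by rewrite lerD2l.
  have := v2 v; rewrite ve ltW ?ltNge// => /(_ isT) /ler_normlP[_]; rewrite lerBlDl => /le_trans; apply.
  by rewrite lerD2l.
Unshelve. all: by end_near.
Qed.

End LocalStep.

(** * Uniform steps and plans *)

Lemma partition_le (R : realType) (T : nat -> R) i j :
  (forall i, T i < T i.+1) -> (i <= j)%N -> T i <= T j.
Proof.
move=> Ti /subnKC <-; elim: (j - i)%N => [|k IH]; first by rewrite addn0.
by rewrite addnS (le_trans IH)// ltW.
Qed.

Lemma nbhs_norm_le (R : realType) (n : nat) (x : 'rV[R]_n) (r : R) : 0 < r -> nbhs x [set y | `|y - x| <= r].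
Proof.
move=> r0; apply: (@filterS _ (nbhs x) _ (ball x r)); last exact: nbhsx_ballx.
by move=> y; rewrite -ball_normE /= distrC => /ltW.
Qed.

Section Steer.
Context {R : realType} {n : nat}.
Notation E := 'rV[R]_n.
Variables (f g : E -> E) (V : E -> R).

Definition steer (U s e : R) (c : R -> R) (phi : R -> E) :=
  [/\ measurable_fun setT c, forall t, `|c t| <= U & traj f g c s e phi].

Lemma measurable_if_lt (m : R) (c1 c2 : R -> R) :
  measurable_fun setT c1 -> measurable_fun setT c2 ->
  measurable_fun setT (fun t : R => if t < m then c1 t else c2 t).
Proof.
move=> h1 h2; apply: (measurable_fun_ifT _ h1 h2).
by apply: measurable_fun_ltr => //; exact: measurable_id.
Qed.

Lemma steer_cat U s m e c1 c2 phi psi : s <= m -> m <= e ->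
  steer U s m c1 phi -> steer U m e c2 psi -> phi m = psi m ->
  steer U s e (fun t => if t < m then c1 t else c2 t) (fun t => if t <= m then phi t else psi t).
Proof.
move=> sm me [m1 b1 t1] [m2 b2 t2] pm; split.
- exact: measurable_if_lt.
- by move=> t; case: ifP.
- apply: (traj_cat sm me _ _ t1 t2 pm) => t /andP[h1 h2]; first by rewrite h2.
  by rewrite ltNge h1.
Qed.

Lemma steer_sub U s e a b c phi : s <= a -> a <= b -> b <= e ->
  steer U s e c phi -> steer U a b c phi.
Proof. by move=> sa ab be [mc cU T]; split=> //; exact: traj_sub T. Qed.

Hypotheses (fs : smooth f) (gs : smooth g) (Vs : smooth V).
Hypotheses (V0 : positive_definite V) (Vp : proper_map V).
Hypothesis dV : forall x, x != 0 -> descent f g V x.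

Lemma V_ge0 x : 0 <= V x.
Proof.
have [->|x0] := eqVneq x 0; first by rewrite (V0.1 : V 0 = 0).
by rewrite ltW//; exact: V0.2.
Qed.

Lemma sublevel_bounded b : exists2 B : R, 0 <= B & forall x, V x <= b -> `|x| <= B.
Proof.
have cI : compact `[0, b]%classic by exact: segment_compact.
have /compact_bounded[M [_ HM]] := Vp cI.
exists (`|M| + 1); first by rewrite addr_ge0.
move=> x xb; apply: (HM (`|M| + 1)) => /=; first by rewrite ltr_pwDr// ler_norm.
by rewrite in_itv /= V_ge0.
Qed.

(** A single integer k bounds the control, the duration and the decrease, because the near-covering
    form of compactness produces one eventual parameter. The least duration prevents step times from
    accumulating. *)
Lemma descent_uniform c b sigma : 0 < c -> 0 < sigma ->
  exists k : nat, forall y s, c <= V y <= b -> exists e ctl phi,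
    [/\ s + k.+1%:R^-1 <= e <= s + sigma, steer k%:R s e ctl phi, phi s = y,
        V (phi e) <= V y - k.+1%:R^-1 & forall v, s <= v <= e -> V (phi v) <= V y + sigma].
Proof.
move=> c0 sigma0.
pose P (k : nat) (y : E) := forall s, exists e ctl phi,
    [/\ s + k.+1%:R^-1 <= e <= s + sigma, steer k%:R s e ctl phi, phi s = y,
        V (phi e) <= V y - k.+1%:R^-1 & forall v, s <= v <= e -> V (phi v) <= V y + sigma].
have cI : compact `[c, b]%classic by exact: segment_compact.
have /compact_near_coveringP /(_ nat \oo P _) := Vp cI.
case=> [x /=|k _ Hk].
  rewrite in_itv /= => /andP[cx _].
  have x0 : x != 0.
    by apply/eqP => xE; move: cx; rewrite xE (V0.1 : V 0 = 0) leNgt c0.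
  have [u [w [t1 [t2 [d [r [[t10 t20 tsig d0 r0] H]]]]]]] := local_step fs gs Vs (dV x0) sigma0.
  pose M := `|u| + `|w| + t1^-1 + d^-1.
  exists ([set y | `|y - x| <= r], [set k | (Num.bound `|M| <= k)%N]).
    split => /=; last by exists (Num.bound `|M|).
    exact: nbhs_norm_le.
  move=> [y k] /= [yr Mk] s.
  have Mk' : M <= k%:R.
    apply: (@le_trans _ _ (Num.bound `|M|)%:R); last by rewrite ler_nat.
    by rewrite (le_trans (ler_norm _))// ltW// archi_boundP.
  have td : 0 <= t1^-1 /\ 0 <= d^-1 by rewrite !invr_ge0 !ltW.
  have kinv (z : R) : 0 < z -> z^-1 <= k%:R -> k.+1%:R^-1 <= z.
    move=> z0 zk; rewrite -[leRHS]invrK lef_pV2 ?posrE ?invr_gt0//.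
    by rewrite (le_trans zk)// ler_nat.
  have Mu : `|u| <= M /\ `|w| <= M /\ t1^-1 <= M /\ d^-1 <= M.
    have := normr_ge0 u; have := normr_ge0 w; case: td; rewrite /M.
    by move: (`|u|) (`|w|) (t1^-1) (d^-1) => ????; lra.
  case: Mu => [Mu [Mw [Mt Md]]].
  have [phi [T ps pe pa]] := H y s yr.
  exists (s + t1 + t2), (fun t => if t < s + t1 then u else w), phi; split=> //.
  - rewrite -!addrA !lerD2l tsig andbT.
    apply: (@le_trans _ _ t1); last by rewrite lerDl.
    by apply: kinv => //; exact: le_trans Mk'.
  - split=> //; first by apply: measurable_if_lt => //; exact: measurable_cst.
    by move=> t; case: ifP => _; [exact: le_trans Mk'|exact: le_trans Mk'].
  - by rewrite (le_trans pe)// lerD2l lerN2 kinv//; exact: le_trans Mk'.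
by exists k => y s ycb; apply: (Hk k) => /=.
Qed.

(** The derivative of V along f is bounded near the bounded set {V <= c}, so with zero control V
    rises by at most eta over a uniform time. *)
Lemma coast c eta : 0 < eta -> exists2 tau : R, 0 < tau & forall y s, V y <= c ->
  exists2 phi, steer 0 s (s + tau) (fun=> 0) phi & phi s = y /\
    forall v, s <= v <= s + tau -> V (phi v) <= V y + eta.
Proof.
move=> eta0; pose X := f + 0 *: g; have Xs : smooth X := smoothD fs (smoothZ 0 gs).
have [B B0 HB] := sublevel_bounded c.
have [t1 t10 F] := flow_exists Xs B0.
have [M M0 HM] := continuous_bounded_ball (B + 1) (smooth_continuous (smooth_lderR Xs Vs)).
pose tau := Num.min t1 (eta / M).
have tau0 : 0 < tau by rewrite lt_min t10 divr_gt0.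
exists tau => // y s yc.
have [|phi fphi [ps pB]] := F tau s y _ (HB y yc).
  by rewrite (ltW tau0)/= ge_min lexx.
exists phi.
  split; [exact: measurable_cst|by move=> t; rewrite normr0|exact: flow_traj].
split=> // v sv; have /andP[sv1 sv2] := sv.
have := flow_increment Xs Vs fphi (ltW M0) (fun t st => HM (phi t) (pB t st)) sv.
move=> /ler_normlP[_]; rewrite lerBlDl ps => /le_trans; apply; rewrite lerD2l.
have : v - s <= eta / M by rewrite lerBlDl (le_trans sv2)// lerD2l ge_min lexx orbT.
by rewrite ler_pdivlMr// mulrC.
Qed.

Lemma step_uniform c b eta : 0 < c -> 0 < eta ->
  exists tau delta U : R, [/\ 0 < tau, 0 < delta & forall y s, V y <= b ->
    exists e ctl phi, [/\ s + tau <= e, steer U s e ctl phi, phi s = y,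
      V (phi e) <= Num.max (V y - delta) (c + eta) &
      forall v, s <= v <= e -> V (phi v) <= Num.max (V y) c + eta]].
Proof.
move=> c0 eta0; have [k Hk] := descent_uniform b c0 eta0.
have [t1 t10 Ht] := coast c eta0.
have k0 : 0 < k.+1%:R^-1 :> R by rewrite invr_gt0 ltr0n.
exists (Num.min t1 k.+1%:R^-1), k.+1%:R^-1, k%:R; split=> //; first by rewrite lt_min t10.
move=> y s yb; have [yc|/ltW cy] := leP (V y) c.
  have [phi [mc cU T] [ps pa]] := Ht y s yc.
  exists (s + t1), (fun=> 0), phi; split=> //.
  - by rewrite lerD2l ge_min lexx.
  - by split=> // t; rewrite normr0 ler0n.
  - rewrite le_max; apply/orP; right; rewrite (le_trans (pa _ _)) ?lerD2r//.
    by rewrite lexx lerDl ltW.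
  - by move=> v /pa /le_trans; apply; rewrite lerD2r.
have [|e [ctl [phi [/andP[se _] st ps pe pa]]]] := Hk y s; first by rewrite cy.
exists e, ctl, phi; split=> //.
- by rewrite (le_trans _ se)// lerD2l ge_min lexx orbT.
- by rewrite le_max pe.
Qed.

(** At the ends of the steps V never exceeds the maximum of V y and c + eta, so the rises within
    single steps do not add up. *)
Lemma steps_uniform c b eta : 0 < c -> 0 < eta -> c + eta <= b ->
  exists tau delta U : R, [/\ 0 < tau, 0 < delta & forall k y s, V y <= b ->
    exists e ctl phi, [/\ s + k%:R * tau <= e, steer U s e ctl phi, phi s = y,
      V (phi e) <= Num.max (V y - k%:R * delta) (c + eta) &
      forall v, s <= v <= e -> V (phi v) <= Num.max (V y) (c + eta) + eta]].
Proof.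
move=> c0 eta0 cb; have [tau [delta [U [tau0 delta0 H]]]] := step_uniform b c0 eta0.
exists tau, delta, U; split=> //; elim=> [|k IH] y s yb.
  (* For k = 0 a trajectory on the single point s is still required; it is cut out of one step. *)
  have [e [ctl [phi [se [mc cU T] ps pe pa]]]] := H y s yb.
  have se' : s <= e by rewrite (le_trans _ se)// lerDl ltW.
  exists s, ctl, phi; split=> //.
  - by rewrite mul0r addr0.
  - exact: (steer_sub (lexx s) (lexx s) se').
  - by rewrite ps mul0r subr0 le_max lexx.
  - move=> v /andP[sv vs]; have -> : v = s by apply/le_anti; rewrite sv vs.
    by rewrite ps ler_wpDr ?(ltW eta0)// le_max lexx.
have [m [c1 [phi [sm st1 ps pm pa]]]] := IH y s yb.
have sm' : s <= m by rewrite (le_trans _ sm)// lerDl mulr_ge0// ltW.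
have kd : 0 <= k%:R * delta by rewrite mulr_ge0// ltW.
have Vm : V (phi m) <= Num.max (V y) (c + eta).
  by rewrite (le_trans pm)// ge_max !le_max lexx orbT andbT gerBl kd.
have Vmb : V (phi m) <= b by rewrite (le_trans Vm)// ge_max yb.
have [e [c2 [psi [me st2 qs qe qa]]]] := H (phi m) m Vmb.
have me' : m <= e by rewrite (le_trans _ me)// lerDl ltW.
exists e, (fun t => if t < m then c1 t else c2 t), (fun t => if t <= m then phi t else psi t).
split.
- by rewrite -natr1 mulrDl mul1r addrA (le_trans _ me)// lerD2r.
- exact: steer_cat.
- by rewrite sm'.
- have -> : (if e <= m then phi e else psi e) = psi e.
    by case: ifP => // em; have -> : e = m; [apply/le_anti; rewrite em me'|rewrite qs].
  rewrite (le_trans qe)// -natr1 mulrDl mul1r opprD addrA.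
  move: pm; rewrite !ge_max !le_max lexx orbT andbT => /orP[h|h].
    by rewrite lerD2r h.
  by apply/orP; right; rewrite lerBlDr (le_trans h)// lerDl ltW.
- move=> v /andP[sv ve]; case: ifPn => vm; first by rewrite pa// sv.
  have mv : m <= v by rewrite ltW// ltNge.
  apply: (le_trans (qa v _)); first by rewrite mv.
  by rewrite lerD2r ge_max Vm/= !le_max lerDl (ltW eta0) orbT.
Qed.

(** With c = b/4 and eta = b/8, the first k1 steps bring V below 3b/8, without exceeding b + b/8.
    The next k2 steps wait for a sampling time, and keep V below 3b/8 + b/8 = b/2. *)
Lemma reach (T : nat -> R) b : (forall i, T i < T i.+1) -> T @ \oo --> +oo -> 0 < b ->
  exists U : R, forall i y, V y <= b -> exists j ctl phi,
    [/\ (i <= j)%N, steer U (T i) (T j) ctl phi, phi (T i) = y, V (phi (T j)) <= b / 2 &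
        forall v, T i <= v <= T j -> V (phi v) <= b * 2].
Proof.
move=> Ti Too b0; have c0 : 0 < b / 4 by rewrite divr_gt0.
have eta0 : 0 < b / 8 by rewrite divr_gt0.
have cb : b / 4 + b / 8 <= b by lra.
have [tau [delta [U [tau0 delta0 H]]]] := steps_uniform c0 eta0 cb.
have bnd (z d : R) : 0 < d -> exists k : nat, z <= k%:R * d.
  move=> d0; exists (Num.bound `|z / d|); rewrite -ler_pdivrMr//.
  by rewrite (le_trans (ler_norm _))// ltW// archi_boundP.
exists U => i y yb.
have [k1 Hk1] := bnd b delta delta0.
have [m [c1 [phi [sm st1 ps pm pa]]]] := H k1 y (T i) yb.
have sm' : T i <= m by rewrite (le_trans _ sm)// lerDl mulr_ge0// ltW.
have Vm : V (phi m) <= b / 4 + b / 8.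
  rewrite (le_trans pm)// ge_max lexx andbT lerBlDr (le_trans yb)// (le_trans Hk1)//.
  by rewrite lerDr ltW// addr_gt0.
have [j mj] : exists j, m <= T j.
  by have /cvgryPge /(_ m) [j _ Hj] := Too; exists j; apply: Hj => /=.
have ij : (i <= maxn i j)%N by rewrite leq_maxl.
have mT : m <= T (maxn i j) by rewrite (le_trans mj)// partition_le// leq_maxr.
have [k2 Hk2] := bnd (T (maxn i j) - m) tau tau0.
have [e [c2 [psi [me st2 qs _ qa]]]] := H k2 (phi m) m (le_trans Vm cb).
have Te : T (maxn i j) <= e by rewrite (le_trans _ me)// -lerBlDl.
have st3 := steer_sub (lexx m) mT Te st2.
have qa' v : m <= v <= e -> V (psi v) <= b / 2.
  move=> /qa /le_trans; apply; rewrite (_ : b / 2 = b / 4 + b / 8 + b / 8); last by field.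
  by rewrite lerD2r ge_max Vm lexx.
exists (maxn i j), (fun t => if t < m then c1 t else c2 t),
  (fun t => if t <= m then phi t else psi t); split=> //.
- exact: steer_cat.
- by rewrite sm'.
- have -> : (if T (maxn i j) <= m then phi (T (maxn i j)) else psi (T (maxn i j))) = psi (T (maxn i j)).
    case: ifP => // em; have -> : T (maxn i j) = m by apply/le_anti; rewrite em mT.
    by rewrite qs.
  by apply: qa'; rewrite mT.
- move=> v /andP[sv ve]; case: ifPn => vm.
    have := pa v; rewrite sv vm => /(_ isT) /le_trans; apply.
    have : Num.max (V y) (b / 4 + b / 8) <= b by rewrite ge_max yb cb.
    by move: (Num.max _ _) b0 => z; lra.
  rewrite (le_trans (qa' v _))//; last by move: b0; lra.
  by rewrite (le_trans ve)// andbT ltW// ltNge.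
Qed.

End Steer.

(** * The sampled feedback *)

Section Norms.
Context {R : realType} {n : nat}.
Notation E := 'rV[R]_n.

Lemma norm_le_enorm (x : E) : `|x| <= enorm x.
Proof.
apply: rV_norm_leP => [|i]; first exact: sqrtr_ge0.
rewrite -sqrtr_sqr ler_wsqrtr// (bigD1 i)//= lerDl sumr_ge0// => j _.
exact: sqr_ge0.
Qed.

Lemma enorm_le_norm (x : E) : enorm x <= n%:R * `|x|.
Proof.
rewrite -[leRHS]ger0_norm ?mulr_ge0// -sqrtr_sqr ler_wsqrtr//.
apply: (@le_trans _ _ (\sum_(i < n) `|x| ^+ 2)).
  apply: ler_sum => i _; rewrite -real_normK ?num_real// lerXn2r ?nnegrE//.
  exact: rV_coord_le.
rewrite sumr_const card_ord exprMn -[leLHS]mulr_natl ler_wpM2r ?sqr_ge0//.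
by rewrite -natrX ler_nat; case: (n) => // k; rewrite expnS expn1 leq_pmulr.
Qed.

Lemma enorm_const (c : R) : enorm (const_mx c : 'rV[R]_1) = `|c|.
Proof. by rewrite /enorm big_ord1 mxE sqrtr_sqr. Qed.

End Norms.

Lemma int_max (P : int -> Prop) (m0 M : int) : P m0 -> (forall m, P m -> m <= M) ->
  exists2 m, P m & forall m', P m' -> m' <= m.
Proof.
move=> P0 PM; pose Q k := `[< P (m0 + k%:Z) >].
have exQ : exists k, Q k by exists 0%N; apply/asboolP; rewrite addr0.
have Qb k : Q k -> (k <= `|M - m0|)%N by move=> /asboolP/PM; lia.
case: (ex_maxnP exQ Qb) => k /asboolP Qk kmax; exists (m0 + k%:Z) => // m' Pm'.
have [|m0m'] := leP m' m0; first by lia.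
have : Q `|m' - m0|%N by apply/asboolP; rewrite (_ : m0 + _ = m'); [|lia].
by move=> /kmax; lia.
Qed.

Lemma nat_min (P : nat -> Prop) k0 : P k0 -> exists2 k, P k & forall k', P k' -> (k <= k')%N.
Proof.
move=> P0; have exP : exists k, `[< P k >] by exists k0; apply/asboolP.
case: (ex_minnP exP) => k /asboolP Pk kmin; exists k => // k' Pk'.
by apply: kmin; apply/asboolP.
Qed.

Section Levels.
Context {R : realType}.

(** Negative indices accommodate large initial values of V. *)
Definition level (m : int) : R := 2 ^ (- m).

Lemma level_gt0 m : 0 < level m.
Proof. exact: exprz_gt0. Qed.

Lemma levelS m : level (m + 1) = level m / 2.
Proof. by rewrite /level opprD expfzDr// pnatr_eq0. Qed.

Lemma level_le m m' : m <= m' -> level m' <= level m.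
Proof.
move=> mm'; have -> : m' = m + `|m' - m|%N%:Z by lia.
elim: `|m' - m|%N => [|k IH]; first by rewrite addr0.
rewrite -addn1 PoszD addrA levelS (le_trans _ IH)// ler_pdivrMr//.
by rewrite ler_peMr ?(ltW (level_gt0 _))// ler1n.
Qed.

Lemma level_small z : 0 < z -> exists m, level m < z.
Proof.
move=> z0; exists (Num.bound z^-1)%:Z; rewrite /level.
rewrite -exprnN invf_plt ?posrE ?exprn_gt0//.
apply: (@lt_trans _ _ (Num.bound z^-1)%:R); first by rewrite archi_boundP// invr_ge0 ltW.
by rewrite -natrX ltr_nat ltn_expl.
Qed.

Lemma level_large (z : R) : exists m, z <= level m.
Proof.
exists (- (Num.bound `|z|)%:Z); rewrite /level opprK.
apply: (@le_trans _ _ (Num.bound `|z|)%:R).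
  by rewrite (le_trans (ler_norm _))// ltW// archi_boundP.
by rewrite -exprnP -natrX ler_nat ltnW// ltn_expl.
Qed.

Lemma level_antitone m m' : level m <= level m' -> m' <= m.
Proof.
rewrite leNgt; apply: contraNle => mm'.
have h : m + 1 <= m' by lia.
by rewrite (le_lt_trans (level_le h))// levelS ltr_pdivrMr// ltr_pMr ?level_gt0// ltr1n.
Qed.

End Levels.

Section Properness.
Context {R : realType} {n : nat}.
Notation E := 'rV[R]_n.
Variable V : E -> R.
Hypotheses (Vc : continuous V) (V0 : positive_definite V) (Vp : proper_map V).

(** By properness {0 <= V <= 1} is compact, so V has a positive lower bound on its part with |y| >
    eps; the minimum with 1 puts y in that set. *)
Lemma V_small_norm eps : 0 < eps -> exists2 c : R, 0 < c & forall y, V y <= c -> `|y| <= eps.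
Proof.
move=> eps0; pose P (k : nat) (y : E) := eps < `|y| -> k.+1%:R^-1 < V y.
have cI : compact `[0 : R, 1]%classic by exact: segment_compact.
have /compact_near_coveringP /(_ nat \oo P _) := Vp cI.
case=> [x _|k _ Hk].
  have [->|x0] := eqVneq x 0.
    exists ([set y | `|y - 0| <= eps], setT).
      by split => /=; [exact: nbhs_norm_le|exact: filterT].
    by move=> [y k] /= [yr _]; rewrite /P ltNge; move: yr; rewrite subr0 => ->.
  have Vx : 0 < V x by exact: V0.2.
  have Vx2 : 0 < V x / 2 by rewrite divr_gt0.
  have /cvgrPdist_lt /(_ _ Vx2) nV := @Vc x.
  exists ([set y | `|V x - V y| < V x / 2], [set k | (Num.bound (V x / 2)^-1 <= k)%N]).
    by split => //=; exists (Num.bound (V x / 2)^-1).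
  move=> [y k] /= [yr Mk] _.
  have h1 : k.+1%:R^-1 < V x / 2.
    rewrite invf_plt ?posrE//; apply: (@lt_le_trans _ _ (Num.bound (V x / 2)^-1)%:R).
      by rewrite archi_boundP// invr_ge0 ltW.
    by rewrite ler_nat ltnW.
  move: yr => /ltr_normlP[_]; rewrite ltrBlDr {1}[V x]splitr ltrD2l.
  exact: lt_trans.
have k0 : 0 < k.+1%:R^-1 :> R by rewrite invr_gt0 ltr0n.
exists (Num.min 1 k.+1%:R^-1) => [|y]; first by rewrite lt_min ltr01.
rewrite le_min => /andP[y1 yk]; rewrite leNgt; apply/negP => ye.
have : V y < V y.
  apply: (le_lt_trans yk); apply: (Hk k) => //=.
  by rewrite in_itv /= (V_ge0 V0).
by rewrite ltxx.
Qed.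

Lemma norm_small_V c : 0 < c -> exists2 d : R, 0 < d & forall y, `|y| <= d -> V y <= c.
Proof.
move=> c0; have /cvgrPdist_lt /(_ _ c0) /nbhs_normP[e /= e0 He] := @Vc 0.
exists (e / 2) => [|y ye]; first by rewrite divr_gt0.
have /ltr_normlP[+ _] : `|V 0 - V y| < c.
  apply: He => /=; rewrite sub0r normrN (le_lt_trans ye)// ltr_pdivrMr// ltr_pMr// ltr1n//.
by rewrite V0.1 sub0r opprK => /ltW.
Qed.

End Properness.

Section Feedback.
Context {R : realType} {n : nat}.
Notation E := 'rV[R]_n.
Variables (f g : E -> E) (V : E -> R).
Hypotheses (fs : smooth f) (gs : smooth g) (Vs : smooth V) (f0 : f 0 = 0).
Hypotheses (V0 : positive_definite V) (Vp : proper_map V).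
Hypothesis dV : forall x, x != 0 -> descent f g V x.

(** [local_step] for the minimum of sigma and V x: the duration is at most sigma and V rises by at
    most V x, whence the bound 2 V x. *)
Lemma initial_step x sigma : 0 < sigma -> x != 0 ->
  exists (eps : R) (u : R -> 'rV[R]_1) (phi : R -> E),
    [/\ 0 < eps <= sigma, measurable_control `[0, eps] u /\ loc_ess_bounded `[0, eps] u,
        is_trajectory (affine_system f g) u 0 eps phi /\ phi 0 = x,
        V (phi eps) < V x & forall s, s \in `[0, eps] -> V (phi s) <= 2 * V x].
Proof.
move=> sigma0 x0; have Vx : 0 < V x by exact: V0.2.
have m0 : 0 < Num.min sigma (V x) by rewrite lt_min sigma0.
have [u [w [t1 [t2 [d [r [[t10 t20 tsig d0 r0] H]]]]]]] := local_step fs gs Vs (dV x0) m0.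
have [|phi [T ps pe pa]] := H x 0; first by rewrite subrr normr0 ltW.
move: T ps pe pa; rewrite !add0r => T ps pe pa.
move: tsig; rewrite le_min => /andP[tsig tV].
pose c t : R := if t < t1 then u else w.
have t12 : 0 < t1 + t2 by rewrite ltr_wpDr.
exists (t1 + t2), (fun t => const_mx (c t)), phi; split=> //.
- by rewrite t12.
- split.
    move=> i; rewrite (_ : (fun t => _) = c); last by apply/funext => t; rewrite mxE.
    apply: measurable_funTS; apply: measurable_if_lt; exact: measurable_cst.
  move=> K _ _; exists (`|u| + `|w|); apply: aeW => t _; rewrite enorm_const /c.
  by case: ifP => _; [rewrite lerDl|rewrite lerDr].
- split=> //; apply: (traj_is_trajectory (ltW t12) _ T) => t _.
  by rewrite mxE.
- by rewrite (le_lt_trans pe)// ltrBlDr ltrDl.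
- move=> s; rewrite in_itv /= => /pa /le_trans; apply.
  by rewrite mulr_natl mulr2n lerD2l ge_min lexx orbT.
Qed.

Section Partition.
Variable T : nat -> R.
Hypotheses (T0 : T 0%N = 0) (Ti : forall i, T i < T i.+1) (Too : T @ \oo --> +oo).

(** The control bound depends on the level alone, neither on the state nor on the sampling time; the
    boundedness of the feedback rests on this. *)
Definition plan (U : int -> R) i x (m : int) j ctl phi :=
  [/\ (i <= j)%N, steer f g (U m) (T i) (T j) ctl phi, phi (T i) = x,
      V (phi (T j)) <= level m / 4 & forall v, T i <= v <= T j -> V (phi v) <= level m].

(** [reach] for b = level m / 2: its bounds b/2 and 2b are those required of a plan. *)
Lemma plan_exists : exists U : int -> R, forall i x m, V x <= level m / 2 ->
  exists j ctl phi, plan U i x m j ctl phi.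
Proof.
have H (m : int) : {U : R | forall i x, V x <= level m / 2 -> exists j ctl phi,
    [/\ (i <= j)%N, steer f g U (T i) (T j) ctl phi, phi (T i) = x,
      V (phi (T j)) <= level m / 4 & forall v, T i <= v <= T j -> V (phi v) <= level m]}.
  apply: cid; have b0 : 0 < level m / 2 :> R by rewrite divr_gt0 ?level_gt0.
  have [U HU] := reach fs gs Vs V0 Vp dV Ti Too b0.
  exists U => i x /HU -/(_ i)[j [ctl [phi [ij st ps pe pa]]]]; exists j, ctl, phi; split=> //.
    by rewrite (le_trans pe)// -mulrA -invfM -natrM.
  by move=> v /pa; rewrite divfK.
by exists (fun m => sval (H m)) => i x m; exact: (svalP (H m)).
Qed.

Lemma plan_level U i x m j ctl phi : plan U i x m j ctl phi -> V x <= level m.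
Proof.
by move=> [ij _ <- _ pa]; apply: pa; rewrite lexx partition_le.
Qed.

(** What remains of a plan competes in the next choice, so the best level there is at least m and,
    at equal level, the best end at most j. *)
Lemma plan_tail U i x m j ctl phi : (i < j)%N -> plan U i x m j ctl phi ->
  plan U i.+1 (phi (T i.+1)) m j ctl phi.
Proof.
move=> ij [_ st _ pe pa]; split=> //.
- by apply: (steer_sub _ _ _ st); rewrite ?partition_le// ltW.
- by move=> v /andP[iv vj]; apply: pa; rewrite vj andbT (le_trans _ iv)// ltW.
Qed.

Definition best U i x m j ctl phi := plan U i x m j ctl phi /\
  forall m' j' ctl' phi', plan U i x m' j' ctl' phi' -> m' <= m /\ (m' = m -> (j <= j')%N).

Lemma best_exists U : (forall i x m, V x <= level m / 2 ->
    exists j ctl phi, plan U i x m j ctl phi) ->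
  exists (m : nat -> E -> int) (j : nat -> E -> nat) (K : nat -> E -> R -> R)
    (tr : nat -> E -> R -> E), forall i x, x != 0 ->
    best U i x (m i x) (j i x) (K i x) (tr i x).
Proof.
move=> HU.
have H (p : nat * E) : {q : int * nat * (R -> R) * (R -> E) | p.2 != 0 ->
    best U p.1 p.2 q.1.1.1 q.1.1.2 q.1.2 q.2}.
  apply: cid; case: p => i x /=.
  (* At the origin plans of every level exist and none is largest; the values there are dummies. *)
  have [->|x0] := eqVneq x 0; first by exists (0, 0%N, fun=> 0, fun=> 0).
  have Vx : 0 < V x by exact: V0.2.
  (* A plan of level m has V x <= level m, so V x > 0 bounds the levels from above; m0 is a level
     that has a plan. *)
  have [M HM] := level_small Vx; have [m0 Hm0] := level_large (V x * 2).
  have [|j0 [c0 [p0 P0]]] := HU i x m0; first by rewrite ler_pdivlMr.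
  have [||m [j1 [c1 [p1 P1]]] mmax] := @int_max
      (fun m => exists j ctl phi, plan U i x m j ctl phi) m0 M.
  - by exists j0, c0, p0.
  - move=> m [j [c [p /plan_level Vm]]]; apply: (@level_antitone R).
    exact: le_trans (ltW HM) Vm.
  have [|j [c [p P]] jmin] := @nat_min (fun j => exists ctl phi, plan U i x m j ctl phi) j1.
    by exists c1, p1.
  exists (m, j, c, p) => _; split=> // m' j' c' p' P'; split.
    by apply: mmax; exists j', c', p'.
  by move=> /= m'm; apply: jmin; exists c', p'; rewrite -m'm.
exists (fun i x => (sval (H (i, x))).1.1.1), (fun i x => (sval (H (i, x))).1.1.2),
  (fun i x => (sval (H (i, x))).1.2), (fun i x => (sval (H (i, x))).2) => i x x0.
exact: (svalP (H (i, x)) x0).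
Qed.


Section Loop.
Variables (U : int -> R) (m : nat -> E -> int) (j : nat -> E -> nat).
Variables (K0 : nat -> E -> R -> R) (tr0 : nat -> E -> R -> E).
Hypothesis HU : forall i x m, V x <= level m / 2 -> exists j ctl phi, plan U i x m j ctl phi.
Hypothesis HB : forall i x, x != 0 -> best U i x (m i x) (j i x) (K0 i x) (tr0 i x).

(** At the origin the control is zero, and f 0 = 0 keeps the state there. *)
Let K i x t : R := if x == 0 then 0 else K0 i x t.
Let tr i x t : E := if x == 0 then 0 else tr0 i x t.
(** The origin counts as having every level. *)
Let good i M x := x = 0 \/ M <= m i x.

(** If the best plan ended at once, V x <= level m / 4 = level (m + 1) / 2 would provide a plan of
    level m + 1. *)
Lemma plan_ahead i x : x != 0 -> (i < j i x)%N.
Proof.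
move=> x0; have [[ij st ps pe pa] mmax] := HB i x0.
rewrite ltn_neqAle ij andbT; apply/eqP => ije.
move: pe; rewrite -ije ps => Vx.
have [|j' [c' [p' P']]] := HU i (x := x) (m := m i x + 1).
  by rewrite levelS (le_trans Vx)// -mulrA -invfM -natrM.
by have [] := mmax _ _ _ _ P'; lia.
Qed.

Lemma sampled_piece i x : [/\ measurable_fun setT (K i x),
  exists B, forall t, `|K i x t| <= B, traj f g (K i x) (T i) (T i.+1) (tr i x) & tr i x (T i) = x].
Proof.
rewrite /K /tr; have [->|x0] := eqVneq x 0.
  split=> //; first by exists 0 => t; rewrite normr0.
  move=> k; have e : rhs f g (fun=> 0) (fun=> 0) k = fun=> 0.
    by apply/funext => t; rewrite /rhs f0 scale0r addr0 mxE.
  split=> [|t _]; rewrite e; first by apply: integrable_continuous => t; exact: cvg_cst.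
  by rewrite mxE add0r /Rintegral integral0.
have [[ij [mc cU Tr] ps _ _] _] := HB i x0.
split=> //; first by exists (U (m i x)).
apply: (traj_sub (lexx _) _ _ Tr); first exact: ltW.
by apply: partition_le => //; exact: plan_ahead.
Qed.

Lemma good_bound i M x t : good i M x -> T i <= t <= T i.+1 -> V (tr i x t) <= level M.
Proof.
rewrite /tr => gM /andP[it ti]; have [_|x0] := eqVneq x 0; first by rewrite V0.1 ltW ?level_gt0.
case: gM => [xE|Mm]; first by rewrite xE eqxx in x0.
have [[ij _ _ _ pa] _] := HB i x0.
apply: (le_trans _ (@level_le R _ _ Mm)); apply: pa; rewrite it (le_trans ti)//.
by apply: partition_le => //; exact: plan_ahead.
Qed.

Lemma good_next i M x : good i M x -> good i.+1 M (tr i x (T i.+1)).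
Proof.
rewrite /tr => gM; have [_|x0] := eqVneq x 0; first by left.
case: gM => [xE|Mm]; first by rewrite xE eqxx in x0.
have [y0|y0] := eqVneq (tr0 i x (T i.+1)) 0; first by left.
right; have [P _] := HB i x0.
have [_ mmax] := HB i.+1 y0.
by have [/(le_trans Mm)] := mmax _ _ _ _ (plan_tail (plan_ahead i x0) P).
Qed.

Lemma good_start i M x : V x <= level M / 2 -> good i M x.
Proof.
move=> VM; have [x0|x0] := eqVneq x 0; [by left|right].
have [j' [c' [p' P']]] := HU i VM; have [_ mmax] := HB i x0.
by have [] := mmax _ _ _ _ P'.
Qed.

Lemma good_later X i i' M : (forall i, X i.+1 = tr i (X i) (T i.+1)) -> (i <= i')%N ->
  good i M (X i) -> good i' M (X i').
Proof.
move=> XS /subnKC <- gi; elim: (i' - i)%N => [|k IH]; first by rewrite addn0.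
by rewrite addnS XS; exact: good_next.
Qed.

(* While the level stays the same the planned end does not move, so it is
   eventually reached. *)
Lemma good_progress X i M : (forall i, X i.+1 = tr i (X i) (T i.+1)) ->
  good i M (X i) -> exists i', good i' (M + 1) (X i').
Proof.
move=> XS gi; apply: contrapT => nex.
have bad i' : (i <= i')%N -> X i' != 0 /\ m i' (X i') = M.
  move=> ii'; have gi' := good_later XS ii' gi.
  have X0 : X i' != 0 by apply/eqP => X0; apply: nex; exists i'; left.
  split=> //; case: gi' => [XE|Mm]; first by rewrite XE eqxx in X0.
  have : ~ M + 1 <= m i' (X i') by move=> h; apply: nex; exists i'; right.
  by move: Mm; lia.
have jle k : (j (i + k) (X (i + k)%N) <= j i (X i))%N.
  elim: k => [|k IH]; first by rewrite addn0.
  apply: leq_trans IH; rewrite addnS.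
  have [X0 mM] := bad (i + k)%N (leq_addr _ _).
  have [X0' mM'] := bad (i + k).+1 (leqW (leq_addr _ _)).
  have [P _] := HB (i + k)%N X0; have [_ mmax] := HB (i + k).+1 X0'.
  have P' := plan_tail (plan_ahead (i + k) X0) P.
  have e : X (i + k).+1 = tr0 (i + k) (X (i + k)%N) (T (i + k).+1).
    by rewrite XS /tr (negbTE X0).
  rewrite -e in P'; have [_] := mmax _ _ _ _ P'.
  by rewrite mM mM'; apply.
have [X0 _] := bad i (leqnn i).
have ij := ltnW (plan_ahead i X0).
have := jle (j i (X i) - i)%N; rewrite subnKC//.
have [X0' _] := bad _ ij; have := plan_ahead (j i (X i)) X0'; lia.
Qed.

Lemma good_eventually X M : (forall i, X i.+1 = tr i (X i) (T i.+1)) ->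
  exists i, good i M (X i).
Proof.
move=> XS; have [M0 HM0] := level_large (V (X 0%N) * 2).
have gk k : exists i, good i (M0 + k%:Z) (X i).
  elim: k => [|k [i gi]].
    by exists 0%N; rewrite addr0; apply: good_start; rewrite ler_pdivlMr.
  have [i' gi'] := good_progress XS gi; exists i'.
  by rewrite -addn1 PoszD addrA.
have [i [X0|h]] := gk `|M - M0|%N; exists i; [by left|right].
by apply: le_trans h; lia.
Qed.

(** Index of the sampling interval containing t; the default 0 is taken only for t < 0. *)
Let idx t := xget 0%N [set i | T i <= t < T i.+1].

Lemma idxE i t : T i <= t < T i.+1 -> idx t = i.
Proof.
move=> /andP[it ti]; apply: xget_unique; first by rewrite /= it.
move=> k /= /andP[kt tk].
have le_of a b : T a <= t -> t < T b.+1 -> (a <= b)%N.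
  move=> at' tb; rewrite leqNgt; apply/negP => ba.
  by have := lt_le_trans tb (le_trans (partition_le Ti ba) at'); rewrite ltxx.
by apply/eqP; rewrite eqn_leq !le_of.
Qed.

Lemma idx_exists t : 0 <= t -> exists i, T i <= t < T i.+1.
Proof.
move=> t0; have [k0 tk0] : exists k, t < T k.
  by have /cvgryPgt /(_ t) [k _ Hk] := Too; exists k; apply: Hk => /=.
have [k tk kmin] := @nat_min (fun k => t < T k) k0 tk0.
case: k tk kmin => [|k] tk kmin; first by move: tk; rewrite T0 ltNge t0.
exists k; rewrite tk andbT leNgt; apply/negP => /kmin; by rewrite ltnn.
Qed.

Definition feedback (t : R) (x : E) : 'rV[R]_1 := const_mx (K (idx t) x t).

(** Uniqueness for bounded controls identifies any closed-loop trajectory with the chosen plan on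
    each sampling interval. *)
Lemma closed_loop_piece phi i : closed_loop (affine_system f g) T setT feedback phi ->
  forall t, T i <= t <= T i.+1 -> phi t = tr i (phi (T i)) t.
Proof.
move=> cl; have [_ /is_trajectory_traj Tr] := cl i.
have [_ [B KB] Tr' trs] := sampled_piece i (phi (T i)).
have Ti' := ltW (Ti i).
apply: (traj_uniq fs gs (fun t _ => KB t) _ Tr' (esym trs)).
apply: (traj_eq Ti' _ _ Tr) => // t ti.
by rewrite mxE (idxE ti).
Qed.

Lemma closed_loop_exists x : exists2 phi,
  closed_loop (affine_system f g) T setT feedback phi & phi 0 = x.
Proof.
pose X := fix X i := if i is i'.+1 then tr i' (X i') (T i'.+1) else x.
pose phi t := tr (idx t) (X (idx t)) t.
have phiT i : phi (T i) = X i.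
  rewrite /phi (@idxE i); last by rewrite lexx Ti.
  by have [_ _ _] := sampled_piece i (X i).
have phiE i t : T i <= t <= T i.+1 -> phi t = tr i (X i) t.
  move=> /andP[it]; rewrite le_eqVlt => /orP[/eqP ->|ti]; first by rewrite phiT.
  by rewrite /phi (@idxE i) ?it.
exists phi; last by rewrite -T0 phiT.
move=> i; split=> //; have [_ _ Tr _] := sampled_piece i (X i).
apply: (@traj_is_trajectory _ _ f g (K i (X i))); first exact: ltW.
  by move=> t ti; rewrite mxE (idxE ti) phiT.
by apply: (traj_eq (ltW (Ti i)) _ _ Tr) => // t ti; rewrite (phiE i).
Qed.

Lemma closed_loop_bound phi i M : closed_loop (affine_system f g) T setT feedback phi ->
  good i M (phi (T i)) -> forall t, 0 <= t -> T i <= t -> V (phi t) <= level M.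
Proof.
move=> cl gi t t0 it; have [k kt] := idx_exists t0.
have kt' : T k <= t <= T k.+1 by move: kt => /andP[-> /ltW].
rewrite (closed_loop_piece cl kt'); apply: good_bound => //.
have ik : (i <= k)%N.
  rewrite leqNgt; apply/negP => ki; move: kt => /andP[_ tk].
  by have := lt_le_trans tk (le_trans (partition_le Ti ki) it); rewrite ltxx.
apply: (@good_later (fun k => phi (T k)) i k M _ ik gi) => l.
by apply: (closed_loop_piece cl); rewrite lexx ltW.
Qed.

Lemma feedback_measurable x : measurable_control `[0, +oo[ (feedback ^~ x).
Proof.
move=> i; rewrite (_ : (fun t => _) = fun t => K (idx t) x t); last first.
  by apply/funext => t; rewrite mxE.
have -> : `[0, +oo[%classic = \bigcup_k `[T k, T k.+1[%classic.
  apply/seteqP; split=> t /=; rewrite in_itv /= ?andbT.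
    by move=> /idx_exists[k kt]; exists k => //=; rewrite in_itv.
  move=> [k _ /=]; rewrite in_itv /= => /andP[kt _].
  by apply: le_trans kt; rewrite -T0; exact: partition_le.
apply/measurable_fun_bigcup => [k|k]; first exact: measurable_itv.
apply: (eq_measurable_fun (K k x)).
  by move=> t; rewrite inE /= in_itv /= => /idxE ->.
by apply: measurable_funTS; have [] := sampled_piece k x.
Qed.

(** At every sampling time the best level at x lies between m0 and M, which depend on x only, so
    finitely many bounds [U m] occur. *)
Lemma feedback_bounded x : ess_bounded `[0, +oo[ (feedback ^~ x).
Proof.
suff [B HB'] : exists B, forall i t, `|K i x t| <= B.
  by exists B; apply: aeW => t _; rewrite enorm_const.
have [xE|x0] := eqVneq x 0; first by exists 0 => i t; rewrite /K xE eqxx normr0.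
have Vx : 0 < V x by exact: V0.2.
have [M HM] := level_small Vx; have [m0 Hm0] := level_large (V x * 2).
exists (\sum_(k < `|M - m0|.+1) `|U (m0 + k%:Z)|) => i t.
have gi : m0 <= m i x.
  have /good_start : V x <= level m0 / 2 by rewrite ler_pdivlMr.
  by move=> /(_ i)[xE|//]; rewrite xE eqxx in x0.
have [P _] := HB i x0.
have mM : m i x <= M.
  by apply: (@level_antitone R); exact: le_trans (ltW HM) (plan_level P).
have kM : (`|m i x - m0| < `|M - m0|.+1)%N by lia.
rewrite (bigD1 (Ordinal kM))//= (_ : m0 + _ = m i x); last by lia.
rewrite /K (negbTE x0); have [_ [_ cU _] _ _ _] := P.
by rewrite ler_wpDr ?sumr_ge0// (le_trans (cU t))// ler_norm.
Qed.

Lemma feedback_stable eps : 0 < eps -> exists2 delta : R, 0 < delta &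
  forall phi, closed_loop (affine_system f g) T setT feedback phi -> enorm (phi 0) <= delta ->
    forall t : R, 0 <= t -> enorm (phi t) <= eps.
Proof.
move=> eps0; have Vc := smooth_continuous Vs.
have n0 : 0 < n%:R + 1 :> R by rewrite ltr_wpDl.
(* The factor n + 1 passes from the sup norm to the Euclidean norm and is positive even for n =
   0. *)
have [c c0 Hc] := V_small_norm Vc V0 Vp (divr_gt0 eps0 n0).
have [M HM] := level_small c0.
have [d d0 Hd] := norm_small_V Vc V0 (divr_gt0 (level_gt0 M) (ltr0n R 2)).
exists d => // phi cl phid t t0.
have gM : good 0 M (phi (T 0%N)).
  by apply: good_start; rewrite T0; apply: Hd; exact: le_trans (norm_le_enorm _) phid.
have Vt : V (phi t) <= c.
  by apply: le_trans (ltW HM); apply: (closed_loop_bound cl gM) => //; rewrite T0.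
apply: (le_trans (enorm_le_norm _)).
apply: (@le_trans _ _ ((n%:R + 1) * `|phi t|)); first by rewrite ler_wpM2r// lerDl.
by rewrite mulrC -ler_pdivlMr// Hc.
Qed.

Lemma feedback_attractive phi : closed_loop (affine_system f g) T setT feedback phi ->
  phi t @[t --> +oo] --> (0 : E).
Proof.
move=> cl; apply/cvgrPdist_le => eps eps0.
have [c c0 Hc] := V_small_norm (smooth_continuous Vs) V0 Vp eps0.
have [M HM] := level_small c0.
have [|i gi] := @good_eventually (fun i => phi (T i)) M.
  by move=> i; apply: (closed_loop_piece cl); rewrite lexx ltW.
exists (T i); split; first exact: num_real.
move=> t it; rewrite sub0r normrN Hc// (le_trans _ (ltW HM))//.
apply: (closed_loop_bound cl gi); last exact: ltW.
by apply: le_trans (ltW it); rewrite -T0 partition_le.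
Qed.

End Loop.
End Partition.

Lemma sampled_stabilization : SDF_SGAS (affine_system f g).
Proof.
move=> r T r0 T0 Ti Too _; have [U HU] := plan_exists Ti Too.
have [m [j [K [tr HB]]]] := best_exists Ti HU.
exists setT, (feedback T K); split.
- by split; [exact: filterT|].
- by move=> x _; split; [exact: feedback_measurable HU HB _|exact: feedback_bounded HU HB _].
- by move=> x _; exact: closed_loop_exists HU HB _.
- by move=> eps; exact: feedback_stable HU HB _.
- by move=> phi; exact: feedback_attractive HU HB _.
Qed.

End Feedback.

Theorem proposition2 (R : realType) (n : nat)
  (f g : 'rV[R]_n -> 'rV[R]_n) (V : 'rV[R]_n -> R)
  (f_smooth : smooth f) (g_smooth : smooth g) (f0 : f 0 = 0)
  (V_smooth : smooth V) (V_posdef : positive_definite V)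
  (V_proper : proper_map V)
  (hV : forall x : 'rV[R]_n, x != 0 ->
     lder g V x <> 0 \/
     (lder g V x = 0 /\ (lder f V x < 0 \/ condition_B f g V x))) :
  (exists a : R -> R, classK a /\
     forall (sigma : R) (x : 'rV[R]_n), 0 < sigma -> x != 0 ->
     exists (eps : R) (u : R -> 'rV[R]_1) (phi : R -> 'rV[R]_n),
       [/\ 0 < eps <= sigma,
           measurable_control `[0, eps] u /\ loc_ess_bounded `[0, eps] u,
           is_trajectory (affine_system f g) u 0 eps phi /\ phi 0 = x,
           V (phi eps) < V x &
           forall s, s \in `[0, eps] -> V (phi s) <= a (V x)])
  /\ SDF_SGAS (affine_system f g).
Proof.
have dV x : x != 0 -> descent f g V x.
  by move=> /hV; exact: (@condition_descent R n (mk_sm f_smooth) (mk_sm g_smooth) (mk_sm V_smooth)).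
split; last exact: (sampled_stabilization f_smooth g_smooth V_smooth f0 V_posdef V_proper dV).
(* The factor 2 is the one of [initial_step]. *)
exists (fun s => 2 * s); split.
  split=> [|s t _ _ st|]; last by rewrite mulr0.
    by apply: continuous_subspaceT => s; exact: mulrl_continuous.
  by rewrite ltr_pM2l.
by move=> sigma x; exact: (initial_step f_smooth g_smooth V_smooth V_posdef dV).
Qed.
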